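(* Let $n\geq 1$ be an integer, let $D\geq 1$ be an odd square-free integer, and let $\chi$ be a primitive Dirichlet character mod $D$. There exists $K_0=K_0(n,D)$ such that for every even integer $K\geq K_0$ the following holds: if $\ell_1<\ell_2<\cdots<\ell_n$ are integers with $3\leq \ell_1$, $\ell_n\leq \frac{K-2}{2}$ and $\chi(-1)=(-1)^{\ell_i}$ for all $1\leq i\leq n$, then the twisted periods $r_{\ell_1-1,\chi},\dots,r_{\ell_n-1,\chi}$, viewed as elements of $\mathrm{Hom}_{\mathbb{C}}(S_K,\mathbb{C})$, are linearly independent over $\mathbb{C}$.
   Context: $S_K$ is the space of cusp forms of weight $K$ for $\mathrm{SL}_2(\mathbb{Z})$, $q=e^{2\pi i z}$. For $f(z)=\sum_{n\ge1}a_f(n)q^n\in S_K$ and a Dirichlet character $\chi$, put $f_\chi(z)=\sum_{n\geq1}\chi(n)a_f(n)q^n$ and $L(f,\chi,s)=\sum_{n\ge1}\chi(n)a_f(n)n^{-s}$ (analytically continued to $\mathbb{C}$). For a primitive Dirichlet character $\chi$ mod $D$ and $0\leq m\leq K-2$, the $m$-th twisted period is the linear functional on $S_K$ given by $r_{m,\chi}(f)=\int_0^{i\infty}f_\chi(z)z^m\,dz=\frac{m!}{(-2\pi i)^{m+1}}L(f,\chi,m+1)$. *)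

(* Defs.v *)
From Stdlib Require Import Reals ZArith Arith.
From Coquelicot Require Import Coquelicot.

Open Scope R_scope.

(** * Complex analysis *)

Definition Cexp (z : C) : C :=
  (exp (Re z) * cos (Im z), exp (Re z) * sin (Im z)).

(** Coquelicot's [Series] is real-valued; this is the sum of a complex series
    whenever it converges. *)
Definition CSeries (u : nat -> C) : C :=
  (Series (fun n => Re (u n)), Series (fun n => Im (u n))).

Definition in_upper_half_plane (z : C) : Prop := 0 < Im z.

Definition nome (z : C) : C := Cexp (RtoC (2 * PI) * Ci * z)%C.

(** * Dirichlet characters *)

Record dirichlet_character (D : nat) (chi : Z -> C) : Prop := {
  dirichlet_periodic : forall a : Z, chi (a + Z.of_nat D)%Z = chi a;
  dirichlet_mul : forall a b : Z, chi (a * b)%Z = (chi a * chi b)%C;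
  dirichlet_support : forall a : Z,
    chi a <> RtoC 0 <-> Z.gcd a (Z.of_nat D) = 1%Z
}.

(** Primitive: not induced by a character modulo a proper divisor of [D]. *)
Definition primitive_character (D : nat) (chi : Z -> C) : Prop :=
  dirichlet_character D chi /\
  forall (d : nat) (psi : Z -> C),
    Nat.divide d D ->
    dirichlet_character d psi ->
    (forall a : Z, Z.gcd a (Z.of_nat D) = 1%Z -> chi a = psi a) ->
    d = D.

Definition squarefree (D : nat) : Prop :=
  forall d : nat, Nat.divide (d * d) D -> d = 1%nat.

(** * Cusp forms for SL_2(Z) *)

(** [cusp_fun f] matters only on the upper half plane: its values elsewhere
    are unconstrained and never used.  The sequence [cusp_coef f] is
    determined by the restriction of [cusp_fun f] to the upper half plane. *)
Record cusp_form (K : nat) : Type := {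
  cusp_fun :> C -> C;
  cusp_coef : nat -> C;
  cusp_holomorphic : forall z : C, in_upper_half_plane z ->
    ex_derive (K := C_AbsRing) (V := C_NormedModule) cusp_fun z;
  cusp_modular : forall (a b c d : Z) (z : C),
    (a * d - b * c = 1)%Z -> in_upper_half_plane z ->
    cusp_fun ((RtoC (IZR a) * z + RtoC (IZR b)) /
              (RtoC (IZR c) * z + RtoC (IZR d)))%C
    = ((RtoC (IZR c) * z + RtoC (IZR d)) ^ K * cusp_fun z)%C;
  cusp_coef_0 : cusp_coef 0%nat = RtoC 0;
  cusp_expansion : forall z : C, in_upper_half_plane z ->
    is_series (K := C_AbsRing) (V := C_NormedModule)
      (fun n => (cusp_coef n * nome z ^ n)%C) (cusp_fun z)
}.

Arguments cusp_fun {K} f z : rename.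
Arguments cusp_coef {K} f n : rename.

(** The sum may start at [n = 0] because [cusp_coef f 0 = 0]. *)
Definition twist {K : nat} (chi : Z -> C) (f : cusp_form K) (z : C) : C :=
  CSeries (fun n => (chi (Z.of_nat n) * cusp_coef f n * nome z ^ n)%C).

(** The integral of [f_chi(z) z^m dz] along the imaginary axis from [0] to
    [i oo], parametrized by [z = i t], [dz = i dt]. *)
Definition twisted_period {K : nat} (m : nat) (chi : Z -> C)
    (f : cusp_form K) : C :=
  RInt_gen (V := C_R_CompleteNormedModule)
    (fun t : R => (twist chi f (Ci * RtoC t) * (Ci * RtoC t) ^ m * Ci)%C)
    (at_right 0) (Rbar_locally p_infty).

(** * Linear independence *)

(** Linear independence over [C] of [phi 1], ..., [phi n] in the space of
    complex-valued functions on [T], hence in any of its subspaces, such as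
    the linear functionals when [T] is a space of cusp forms. *)
Definition linearly_independent {T : Type} (n : nat) (phi : nat -> T -> C)
    : Prop :=
  forall c : nat -> C,
    (forall x : T,
       sum_n_m (G := C_AbelianMonoid) (fun i => (c i * phi i x)%C) 1 n
       = RtoC 0) ->
    forall i : nat, (1 <= i <= n)%nat -> c i = RtoC 0.

(* Main.v *)
(** Linear independence is tested on the Poincare series
    [P_k(z) = sum_(c,d)=1 (cz+d)^(-K) e(k gamma z)], [gamma] having bottom row [(c,d)].
    Writing [f_chi] through Gauss sums as a combination of the translates [f(z + a/D)], the
    period [r_(m,chi)(P_k)] is a sum over pairs [(c,d)].  The two pairs [+-(D,-a)], for which
    [gamma] sends the cusp [a/D] to infinity, contribute, with [l = m + 1], an explicit nonzero
    constant independent of [k] times [chi(-k)^(-1) k^(l-K) (K-l-1)!].  The pairs [(0,+-1)]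
    contribute [O((l-1)! (2 pi k)^(-l))], and all others [O(D^K)] because [|cz+d|] is bounded
    below on the line [Re z = a/D]; both are negligible as [K] grows, uniformly in
    [3 <= l <= (K-2)/2].  Taking [k = M^(2j)] for [1 <= j <= n] with [M] a large power of [2],
    which is prime to [D], the matrix of periods is, up to row and column factors, a small
    perturbation of the generalized Vandermonde matrix [M^(2 j l_i)], and it is diagonally
    dominant after scaling.

    That [P_k] has a [q]-expansion is proved without contour integration: the Fourier
    coefficients on horizontal lines are constant by the Cauchy-Riemann equations, and the
    Fourier series is summed by Chernoff's telescoping argument. *)

Require Import Defs.
From Stdlib Require Import Reals ZArith Arith Lia Lra List FinFun.
From Stdlib Require Import Znumtheory Permutation Classical ClassicalEpsilon FunctionalExtensionality.
From Coquelicot Require Import Coquelicot.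
Import ListNotations.
Local Open Scope R_scope.

(** * Complex exponential *)

(** The sum over pairs and the integral are never interchanged. On each line above [a/D] the
    explicit terms of [+-(D,-a)] are subtracted first; what remains, times [t^m], is bounded
    pointwise by an explicit integrable function, and only then is the integral taken. The range of
    [l] enters in that bound: [l >= 3] lets [t^m] absorb the [t^(-2)] that summability over the
    pairs costs near [0], and [l <= (K-2)/2] leaves the decay [1/(1+t^2)]. As [K_0] is chosen before
    [chi], Gauss sums are only estimated by [1 <= |g| <= D], a loss that the factorial absorbs. Sums
    over pairs are limits over finite sets ordered by inclusion, not enumerated series, because
    modularity comes from a permutation of the pairs. Holomorphy is carried along as a second-order
    remainder that is uniform on half-strips: such bounds can be summed over the lattice, and they
    show, by cutting an interval into small steps, that Fourier coefficients do not depend on the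
    height. *)

Lemma Cmod_minus_sym (a b : C) : Cmod (a - b) = Cmod (b - a).
Proof.
  rewrite <- Cmod_opp. f_equal. ring.
Qed.

Lemma Cmod_minus_triangle (a b c : C) : Cmod (a - c) <= Cmod (a - b) + Cmod (b - c).
Proof.
  replace (a - c)%C with ((a - b) + (b - c))%C by ring. apply Cmod_triangle.
Qed.

Lemma Cmod_ge_minus (a b : C) : Cmod a - Cmod b <= Cmod (a + b).
Proof.
  assert (H := Cmod_triangle (a + b) (- b)). rewrite Cmod_opp in H.
  replace ((a + b) + - b)%C with a in H by ring. lra.
Qed.

Lemma Cmod_le_abs (z : C) : Cmod z <= Rabs (Re z) + Rabs (Im z).
Proof.
  assert (H := Cmod2_alt z).
  assert (H1 := Rabs_pos (Re z)). assert (H2 := Rabs_pos (Im z)).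
  assert (H3 := pow2_abs (Re z)). assert (H4 := pow2_abs (Im z)).
  apply Rnot_lt_le. intro. nra.
Qed.

Lemma im_le_Cmod (z : C) : Rabs (Im z) <= Cmod z.
Proof.
  apply Rle_trans with (2 := Rmax_Cmod z). apply Rmax_r.
Qed.

Lemma C_ext (a b : C) : Re a = Re b -> Im a = Im b -> a = b.
Proof.
  destruct a, b; simpl; intros; subst; reflexivity.
Qed.

Lemma re_minus (a b : C) : Re (a - b) = Re a - Re b.
Proof. reflexivity. Qed.

Lemma im_minus (a b : C) : Im (a - b) = Im a - Im b.
Proof. reflexivity. Qed.

Lemma Cexp_plus (z w : C) : Cexp (z + w) = (Cexp z * Cexp w)%C.
Proof.
  unfold Cexp. rewrite re_plus, im_plus, exp_plus, cos_plus, sin_plus.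
  apply C_ext; rewrite ?re_mult, ?im_mult; simpl; ring.
Qed.

Lemma Cexp_0 : Cexp 0 = RtoC 1.
Proof.
  unfold Cexp. simpl. rewrite exp_0, cos_0, sin_0. apply C_ext; simpl; ring.
Qed.

Lemma Cmod_Cexp (z : C) : Cmod (Cexp z) = exp (Re z).
Proof.
  assert (H := exp_pos (Re z)).
  unfold Cmod, Cexp. simpl.
  replace (_ + _) with (Rsqr (exp (Re z))).
  - apply sqrt_Rsqr. lra.
  - assert (E := sin2_cos2 (Im z)). unfold Rsqr in *. nra.
Qed.

Lemma nome_plus (z w : C) : nome (z + w) = (nome z * nome w)%C.
Proof.
  unfold nome. rewrite Cmult_plus_distr_l. apply Cexp_plus.
Qed.

Lemma nome_0 : nome 0 = RtoC 1.
Proof.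
  unfold nome. rewrite Cmult_0_r. apply Cexp_0.
Qed.

Lemma re_2PI_Ci (z : C) : Re (RtoC (2 * PI) * Ci * z) = - (2 * PI) * Im z.
Proof.
  rewrite !re_mult, !im_mult. simpl. ring.
Qed.

Lemma im_2PI_Ci (z : C) : Im (RtoC (2 * PI) * Ci * z) = 2 * PI * Re z.
Proof.
  rewrite !im_mult, !re_mult. simpl. ring.
Qed.

Lemma Cmod_nome (z : C) : Cmod (nome z) = exp (- (2 * PI) * Im z).
Proof.
  unfold nome. now rewrite Cmod_Cexp, re_2PI_Ci.
Qed.

Lemma nome_neq_0 (z : C) : nome z <> RtoC 0.
Proof.
  apply Cmod_gt_0. rewrite Cmod_nome. apply exp_pos.
Qed.

Lemma nome_opp (z : C) : nome (- z) = (/ nome z)%C.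
Proof.
  assert (H : (nome (- z) * nome z)%C = RtoC 1).
  { rewrite <- nome_plus. replace (- z + z)%C with (RtoC 0) by ring. apply nome_0. }
  assert (N := nome_neq_0 z).
  replace (nome (- z)) with (nome (- z) * nome z * / nome z)%C by now field.
  rewrite H. ring.
Qed.

Lemma nome_nat (n : nat) : nome (RtoC (INR n)) = RtoC 1.
Proof.
  unfold nome, Cexp. rewrite re_2PI_Ci, im_2PI_Ci. simpl Re; simpl Im.
  rewrite Rmult_0_r, exp_0.
  replace (2 * PI * INR n) with (0 + 2 * INR n * PI) by ring.
  rewrite cos_period, sin_period, cos_0, sin_0.
  apply C_ext; simpl; ring.
Qed.

Lemma nome_Z (n : Z) : nome (RtoC (IZR n)) = RtoC 1.
Proof.
  destruct (Z_le_gt_dec 0 n) as [H | H].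
  - rewrite <- (Z2Nat.id n H), <- INR_IZR_INZ. apply nome_nat.
  - replace n with (- (Z.of_nat (Z.to_nat (- n))))%Z by lia.
    rewrite opp_IZR, <- INR_IZR_INZ, RtoC_opp, nome_opp, nome_nat.
    apply C_ext; simpl; field; lra.
Qed.

Lemma nome_plus_Z (z : C) (n : Z) : nome (z + RtoC (IZR n)) = nome z.
Proof.
  rewrite nome_plus, nome_Z. ring.
Qed.

Lemma nome_pow (z : C) (n : nat) : (nome z ^ n)%C = nome (RtoC (INR n) * z).
Proof.
  induction n as [| n IH].
  - simpl. rewrite Cmult_0_l. symmetry. apply nome_0.
  - rewrite Cpow_S, IH, <- nome_plus, S_INR, RtoC_plus. f_equal. ring.
Qed.

Lemma exp_quadratic (x : R) : Rabs x <= 1 / 2 -> Rabs (exp x - 1 - x) <= 2 * (x * x).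
Proof.
  intros Hx. apply Rabs_le_between in Hx.
  assert (H1 := exp_ineq1_le x). assert (H2 := exp_ineq1_le (- x)).
  assert (H4 : exp x * exp (- x) = 1)
    by (rewrite <- exp_plus; replace (x + - x) with 0 by ring; apply exp_0).
  rewrite Rabs_pos_eq by lra. nra.
Qed.

Lemma sin_abs_le (x : R) : Rabs (sin x) <= Rabs x.
Proof.
  assert (K : forall y, 0 < y -> Rabs (sin y) <= y).
  { intros y Hy. apply Rabs_le. assert (sin y < y) by (apply sin_lt_x; lra).
    destruct (Rle_dec y PI).
    - assert (0 <= sin y) by (apply sin_ge_0; lra). lra.
    - assert (- 1 <= sin y) by apply SIN_bound. assert (P := PI2_1). lra. }
  destruct (total_order_T x 0) as [[H | ->] | H].
  - specialize (K (- x)). rewrite sin_neg, Rabs_Ropp in K. rewrite (Rabs_left1 x); lra.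
  - rewrite sin_0. apply Rle_refl.
  - rewrite (Rabs_pos_eq x) by lra. now apply K.
Qed.

Lemma cos_quadratic (x : R) : Rabs (cos x - 1) <= x * x.
Proof.
  replace x with (2 * (x / 2)) at 1 by lra. rewrite cos_2a_sin.
  assert (H := sin_abs_le (x / 2)).
  replace (1 - 2 * sin (x / 2) * sin (x / 2) - 1) with (- (2 * Rsqr (sin (x / 2))))
    by (unfold Rsqr; ring).
  rewrite Rabs_Ropp, Rabs_pos_eq by (assert (Z := Rle_0_sqr (sin (x/2))); lra).
  apply Rsqr_le_abs_1 in H. unfold Rsqr in *. nra.
Qed.

Lemma sin_quadratic (x : R) : Rabs (sin x - x) <= x * x.
Proof.
  assert (K : forall y, 0 <= y -> 0 <= y - sin y <= y * y).
  { intros y Hy.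
    assert (S := sin_abs_le y). rewrite (Rabs_pos_eq y) in S by lra.
    apply Rabs_le_between in S. split; [lra |].
    destruct (Rle_dec 2 y); [assert (-1 <= sin y) by apply SIN_bound; nra |].
    destruct (Req_dec y 0) as [-> | N]; [rewrite sin_0; lra |].
    destruct (MVT_cor2 (fun t => sin t - t) (fun t => cos t - 1) 0 y) as [c [E [c1 c2]]].
    - lra.
    - intros c _. apply derivable_pt_lim_minus; [apply derivable_pt_lim_sin | apply derivable_pt_lim_id].
    - cbv beta in E. rewrite sin_0 in E.
      assert (Q := cos_quadratic c). apply Rabs_le_between in Q.
      destruct (Rle_dec y 1).
      + nra.
      + assert (0 <= sin y) by (apply sin_ge_0; assert (P := PI2_1); lra). nra. }
  destruct (Rle_dec 0 x) as [H | H].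
  - specialize (K x H). apply Rabs_le. lra.
  - specialize (K (- x)). rewrite sin_neg in K. apply Rabs_le. nra.
Qed.

(** Second-order remainders with explicit constants stand in for derivatives: they can be summed
    over the lattice pairs, which is how the Poincare series gets differentiated. *)
Lemma Cexp_quadratic (z : C) :
  Cmod z <= 1 / 2 -> Cmod (Cexp z - 1 - z) <= 16 * Cmod z ^ 2.
Proof.
  intros Hz.
  assert (A := re_le_Cmod z). assert (B := im_le_Cmod z).
  apply Rle_trans with (1 := Cmod_le_abs _).
  unfold Cexp. rewrite !re_minus, !im_minus. simpl (Re (_, _)). simpl (Im (_, _)).
  change (Re 1) with 1. change (Im 1) with 0.
  set (x := Re z) in *. set (y := Im z) in *.
  assert (X := exp_quadratic x ltac:(lra)). assert (Cc := cos_quadratic y).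
  assert (Ss := sin_quadratic y).
  assert (ax := Rabs_pos x). assert (ay := Rabs_pos y).
  assert (X2 : x * x <= Cmod z ^ 2) by (rewrite <- (Rabs_pos_eq (x * x)) by nra; rewrite Rabs_mult; nra).
  assert (Y2 : y * y <= Cmod z ^ 2) by (rewrite <- (Rabs_pos_eq (y * y)) by nra; rewrite Rabs_mult; nra).
  assert (XY : Rabs x * Rabs y <= Cmod z ^ 2) by nra.
  assert (E : Rabs (exp x - 1) <= 2 * Rabs x).
  { replace (exp x - 1) with ((exp x - 1 - x) + x) by ring.
    apply Rle_trans with (1 := Rabs_triang _ _).
    replace (x * x) with (Rabs x * Rabs x) in X by (rewrite <- Rabs_mult; apply Rabs_pos_eq; nra). nra. }
  assert (E2 : exp x <= 2) by (apply Rabs_le_between in E; lra).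
  assert (E0 := exp_pos x).
  replace (exp x * cos y - 1 - x) with ((exp x - 1 - x) + exp x * (cos y - 1)) by ring.
  replace (exp x * sin y - 0 - y) with (exp x * (sin y - y) + (exp x - 1) * y) by ring.
  assert (T1 := Rabs_triang (exp x - 1 - x) (exp x * (cos y - 1))).
  assert (T2 := Rabs_triang (exp x * (sin y - y)) ((exp x - 1) * y)).
  rewrite !Rabs_mult, (Rabs_pos_eq (exp x)) in T1, T2 by lra.
  assert (V1 : exp x * Rabs (cos y - 1) <= 2 * (y * y))
    by (apply Rmult_le_compat; try lra; apply Rabs_pos).
  assert (V2 : exp x * Rabs (sin y - y) <= 2 * (y * y))
    by (apply Rmult_le_compat; try lra; apply Rabs_pos).
  assert (V3 : Rabs (exp x - 1) * Rabs y <= 2 * Rabs x * Rabs y) by nra.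
  rewrite (Rabs_mult (exp x - 1)) in T2. assert (Z := pow2_ge_0 (Cmod z)). lra.
Qed.

(** * Unordered sums *)

Ltac mult_nonneg := repeat match goal with |- 0 <= _ * _ => apply Rmult_le_pos end.

Definition classical_dec {T : Type} (x y : T) : {x = y} + {x <> y} :=
  excluded_middle_informative (x = y).

Definition lsum {T : Type} (f : T -> C) (l : list T) : C :=
  fold_right (fun x s => (f x + s)%C) (RtoC 0) l.

Definition rsum {T : Type} (f : T -> R) (l : list T) : R :=
  fold_right (fun x s => f x + s) 0 l.

(** Convergence along finite subsets, represented by duplicate-free lists and directed by inclusion.
    It involves no enumeration of the index set and is visibly invariant under bijections. *)
Definition has_sum {T : Type} (f : T -> C) (s : C) : Prop :=
  forall eps : R, 0 < eps ->
  exists l0 : list T, forall l : list T, NoDup l -> incl l0 l ->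
    Cmod (lsum f l - s) < eps.

Definition abs_bounded {T : Type} (f : T -> C) (B : R) : Prop :=
  forall l : list T, NoDup l -> rsum (fun x => Cmod (f x)) l <= B.

Lemma rsum_nonneg {T} (f : T -> R) l : (forall x, 0 <= f x) -> 0 <= rsum f l.
Proof.
  intros H. induction l as [| x l IH]; simpl; [lra |]. specialize (H x). lra.
Qed.

Lemma rsum_le {T} (f g : T -> R) l :
  (forall x, In x l -> f x <= g x) -> rsum f l <= rsum g l.
Proof.
  induction l as [| x l IH]; simpl; intros H; [lra |].
  assert (H1 := H x (or_introl eq_refl)).
  assert (H2 := IH (fun y Hy => H y (or_intror Hy))). lra.
Qed.

Lemma rsum_scal {T} (c : R) (f : T -> R) l : rsum (fun x => c * f x) l = c * rsum f l.
Proof.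
  induction l as [| x l IH]; simpl; [ring |]. rewrite IH. ring.
Qed.

Lemma rsum_app {T} (f : T -> R) l1 l2 : rsum f (l1 ++ l2) = rsum f l1 + rsum f l2.
Proof.
  induction l1 as [| x l IH]; simpl; [ring |]. rewrite IH. ring.
Qed.

Lemma rsum_map {S T} (g : S -> T) (f : T -> R) l :
  rsum f (map g l) = rsum (fun x => f (g x)) l.
Proof.
  induction l as [| x l IH]; simpl; [easy |]. now rewrite IH.
Qed.

Lemma rsum_ext {T} (f g : T -> R) l : (forall x, In x l -> f x = g x) -> rsum f l = rsum g l.
Proof.
  induction l as [| x l IH]; simpl; intros H; [easy |].
  rewrite IH; [rewrite H |]; auto.
Qed.

Lemma rsum_incl {T} (f : T -> R) l l' :
  (forall x, 0 <= f x) -> NoDup l -> incl l l' -> rsum f l <= rsum f l'.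
Proof.
  intros Hf Hl. revert l'. induction Hl as [| x l Hx Hl IH]; intros l' Hi; simpl.
  - now apply rsum_nonneg.
  - destruct (in_split x l') as [l1 [l2 ->]]; [apply Hi; now left |].
    rewrite rsum_app. simpl. specialize (IH (l1 ++ l2)).
    rewrite rsum_app in IH.
    assert (incl l (l1 ++ l2)).
    { intros y Hy. assert (Y := Hi y (or_intror Hy)). apply in_app_or in Y.
      apply in_or_app. destruct Y as [Y | [Y | Y]]; auto. subst. tauto. }
    specialize (IH H). lra.
Qed.

Lemma lsum_app {T} (f : T -> C) l1 l2 : lsum f (l1 ++ l2) = (lsum f l1 + lsum f l2)%C.
Proof.
  induction l1 as [| x l IH]; simpl; [ring |]. rewrite IH. ring.
Qed.

Lemma lsum_map {S T} (g : S -> T) (f : T -> C) l :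
  lsum f (map g l) = lsum (fun x => f (g x)) l.
Proof.
  induction l as [| x l IH]; simpl; [easy |]. now rewrite IH.
Qed.

Lemma lsum_ext {T} (f g : T -> C) l : (forall x, In x l -> f x = g x) -> lsum f l = lsum g l.
Proof.
  induction l as [| x l IH]; simpl; intros H; [easy |].
  rewrite IH; [rewrite H |]; auto.
Qed.

Lemma lsum_plus {T} (f g : T -> C) l :
  lsum (fun x => (f x + g x)%C) l = (lsum f l + lsum g l)%C.
Proof.
  induction l as [| x l IH]; simpl; [ring |]. rewrite IH. ring.
Qed.

Lemma lsum_scal {T} (c : C) (f : T -> C) l : lsum (fun x => (c * f x)%C) l = (c * lsum f l)%C.
Proof.
  induction l as [| x l IH]; simpl; [ring |]. rewrite IH. ring.
Qed.

Lemma lsum_swap {S T} (f : S -> T -> C) l l' :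
  lsum (fun x => lsum (f x) l') l = lsum (fun y => lsum (fun x => f x y) l) l'.
Proof.
  induction l as [| x l IH]; simpl.
  - induction l' as [| y l' IH']; simpl; [easy |]. rewrite <- IH'. ring.
  - now rewrite IH, lsum_plus.
Qed.

Lemma Cmod_lsum_le {T} (f : T -> C) l : Cmod (lsum f l) <= rsum (fun x => Cmod (f x)) l.
Proof.
  induction l as [| x l IH]; simpl; [rewrite Cmod_0; lra |].
  apply Rle_trans with (1 := Cmod_triangle _ _). lra.
Qed.

Lemma lsum_RtoC {T} (f : T -> R) l : lsum (fun x => RtoC (f x)) l = RtoC (rsum f l).
Proof.
  induction l as [| x l IH]; simpl; [easy |]. now rewrite IH, RtoC_plus.
Qed.

Lemma Cmod_small_eq (a b : C) : (forall eps, 0 < eps -> Cmod (a - b) < eps) -> a = b.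
Proof.
  intros H. apply Ceq_minus. apply Cmod_eq_0.
  assert (P := Cmod_ge_0 (a - b)).
  destruct (Req_dec (Cmod (a - b)) 0) as [E | E]; [easy |].
  specialize (H (Cmod (a - b)) ltac:(lra)). lra.
Qed.

Lemma has_sum_unique {T} (f : T -> C) s s' : has_sum f s -> has_sum f s' -> s = s'.
Proof.
  intros H H'. apply Cmod_small_eq. intros eps He.
  destruct (H (eps / 2) ltac:(lra)) as [l0 H0].
  destruct (H' (eps / 2) ltac:(lra)) as [l1 H1].
  set (l := nodup classical_dec (l0 ++ l1)).
  assert (N : NoDup l) by apply NoDup_nodup.
  specialize (H0 l N). specialize (H1 l N).
  assert (I : forall x, In x (l0 ++ l1) -> In x l) by (intros x; apply nodup_In).
  apply Rle_lt_trans with (1 := Cmod_minus_triangle s (lsum f l) s').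
  rewrite (Cmod_minus_sym s).
  assert (Cmod (lsum f l - s) < eps / 2)
    by (apply H0; intros x Hx; apply I, in_or_app; auto).
  assert (Cmod (lsum f l - s') < eps / 2)
    by (apply H1; intros x Hx; apply I, in_or_app; auto).
  lra.
Qed.

Lemma has_sum_plus {T} (f g : T -> C) s s' :
  has_sum f s -> has_sum g s' -> has_sum (fun x => (f x + g x)%C) (s + s').
Proof.
  intros H H' eps He.
  destruct (H (eps / 2) ltac:(lra)) as [l0 H0].
  destruct (H' (eps / 2) ltac:(lra)) as [l1 H1].
  exists (l0 ++ l1). intros l N I. rewrite lsum_plus.
  replace (_ - _)%C with ((lsum f l - s) + (lsum g l - s'))%C by ring.
  apply Rle_lt_trans with (1 := Cmod_triangle _ _).
  specialize (H0 l N (proj1 (incl_app_inv _ _ I))). specialize (H1 l N (proj2 (incl_app_inv _ _ I))).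
  lra.
Qed.

Lemma has_sum_scal {T} (c : C) (f : T -> C) s :
  has_sum f s -> has_sum (fun x => (c * f x)%C) (c * s).
Proof.
  intros H eps He. assert (P := Cmod_ge_0 c).
  destruct (H (eps / (Cmod c + 1))) as [l0 H0]; [apply Rdiv_lt_0_compat; lra |].
  exists l0. intros l N I. specialize (H0 l N I). rewrite lsum_scal.
  replace (_ - _)%C with (c * (lsum f l - s))%C by ring. rewrite Cmod_mult.
  apply (Rmult_lt_compat_r (Cmod c + 1)) in H0; [| lra].
  unfold Rdiv in H0. rewrite Rmult_assoc, Rinv_l in H0; nra.
Qed.

Lemma has_sum_ext {T} (f g : T -> C) s :
  (forall x, f x = g x) -> has_sum f s -> has_sum g s.
Proof.
  intros E H. replace g with f by (apply functional_extensionality; exact E). exact H.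
Qed.

Lemma has_sum_reindex {T} (sigma tau : T -> T) (f : T -> C) s :
  (forall x, tau (sigma x) = x) -> (forall x, sigma (tau x) = x) ->
  has_sum f s -> has_sum (fun x => f (sigma x)) s.
Proof.
  intros E1 E2 H eps He. destruct (H eps He) as [l0 H0].
  exists (map tau l0). intros l N I. rewrite <- lsum_map. apply H0.
  - apply Injective_map_NoDup; [| exact N].
    intros x y Hxy. now rewrite <- (E1 x), Hxy.
  - intros x Hx. rewrite <- (E2 x). apply in_map, I, in_map, Hx.
Qed.

(** Serves to split four exceptional pairs off a Poincare series. A finite set witnessing the limit
    may be enlarged by [L], and its part outside [L] contributes at most [B]. *)
Lemma has_sum_off_list {T} (f : T -> C) s (L : list T) B :
  has_sum f s -> NoDup L ->
  (forall l, NoDup l -> (forall x, In x l -> ~ In x L) ->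
     rsum (fun x => Cmod (f x)) l <= B) ->
  Cmod (s - lsum f L) <= B.
Proof.
  intros H HL Hb. apply le_epsilon. intros eps He.
  destruct (H eps He) as [l0 H0].
  set (l1 := filter (fun x => if in_dec classical_dec x L then false else true)
                    (nodup classical_dec l0)).
  assert (M : forall x, In x l1 <-> In x l0 /\ ~ In x L).
  { intros x. unfold l1. rewrite filter_In, nodup_In.
    destruct (in_dec classical_dec x L); intuition discriminate. }
  assert (N1 : NoDup l1) by apply NoDup_filter, NoDup_nodup.
  assert (N : NoDup (L ++ l1)) by (apply NoDup_app; auto; intros x Hx Hy; now apply M in Hy).
  specialize (H0 _ N). rewrite lsum_app in H0.
  assert (I : incl l0 (L ++ l1)).
  { intros x Hx. apply in_or_app. destruct (classic (In x L)); [now left | right].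
    now apply M. }
  specialize (H0 I). rewrite Cmod_minus_sym in H0.
  specialize (Hb l1 N1 (fun x Hx => proj2 (proj1 (M x) Hx))).
  assert (Q := Cmod_lsum_le f l1).
  replace (s - lsum f L)%C with ((s - (lsum f L + lsum f l1)) + lsum f l1)%C by ring.
  apply Rle_trans with (1 := Cmod_triangle _ _). lra.
Qed.

Lemma has_sum_bound {T} (f : T -> C) s B : has_sum f s -> abs_bounded f B -> Cmod s <= B.
Proof.
  intros H Hb. replace s with (s - lsum f [])%C by (simpl; ring).
  apply has_sum_off_list with (1 := H); [constructor |]. intros l N _. now apply Hb.
Qed.

Lemma has_sum_nonneg {T} (f : T -> R) B :
  (forall x, 0 <= f x) -> (forall l, NoDup l -> rsum f l <= B) ->
  exists s, has_sum (fun x => RtoC (f x)) s.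
Proof.
  intros Hf Hb.
  destruct (completeness (fun r => exists l, NoDup l /\ r = rsum f l)) as [s [S1 S2]].
  - exists B. intros r [l [N ->]]. now apply Hb.
  - exists 0, []. split; [constructor | easy].
  - exists (RtoC s). intros eps He.
    destruct (classic (exists l, NoDup l /\ s - eps < rsum f l)) as [[l0 [N0 H0]] | No].
    + exists l0. intros l N I. rewrite lsum_RtoC, <- RtoC_minus, Cmod_R.
      assert (rsum f l0 <= rsum f l) by now apply rsum_incl.
      assert (rsum f l <= s) by (apply S1; now exists l).
      apply Rabs_def1; lra.
    + exfalso. assert (s <= s - eps); [| lra]. apply S2. intros r [l [N ->]].
      apply Rnot_lt_le. intros Q. apply No. now exists l.
Qed.

(** [f] is the difference of the nonnegative families [|f| + f] and [|f|], whose finite sums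
    converge to their supremum. *)
Lemma has_sum_real {T} (f : T -> R) B :
  (forall l, NoDup l -> rsum (fun x => Rabs (f x)) l <= B) ->
  exists s, has_sum (fun x => RtoC (f x)) s.
Proof.
  intros Hb.
  destruct (has_sum_nonneg (fun x => Rabs (f x)) B) as [s1 H1].
  { intros; apply Rabs_pos. } { exact Hb. }
  destruct (has_sum_nonneg (fun x => Rabs (f x) + f x) (2 * B)) as [s2 H2].
  { intros x. assert (Q := Rle_abs (- f x)). rewrite Rabs_Ropp in Q. lra. }
  { intros l N. specialize (Hb l N).
    apply Rle_trans with (rsum (fun x => 2 * Rabs (f x)) l).
    - apply rsum_le. intros x _. assert (Q := Rle_abs (f x)). lra.
    - rewrite rsum_scal. lra. }
  exists (s2 + (- (1)) * s1)%C.
  apply has_sum_ext with (f := fun x => (RtoC (Rabs (f x) + f x) + (-(1)) * RtoC (Rabs (f x)))%C).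
  - intros x. rewrite RtoC_plus. ring.
  - apply has_sum_plus; [exact H2 | now apply has_sum_scal].
Qed.

Lemma has_sum_exists {T} (f : T -> C) B : abs_bounded f B -> exists s, has_sum f s.
Proof.
  intros Hb.
  destruct (has_sum_real (fun x => Re (f x)) B) as [s1 H1].
  { intros l N. apply Rle_trans with (2 := Hb l N), rsum_le. intros; apply re_le_Cmod. }
  destruct (has_sum_real (fun x => Im (f x)) B) as [s2 H2].
  { intros l N. apply Rle_trans with (2 := Hb l N), rsum_le. intros; apply im_le_Cmod. }
  exists (s1 + Ci * s2)%C.
  apply has_sum_ext with (f := fun x => (RtoC (Re (f x)) + Ci * RtoC (Im (f x)))%C).
  - intros x. apply C_ext; rewrite ?re_plus, ?im_plus, ?re_mult, ?im_mult; simpl; ring.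
  - apply has_sum_plus; [exact H1 | now apply has_sum_scal].
Qed.

(** Choice returns an arbitrary value when [f] has no sum, so every use is backed by a proof of
    summability. *)
Definition usum {T : Type} (f : T -> C) : C := epsilon (inhabits (RtoC 0)) (has_sum f).

Lemma usum_correct {T} (f : T -> C) B : abs_bounded f B -> has_sum f (usum f).
Proof.
  intros H. unfold usum. apply epsilon_spec. now apply has_sum_exists with B.
Qed.

Lemma usum_unique {T} (f : T -> C) s : has_sum f s -> usum f = s.
Proof.
  intros H. apply has_sum_unique with f; [unfold usum; apply epsilon_spec; now exists s | exact H].
Qed.

Lemma abs_bounded_le {T} (f : T -> C) (g : T -> R) A B :
  0 <= A -> (forall x, Cmod (f x) <= A * g x) ->
  (forall l, NoDup l -> rsum g l <= B) -> abs_bounded f (A * B).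
Proof.
  intros HA H Hg l N. apply Rle_trans with (rsum (fun x => A * g x) l).
  - apply rsum_le. intros; apply H.
  - rewrite rsum_scal. apply Rmult_le_compat_l; auto.
Qed.

(** * Poincare series *)

Lemma Rinv_0_le_compat (x : R) : 0 <= x -> 0 <= / x.
Proof.
  intros [H | <-]; [left; now apply Rinv_0_lt_compat | rewrite Rinv_0; lra].
Qed.

(** A product of one-variable weights, so that its sum factors. Every sum over pairs below is
    dominated by a multiple of it. *)
Definition lattice_weight (p : Z * Z) : R :=
  / ((1 + IZR (fst p) ^ 2) * (1 + IZR (snd p) ^ 2)).

(** Telescopes: [1 + (x+1)^2 >= (x+1)(x+2)/2] makes each term at most [2/(x+1) - 2/(x+2)]. *)
Lemma inv_square_sum_seq (N : nat) :
  rsum (fun i => / (1 + INR i ^ 2)) (seq 1 N) <= 2 - 2 / (INR N + 1).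
Proof.
  induction N as [| N IH].
  - simpl. replace (2 / (0 + 1)) with 2 by field. lra.
  - rewrite seq_S, rsum_app.
    change (rsum (fun i => / (1 + INR i ^ 2)) [(1 + N)%nat]) with (/ (1 + INR (S N) ^ 2) + 0). rewrite !S_INR.
    assert (0 <= INR N) by apply pos_INR. set (x := INR N) in *.
    assert (/ (1 + (x + 1) ^ 2) <= 2 / (x + 1) - 2 / (x + 1 + 1)).
    { replace (2 / (x + 1) - 2 / (x + 1 + 1)) with (/ ((x + 1) * (x + 2) / 2)) by (field; lra).
      apply Rinv_le_contravar; nra. }
    lra.
Qed.

Lemma inv_square_sum_Z (l : list Z) :
  NoDup l -> rsum (fun n => / (1 + IZR n ^ 2)) l <= 5.
Proof.
  intros N.
  assert (P : forall n, 0 <= / (1 + IZR n ^ 2)).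
  { intros n. left. apply Rinv_0_lt_compat. assert (Q := pow2_ge_0 (IZR n)). lra. }
  assert (B : exists M, forall x, In x l -> (Z.abs x <= Z.of_nat M)%Z).
  { clear N. induction l as [| x l [M IH]].
    - now exists 0%nat.
    - exists (Nat.max M (Z.to_nat (Z.abs x))). intros y [-> | Hy]; [lia |].
      specialize (IH y Hy). lia. }
  destruct B as [M HM].
  apply Rle_trans with (rsum (fun n => / (1 + IZR n ^ 2))
    (0%Z :: map Z.of_nat (seq 1 M) ++ map (fun i => (- Z.of_nat i)%Z) (seq 1 M))).
  - apply rsum_incl; auto. intros x Hx. specialize (HM x Hx).
    destruct (Z.eq_dec x 0) as [-> | Nx]; [now left | right].
    apply in_or_app. destruct (Z_le_gt_dec 0 x).
    + left. apply in_map_iff. exists (Z.to_nat x). rewrite in_seq. lia.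
    + right. apply in_map_iff. exists (Z.to_nat (- x)). rewrite in_seq. lia.
  - simpl rsum. rewrite rsum_app, !rsum_map.
    assert (S := inv_square_sum_seq M).
    rewrite (rsum_ext (fun x => / (1 + IZR (Z.of_nat x) ^ 2)) (fun i => / (1 + INR i ^ 2)))
      by (intros; now rewrite <- INR_IZR_INZ).
    rewrite (rsum_ext (fun x => / (1 + IZR (- Z.of_nat x) ^ 2)) (fun i => / (1 + INR i ^ 2)))
      by (intros; rewrite opp_IZR, <- INR_IZR_INZ; do 2 f_equal; ring).
    assert (0 <= 2 / (INR M + 1)).
    { apply Rdiv_le_0_compat; assert (Q := pos_INR M); lra. }
    lra.
Qed.

Lemma rsum_list_prod {S T} (f : S -> R) (g : T -> R) l l' :
  rsum (fun p => f (fst p) * g (snd p)) (list_prod l l') = rsum f l * rsum g l'.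
Proof.
  induction l as [| x l IH]; simpl; [ring |].
  rewrite rsum_app, rsum_map, IH. simpl. rewrite rsum_scal. ring.
Qed.

Lemma lattice_weight_pos p : 0 < lattice_weight p.
Proof.
  apply Rinv_0_lt_compat, Rmult_lt_0_compat;
    [assert (Q := pow2_ge_0 (IZR (fst p))) | assert (Q := pow2_ge_0 (IZR (snd p)))]; lra.
Qed.

(** A finite set of pairs sits inside the product of its two projections, over which the sum
    factors; hence [25 = 5 * 5]. *)
Lemma lattice_weight_sum (l : list (Z * Z)) : NoDup l -> rsum lattice_weight l <= 25.
Proof.
  intros N.
  set (A := nodup Z.eq_dec (map fst l)). set (B := nodup Z.eq_dec (map snd l)).
  apply Rle_trans with (rsum lattice_weight (list_prod A B)).
  - apply rsum_incl; auto.
    + intros p. left. apply lattice_weight_pos.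
    + intros [c d] H. apply in_prod; apply nodup_In, in_map_iff; now exists (c, d).
  - rewrite (rsum_ext _ (fun p => / (1 + IZR (fst p) ^ 2) * / (1 + IZR (snd p) ^ 2)))
      by (intros; unfold lattice_weight; apply Rinv_mult).
    rewrite (rsum_list_prod (fun n => / (1 + IZR n ^ 2)) (fun n => / (1 + IZR n ^ 2))).
    assert (HA := inv_square_sum_Z A (NoDup_nodup _ _)).
    assert (HB := inv_square_sum_Z B (NoDup_nodup _ _)).
    assert (PB : 0 <= rsum (fun n => / (1 + IZR n ^ 2)) B).
    { apply rsum_nonneg. intros n. left. apply Rinv_0_lt_compat.
      assert (Q := pow2_ge_0 (IZR n)). lra. }
    nra.
Qed.

Definition zlin (c d : Z) (z : C) : C := (RtoC (IZR c) * z + RtoC (IZR d))%C.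

Lemma re_zlin c d z : Re (zlin c d z) = IZR c * Re z + IZR d.
Proof. unfold zlin. rewrite re_plus, re_mult. simpl. ring. Qed.

Lemma im_zlin c d z : Im (zlin c d z) = IZR c * Im z.
Proof. unfold zlin. rewrite im_plus, im_mult. simpl. ring. Qed.

(** The imaginary part of [cz + d] controls [c] because [Im z >= y1]; then the real part controls
    [d] because [|Re z| <= X]. So [|cz + d|] dominates the norm of [(c,d)], with one constant for
    the whole half-strip. *)
Lemma zlin_lower_bound (X y1 : R) : 0 < y1 ->
  exists delta, 0 < delta /\ forall c d z, Rabs (Re z) <= X -> y1 <= Im z ->
    delta ^ 2 * (IZR c ^ 2 + IZR d ^ 2) <= Cmod (zlin c d z) ^ 2.
Proof.
  intros Hy.
  assert (P0 := pow2_ge_0 X). assert (P1 : 0 < y1 ^ 2) by (apply pow_lt; lra).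
  (* In [v^2 <= 2 (ux + v)^2 + 2 u^2 X^2], the first square is paid for by [A >= 2], and the [u^2]
     terms by [A y1^2 >= 2 X^2 + 1]. *)
  set (A := 2 + (2 * X ^ 2 + 1) / y1 ^ 2).
  assert (HA : 2 <= A) by (assert (0 <= (2 * X ^ 2 + 1) / y1 ^ 2)
    by (apply Rdiv_le_0_compat; lra); unfold A; lra).
  exists (sqrt (/ A)). split; [apply sqrt_lt_R0, Rinv_0_lt_compat; lra |].
  intros c d z Hx Hyz.
  rewrite pow2_sqrt by (left; apply Rinv_0_lt_compat; lra).
  apply Rmult_le_reg_l with A; [lra |]. rewrite <- Rmult_assoc, Rinv_r, Rmult_1_l by lra.
  rewrite Cmod2_alt, re_zlin, im_zlin.
  set (x := Re z) in *. set (y := Im z) in *. set (u := IZR c). set (v := IZR d).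
  assert (X2 : x ^ 2 <= X ^ 2) by (rewrite <- (pow2_abs x); apply pow_incr; split; [apply Rabs_pos | easy]).
  assert (Y2 : y1 ^ 2 <= y ^ 2) by (apply pow_incr; lra).
  assert (E : A * (y1 ^ 2) = 2 * y1 ^ 2 + (2 * X ^ 2 + 1)) by (unfold A; field; lra).
  assert (U : 0 <= u ^ 2) by apply pow2_ge_0.
  assert (G : v ^ 2 <= 2 * (u * x + v) ^ 2 + 2 * (u ^ 2 * X ^ 2)).
  {
    assert (Q := pow2_ge_0 (u * x + v + u * x)). nra. }
  assert (G2 : (2 * X ^ 2 + 1) * u ^ 2 <= A * (u * y) ^ 2).
  { rewrite Rpow_mult_distr.
    apply Rle_trans with (A * (u ^ 2 * y1 ^ 2)).
    - replace (A * (u ^ 2 * y1 ^ 2)) with (u ^ 2 * (A * y1 ^ 2)) by ring. rewrite E. nra.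
    - apply Rmult_le_compat_l; [lra |]. apply Rmult_le_compat_l; lra. }
  assert (G3 := pow2_ge_0 (u * x + v)). nra.
Qed.

Lemma zlin_neq_0 c d z : 0 < Im z -> (c, d) <> (0%Z, 0%Z) -> zlin c d z <> RtoC 0.
Proof.
  intros Hz N E. assert (R1 := re_zlin c d z). assert (R2 := im_zlin c d z).
  rewrite E in R1, R2. simpl in R1, R2. apply N.
  assert (IZR c = 0) by (destruct (Rmult_integral _ _ (eq_sym R2)); lra).
  assert (IZR d = 0) by (rewrite H in R1; lra).
  apply eq_IZR in H, H0. now subst.
Qed.

Lemma IZR_sq_sum_ge_1 c d : (c, d) <> (0%Z, 0%Z) -> 1 <= IZR c ^ 2 + IZR d ^ 2.
Proof.
  intros N. rewrite !pow_IZR, <- plus_IZR. apply IZR_le.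
  assert (c <> 0 \/ d <> 0)%Z.
  { destruct (Z.eq_dec c 0), (Z.eq_dec d 0); subst; auto; now elim N. }
  change (Z.of_nat 2) with 2%Z. nia.
Qed.

(** Four of the [K] factors pay for summability, through [(1 + u^2)(1 + v^2) <= 3 (u^2 + v^2)^2],
    valid since [u^2 + v^2 >= 1]. The other factors are only bounded below by [delta]. *)
Lemma zlin_pow_bound (K : nat) (delta : R) c d z :
  (4 <= K)%nat -> 0 < delta -> (c, d) <> (0%Z, 0%Z) ->
  delta ^ 2 * (IZR c ^ 2 + IZR d ^ 2) <= Cmod (zlin c d z) ^ 2 ->
  / Cmod (zlin c d z) ^ K <= 3 * / delta ^ K * lattice_weight (c, d).
Proof.
  intros HK Hd N H. unfold lattice_weight. simpl fst; simpl snd.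
  assert (R1 := IZR_sq_sum_ge_1 c d N).
  set (u := IZR c) in *. set (v := IZR d) in *. set (m := Cmod _) in *.
  assert (M0 : 0 <= m) by apply Cmod_ge_0.
  assert (D2 : 0 < delta ^ 2) by (apply pow_lt; lra).
  assert (Hm : delta <= m) by (apply Rsqr_incr_0_var; [unfold Rsqr; nra | easy]).
  assert (U := pow2_ge_0 u). assert (V := pow2_ge_0 v).
  replace K with (4 + (K - 4))%nat by lia. rewrite !pow_add.
  assert (D4 : 0 < delta ^ 4) by (apply pow_lt; lra).
  assert (DK : 0 < delta ^ (K - 4)) by (apply pow_lt; lra).
  assert (P4 : delta ^ 4 * ((1 + u ^ 2) * (1 + v ^ 2) / 3) <= m ^ 4).
  { apply Rle_trans with ((delta ^ 2 * (u ^ 2 + v ^ 2)) ^ 2).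
    - replace ((delta ^ 2 * (u ^ 2 + v ^ 2)) ^ 2) with (delta ^ 4 * (u ^ 2 + v ^ 2) ^ 2) by ring.
      apply Rmult_le_compat_l; [lra |]. nra.
    - replace (m ^ 4) with ((m ^ 2) ^ 2) by ring. apply pow_incr. split; [| easy].
      apply Rmult_le_pos; lra. }
  assert (PK : delta ^ (K - 4) <= m ^ (K - 4)) by (apply pow_incr; lra).
  replace (3 * / (delta ^ 4 * delta ^ (K - 4)) * / ((1 + u ^ 2) * (1 + v ^ 2)))
    with (/ ((delta ^ 4 * ((1 + u ^ 2) * (1 + v ^ 2) / 3)) * delta ^ (K - 4)))
    by (field; repeat split; lra).
  assert (0 < delta ^ 4 * ((1 + u ^ 2) * (1 + v ^ 2) / 3)).
  { apply Rmult_lt_0_compat; [lra |]. nra. }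
  apply Rinv_le_contravar.
  - apply Rmult_lt_0_compat; lra.
  - apply Rmult_le_compat; lra.
Qed.

Lemma gcd_1_iff c d : Z.gcd c d = 1%Z <-> exists a b, (a * d - b * c = 1)%Z.
Proof.
  split.
  - intros H. apply Zgcd_1_rel_prime, rel_prime_bezout in H. destruct H as [u v E].
    exists v, (- u)%Z. lia.
  - intros [a [b E]].
    assert (H1 := Z.gcd_divide_l c d). assert (H2 := Z.gcd_divide_r c d).
    assert (H : (Z.gcd c d | 1)%Z).
    { rewrite <- E. apply Z.divide_sub_r; now apply Z.divide_mul_r. }
    apply Z.divide_1_r_nonneg in H; [easy | apply Z.gcd_nonneg].
Qed.

Lemma gcd_1_neq_0 c d : Z.gcd c d = 1%Z -> (c, d) <> (0%Z, 0%Z).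
Proof.
  intros H E. injection E as -> ->. discriminate.
Qed.

Lemma im_mobius a b c d z : (a * d - b * c = 1)%Z -> 0 < Im z ->
  Im (zlin a b z / zlin c d z) = Im z / Cmod (zlin c d z) ^ 2.
Proof.
  intros E Hz.
  assert (N : zlin c d z <> RtoC 0).
  { apply zlin_neq_0; auto. apply gcd_1_neq_0, gcd_1_iff. eauto. }
  assert (M : 0 < Cmod (zlin c d z) ^ 2) by (apply pow_lt, Cmod_gt_0, N).
  rewrite Cmod2_alt in *.
  assert (F : forall u v : C, Re v ^ 2 + Im v ^ 2 <> 0 ->
     Im (u / v) = (Im u * Re v - Re u * Im v) / (Re v ^ 2 + Im v ^ 2)).
  { intros [u1 u2] [v1 v2]. simpl. intros. field. lra. }
  rewrite F by lra. f_equal. rewrite !re_zlin, !im_zlin.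
  apply (f_equal IZR) in E. rewrite minus_IZR, !mult_IZR in E.
  transitivity ((IZR a * IZR d - IZR b * IZR c) * Im z); [ring |]. rewrite E. ring.
Qed.

Lemma unimodular_translate a b a' b' c d :
  (a * d - b * c = 1)%Z -> (a' * d - b' * c = 1)%Z ->
  exists t, (a' = a + t * c /\ b' = b + t * d)%Z.
Proof.
  intros E E'. exists (a * (b' - b) - b * (a' - a))%Z.
  assert (F : ((a' - a) * d = (b' - b) * c)%Z) by lia.
  split.
  - replace ((a * (b' - b) - b * (a' - a)) * c)%Z
      with (a * ((b' - b) * c) - b * c * (a' - a))%Z by ring.
    rewrite <- F. replace (a * ((a' - a) * d) - b * c * (a' - a))%Z
      with ((a' - a) * (a * d - b * c))%Z by ring. rewrite E. ring.
  - replace ((a * (b' - b) - b * (a' - a)) * d)%Z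
      with (a * d * (b' - b) - b * ((a' - a) * d))%Z by ring.
    rewrite F. replace (a * d * (b' - b) - b * ((b' - b) * c))%Z
      with ((b' - b) * (a * d - b * c))%Z by ring. rewrite E. ring.
Qed.

Definition bezout_row (c d : Z) : Z * Z :=
  epsilon (inhabits (0%Z, 0%Z)) (fun p => (fst p * d - snd p * c = 1)%Z).

(** Pairs that are not coprime get the value [0], so that the index set is the whole lattice and
    lattice bounds apply. Both [(c,d)] and [(-c,-d)] are counted: hence the factors [2] below. *)
Definition poincare_term (K k : nat) (p : Z * Z) (z : C) : C :=
  let (c, d) := p in
  let (a, b) := bezout_row c d in
  if Z.eq_dec (Z.gcd c d) 1 then
    (/ zlin c d z ^ K * nome (RtoC (INR k) * (zlin a b z / zlin c d z)))%C
  else RtoC 0.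

(** Two unimodular matrices with the same bottom row differ by a translation [t] on the left, which
    moves the image point by the integer [t]; [nome] has period [1], so every top row gives the same
    term. *)
Lemma poincare_term_eq K k a b c d z :
  (a * d - b * c = 1)%Z -> 0 < Im z ->
  poincare_term K k (c, d) z =
    (/ zlin c d z ^ K * nome (RtoC (INR k) * (zlin a b z / zlin c d z)))%C.
Proof.
  intros E Hz. unfold poincare_term.
  assert (G : Z.gcd c d = 1%Z) by (apply gcd_1_iff; eauto).
  assert (S : (fst (bezout_row c d) * d - snd (bezout_row c d) * c = 1)%Z).
  { unfold bezout_row. apply epsilon_spec. now exists (a, b). }
  destruct (bezout_row c d) as [a' b']. simpl in S.
  destruct (Z.eq_dec (Z.gcd c d) 1); [| easy].
  f_equal. assert (N := zlin_neq_0 c d z Hz (gcd_1_neq_0 c d G)).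
  destruct (unimodular_translate a b a' b' c d E S) as [t [-> ->]].
  symmetry. rewrite <- (nome_plus_Z _ (Z.of_nat k * t)). f_equal.
  rewrite INR_IZR_INZ.
  replace (zlin (a + t * c) (b + t * d) z) with (zlin a b z + RtoC (IZR t) * zlin c d z)%C.
  - rewrite mult_IZR, RtoC_mult. field. exact N.
  - unfold zlin. rewrite !plus_IZR, !mult_IZR, !RtoC_plus, !RtoC_mult. ring.
Qed.

Lemma poincare_term_not_coprime K k c d z :
  Z.gcd c d <> 1%Z -> poincare_term K k (c, d) z = RtoC 0.
Proof.
  intros N. unfold poincare_term. destruct (bezout_row c d).
  now destruct (Z.eq_dec (Z.gcd c d) 1).
Qed.

Lemma Cmod_nome_mobius_le k a b c d z :
  (a * d - b * c = 1)%Z -> 0 < Im z ->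
  Cmod (nome (RtoC (INR k) * (zlin a b z / zlin c d z))) <= 1.
Proof.
  intros E Hz. rewrite Cmod_nome, im_scal_l, (im_mobius _ _ _ _ _ E Hz).
  assert (0 <= Im z / Cmod (zlin c d z) ^ 2).
  { apply Rmult_le_pos; [lra |]. apply Rinv_0_le_compat, pow2_ge_0. }
  assert (H0 := pos_INR k). assert (P := PI_RGT_0).
  assert (M : - (2 * PI) * (INR k * (Im z / Cmod (zlin c d z) ^ 2)) <= 0).
  { assert (0 <= INR k * (Im z / Cmod (zlin c d z) ^ 2)) by now apply Rmult_le_pos. nra. }
  destruct (Rle_lt_or_eq_dec _ _ M) as [L | ->].
  - left. rewrite <- exp_0. now apply exp_increasing.
  - rewrite exp_0. lra.
Qed.

Lemma Cmod_poincare_term_le K k c d z :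
  0 < Im z -> Cmod (poincare_term K k (c, d) z) <= / Cmod (zlin c d z) ^ K.
Proof.
  intros Hz. destruct (Z.eq_dec (Z.gcd c d) 1) as [G | G].
  - assert (N := zlin_neq_0 c d z Hz (gcd_1_neq_0 c d G)).
    destruct (proj1 (gcd_1_iff c d) G) as [a [b E]].
    rewrite (poincare_term_eq K k a b c d z E Hz).
    assert (B := Cmod_nome_mobius_le k a b c d z E Hz).
    rewrite Cmod_mult, Cmod_inv, Cmod_pow by now apply Cpow_nz.
    assert (0 <= / Cmod (zlin c d z) ^ K)
      by (apply Rinv_0_le_compat, pow_le, Cmod_ge_0). nra.
  - rewrite poincare_term_not_coprime, Cmod_0 by easy.
    apply Rinv_0_le_compat, pow_le, Cmod_ge_0.
Qed.

Lemma Cmod_poincare_term_weight (X y1 : R) (K k : nat) : 0 < y1 -> (4 <= K)%nat ->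
  exists A, 0 <= A /\ forall p z, Rabs (Re z) <= X -> y1 <= Im z ->
    Cmod (poincare_term K k p z) <= A * lattice_weight p.
Proof.
  intros Hy HK. destruct (zlin_lower_bound X y1 Hy) as [delta [D H]].
  assert (DK : 0 < / delta ^ K) by (apply Rinv_0_lt_compat, pow_lt, D).
  exists (3 * / delta ^ K). split; [lra |].
  intros [c d] z Hx Hz. assert (W := lattice_weight_pos (c, d)).
  destruct (Z.eq_dec (Z.gcd c d) 1) as [G | G].
  - apply Rle_trans with (1 := Cmod_poincare_term_le K k c d z ltac:(lra)).
    apply zlin_pow_bound; auto. now apply gcd_1_neq_0.
  - rewrite poincare_term_not_coprime, Cmod_0 by easy. apply Rmult_le_pos; lra.
Qed.

Definition poincare (K k : nat) (z : C) : C := usum (fun p => poincare_term K k p z).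

Lemma poincare_abs_bounded K k z : (4 <= K)%nat -> 0 < Im z ->
  exists B, abs_bounded (fun p => poincare_term K k p z) B.
Proof.
  intros HK Hz.
  destruct (Cmod_poincare_term_weight (Rabs (Re z)) (Im z) K k Hz HK) as [A [HA H]].
  exists (A * 25). apply abs_bounded_le with lattice_weight; auto.
  - intros p. apply H; lra.
  - apply lattice_weight_sum.
Qed.

Lemma poincare_has_sum K k z : (4 <= K)%nat -> 0 < Im z ->
  has_sum (fun p => poincare_term K k p z) (poincare K k z).
Proof.
  intros HK Hz. destruct (poincare_abs_bounded K k z HK Hz) as [B HB].
  now apply usum_correct with B.
Qed.

Definition row_action (a b c d : Z) (p : Z * Z) : Z * Z :=
  (fst p * a + snd p * c, fst p * b + snd p * d)%Z.

Lemma zlin_mobius a b c d u v z : zlin c d z <> RtoC 0 ->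
  (zlin u v (zlin a b z / zlin c d z) * zlin c d z)%C
  = zlin (u * a + v * c) (u * b + v * d) z.
Proof.
  intros N.
  replace (zlin u v (zlin a b z / zlin c d z) * zlin c d z)%C
    with (RtoC (IZR u) * zlin a b z + RtoC (IZR v) * zlin c d z)%C.
  - unfold zlin. rewrite !plus_IZR, !mult_IZR, !RtoC_plus, !RtoC_mult. ring.
  - unfold zlin at 3. field. exact N.
Qed.

(** Matrix multiplication acts on bottom rows from the right, and [zlin] obeys the cocycle rule.
    Modularity of the series then amounts to permuting its index set by [row_action], inverted by
    the inverse matrix. *)
Lemma poincare_term_mobius K k a b c d p z :
  (a * d - b * c = 1)%Z -> 0 < Im z ->
  poincare_term K k p (zlin a b z / zlin c d z)
  = (zlin c d z ^ K * poincare_term K k (row_action a b c d p) z)%C.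
Proof.
  intros E Hz. destruct p as [u v]. unfold row_action. simpl fst; simpl snd.
  assert (N : zlin c d z <> RtoC 0).
  { apply zlin_neq_0; auto. apply gcd_1_neq_0, gcd_1_iff. eauto. }
  assert (Hw : 0 < Im (zlin a b z / zlin c d z)).
  { rewrite im_mobius by auto. apply Rdiv_lt_0_compat; [easy |]. apply pow_lt, Cmod_gt_0, N. }
  destruct (Z.eq_dec (Z.gcd u v) 1) as [G | G].
  - assert (Nw := zlin_neq_0 u v _ Hw (gcd_1_neq_0 u v G)).
    destruct (proj1 (gcd_1_iff u v) G) as [s [t F]].
    rewrite (poincare_term_eq K k s t u v _ F Hw).
    assert (F' : ((s * a + t * c) * (u * b + v * d) - (s * b + t * d) * (u * a + v * c) = 1)%Z).
    { replace (_ - _)%Z with ((s * v - t * u) * (a * d - b * c))%Z by ring. now rewrite E, F. }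
    rewrite (poincare_term_eq K k _ _ _ _ z F' Hz).
    rewrite <- !zlin_mobius by easy. rewrite Cpow_mult_l.
    rewrite Cmult_assoc. f_equal.
    + assert (Cpow (zlin c d z) K <> RtoC 0) by now apply Cpow_nz.
      assert (Cpow (zlin u v (zlin a b z / zlin c d z)) K <> RtoC 0) by now apply Cpow_nz.
      field. easy.
    + do 2 f_equal. field. easy.
  - rewrite !poincare_term_not_coprime; [ring | | easy].
    intros G'. apply G. apply gcd_1_iff in G'. destruct G' as [s [t F]].
    apply gcd_1_iff. exists (s * d - t * c)%Z, (t * a - s * b)%Z. rewrite <- F. ring.
Qed.

Lemma poincare_modular K k a b c d z : (4 <= K)%nat ->
  (a * d - b * c = 1)%Z -> 0 < Im z ->
  poincare K k (zlin a b z / zlin c d z) = (zlin c d z ^ K * poincare K k z)%C.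
Proof.
  intros HK E Hz. unfold poincare at 1. apply usum_unique.
  apply has_sum_ext with (f := fun p => (zlin c d z ^ K * poincare_term K k (row_action a b c d p) z)%C).
  { intros p. symmetry. now apply poincare_term_mobius. }
  apply has_sum_scal.
  apply (has_sum_reindex (row_action a b c d) (row_action d (- b) (- c) a)
           (fun p => poincare_term K k p z)).
  - intros [u v]. unfold row_action; simpl. f_equal.
    + replace (_ + _)%Z with (u * (a * d - b * c))%Z by ring. rewrite E. ring.
    + replace (_ + _)%Z with (v * (a * d - b * c))%Z by ring. rewrite E. ring.
  - intros [u v]. unfold row_action; simpl. f_equal.
    + replace (_ + _)%Z with (u * (a * d - b * c))%Z by ring. rewrite E. ring.
    + replace (_ + _)%Z with (v * (a * d - b * c))%Z by ring. rewrite E. ring.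
  - now apply poincare_has_sum.
Qed.

(** * Holomorphy of Poincare series *)

(** An expansion [1 + g1 h + O(h^2)], with [B] and [r] meant to be shared by a family of functions,
    one for each lattice pair. The constant term [1] keeps the class closed under products. *)
Definition quadratic_approx (B r : R) (g : C -> C) (g1 : C) : Prop :=
  Cmod g1 <= B /\
  forall h, Cmod h <= r -> Cmod (g h - 1 - g1 * h) <= B * Cmod h ^ 2.

Lemma quadratic_approx_mult B B' r g g' g1 g1' :
  r <= 1 -> quadratic_approx B r g g1 -> quadratic_approx B' r g' g1' ->
  quadratic_approx (B + B' + 4 * B * B') r (fun h => (g h * g' h)%C) (g1 + g1')%C.
Proof.
  intros Hr [H1 H] [H1' H'].
  assert (P := Cmod_ge_0 g1). assert (P' := Cmod_ge_0 g1').
  assert (BB : 0 <= B * B') by (apply Rmult_le_pos; lra).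
  split.
  - apply Rle_trans with (1 := Cmod_triangle _ _). lra.
  - intros h Hh. specialize (H h Hh). specialize (H' h Hh).
    assert (Q := Cmod_ge_0 h). set (m := Cmod h) in *.
    assert (Q2 : m ^ 2 <= 1) by nra.
    replace (g h * g' h - 1 - (g1 + g1') * h)%C
      with ((g h - 1 - g1 * h) * ((g' h - 1 - g1' * h) + (1 + g1' * h))
            + ((1 + g1 * h) * (g' h - 1 - g1' * h) + g1 * g1' * (h * h)))%C by ring.
    apply Rle_trans with (1 := Cmod_triangle _ _).
    rewrite Cmod_mult.
    assert (T1 := Cmod_triangle ((1 + g1 * h) * (g' h - 1 - g1' * h)) (g1 * g1' * (h * h))).
    rewrite !Cmod_mult in T1. fold m in T1.
    assert (T2 := Cmod_triangle (g' h - 1 - g1' * h) (1 + g1' * h)).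
    assert (T3 : forall w B0, Cmod w <= B0 -> Cmod (1 + w * h) <= 1 + B0).
    { intros w B0 Hw. apply Rle_trans with (1 := Cmod_triangle _ _).
      rewrite Cmod_1, Cmod_mult. fold m. assert (W := Cmod_ge_0 w). nra. }
    assert (T5 := T3 _ _ H1').
    set (e := (g h - 1 - g1 * h)%C) in *. set (e' := (g' h - 1 - g1' * h)%C) in *.
    assert (T6 : Cmod (e' + (1 + g1' * h)) <= 1 + 2 * B') by nra.
    assert (T7 : Cmod e * Cmod (e' + (1 + g1' * h)) <= (B * m ^ 2) * (1 + 2 * B'))
      by (apply Rmult_le_compat; auto using Cmod_ge_0).
    assert (T8 : Cmod (1 + g1 * h) * Cmod e' <= (1 + B) * (B' * m ^ 2))
      by (apply Rmult_le_compat; auto using Cmod_ge_0).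
    assert (T9 : Cmod g1 * Cmod g1' * (m * m) <= B * B' * (m * m)).
    { apply Rmult_le_compat_r; [nra |]. apply Rmult_le_compat; auto. }
    nra.
Qed.

Lemma quadratic_approx_le B B' r r' g g1 :
  B <= B' -> r' <= r -> quadratic_approx B r g g1 -> quadratic_approx B' r' g g1.
Proof.
  intros HB Hr [H1 H]. split; [lra |]. intros h Hh.
  apply Rle_trans with (1 := H h ltac:(lra)). apply Rmult_le_compat_r; [apply pow2_ge_0 | easy].
Qed.

Lemma one_plus_bound (A : R) (lam h : C) :
  Cmod lam <= A -> Cmod h <= / (2 * (A + 1)) ->
  (1 + lam * h)%C <> RtoC 0 /\ Cmod (/ (1 + lam * h)) <= 2.
Proof.
  intros HL Hh. assert (P := Cmod_ge_0 lam). assert (Q := Cmod_ge_0 h).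
  assert (E : Cmod (lam * h) <= 1 / 2).
  { rewrite Cmod_mult. apply Rle_trans with (A * / (2 * (A + 1))).
    - apply Rmult_le_compat; lra.
    - apply Rmult_le_reg_r with (2 * (A + 1)); [lra |].
      rewrite Rmult_assoc, Rinv_l; lra. }
  assert (F := Cmod_ge_minus 1 (lam * h)). rewrite Cmod_1 in F.
  assert (N : (1 + lam * h)%C <> RtoC 0) by (apply Cmod_gt_0; lra).
  split; [easy |]. rewrite Cmod_inv by easy.
  replace 2 with (/ / 2) by lra. apply Rinv_le_contravar; lra.
Qed.

Lemma quadratic_approx_inv (A : R) (lam : C) :
  Cmod lam <= A ->
  quadratic_approx (A + 2 * A ^ 2) (/ (2 * (A + 1))) (fun h => / (1 + lam * h))%C (- lam)%C.
Proof.
  intros HL. assert (P := Cmod_ge_0 lam). split.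
  - rewrite Cmod_opp. assert (Z := pow2_ge_0 A). lra.
  - intros h Hh. destruct (one_plus_bound A lam h HL Hh) as [N F].
    replace (/ (1 + lam * h) - 1 - - lam * h)%C with (lam * lam * (h * h) * / (1 + lam * h))%C
      by (field; easy).
    rewrite !Cmod_mult. assert (Q := Cmod_ge_0 h). set (m := Cmod h) in *.
    assert (L2 : Cmod lam * Cmod lam <= A ^ 2) by nra.
    apply Rle_trans with (A ^ 2 * (m * m) * 2).
    + apply Rmult_le_compat; auto using Cmod_ge_0.
      * mult_nonneg; auto.
      * apply Rmult_le_compat_r; [nra | easy].
    + nra.
Qed.

Lemma quadratic_approx_pow (A : R) (K : nat) : 0 <= A ->
  exists B, forall lam, Cmod lam <= A ->
    quadratic_approx B (/ (2 * (A + 1))) (fun h => (/ (1 + lam * h)) ^ K)%C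
      (RtoC (INR K) * - lam)%C.
Proof.
  intros HA. induction K as [| K [B IH]].
  - exists 0. intros lam HL. split.
    + simpl. rewrite Cmult_0_l, Cmod_0. lra.
    + intros h _. simpl. replace (1 - 1 - 0 * - lam * h)%C with (RtoC 0) by ring.
      rewrite Cmod_0. lra.
  - eexists. intros lam HL. specialize (IH lam HL).
    assert (R1 : / (2 * (A + 1)) <= 1) by (rewrite <- Rinv_1; apply Rinv_le_contravar; lra).
    assert (M := quadratic_approx_mult _ _ _ _ _ _ _ R1 (quadratic_approx_inv A lam HL) IH).
    replace (RtoC (INR (S K)) * - lam)%C with (- lam + RtoC (INR K) * - lam)%C
      by (rewrite S_INR, RtoC_plus; ring).
    exact M.
Qed.

Lemma quadratic_approx_nome (A t : R) : 0 <= A -> 0 <= t ->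
  exists B r, 0 < r <= / (2 * (A + 1)) /\
  forall lam mu, Cmod lam <= A -> Cmod mu <= A ->
    quadratic_approx B r (fun h => nome (RtoC t * (mu * h / (1 + lam * h))))
      (RtoC (2 * PI) * Ci * (RtoC t * mu))%C.
Proof.
  intros HA Ht. assert (PP := PI_RGT_0).
  set (M := 2 * PI * t * A).
  assert (HM : 0 <= M) by (unfold M; mult_nonneg; lra).
  exists (M + 64 * M ^ 2 + 2 * M * A), (Rmin (/ (2 * (A + 1))) (/ (4 * (M + 1)))).
  split.
  { split; [| apply Rmin_l]. apply Rmin_pos; apply Rinv_0_lt_compat; lra. }
  intros lam mu HL HMu.
  assert (PL := Cmod_ge_0 lam).
  assert (M2 := pow2_ge_0 M). assert (MA : 0 <= M * A) by now apply Rmult_le_pos.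
  assert (G : Cmod (RtoC (2 * PI) * Ci * (RtoC t * mu)) <= M).
  { rewrite !Cmod_mult, !Cmod_R, Cmod_Ci, !Rabs_pos_eq by lra. unfold M.
    replace (2 * PI * 1 * (t * Cmod mu)) with (2 * PI * t * Cmod mu) by ring.
    apply Rmult_le_compat_l; [mult_nonneg; lra | easy]. }
  split; [lra |].
  intros h Hh.
  assert (Hh1 := Rle_trans _ _ _ Hh (Rmin_l _ _)). assert (Hh2 := Rle_trans _ _ _ Hh (Rmin_r _ _)).
  destruct (one_plus_bound A lam h HL Hh1) as [N F].
  assert (Q := Cmod_ge_0 h). set (m := Cmod h) in *.
  unfold nome. set (g1 := (RtoC (2 * PI) * Ci * (RtoC t * mu))%C) in *.
  assert (PG := Cmod_ge_0 g1).
  replace (RtoC (2 * PI) * Ci * (RtoC t * (mu * h / (1 + lam * h))))%C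
    with (g1 * h * / (1 + lam * h))%C by (unfold g1; field; easy).
  set (E := (g1 * h * / (1 + lam * h))%C).
  assert (HE : Cmod E <= 2 * M * m).
  { unfold E. rewrite !Cmod_mult. fold m.
    apply Rle_trans with (M * m * 2); [| lra].
    apply Rmult_le_compat; auto using Cmod_ge_0.
    - now apply Rmult_le_pos.
    - now apply Rmult_le_compat_r. }
  assert (PE := Cmod_ge_0 E).
  assert (HE1 : Cmod E <= 1 / 2).
  { apply Rle_trans with (1 := HE).
    apply Rle_trans with (2 * M * / (4 * (M + 1))); [apply Rmult_le_compat_l; lra |].
    apply Rmult_le_reg_r with (4 * (M + 1)); [lra |]. rewrite Rmult_assoc, Rinv_l; lra. }
  assert (T := Cexp_quadratic E HE1).
  replace (Cexp E - 1 - g1 * h)%C with ((Cexp E - 1 - E) + (E - g1 * h))%C by ring.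
  apply Rle_trans with (1 := Cmod_triangle _ _).
  assert (D : Cmod (E - g1 * h) <= 2 * M * A * m ^ 2).
  { replace (E - g1 * h)%C with (- (g1 * lam * (h * h) * / (1 + lam * h)))%C
      by (unfold E; field; easy).
    rewrite Cmod_opp, !Cmod_mult. fold m.
    apply Rle_trans with (M * A * (m * m) * 2); [| lra].
    apply Rmult_le_compat; auto using Cmod_ge_0.
    - mult_nonneg; auto.
    - apply Rmult_le_compat_r; [nra |]. apply Rmult_le_compat; auto. }
  nra.
Qed.

(** Rests on the exact identities [c(z+h) + d = (cz+d)(1 + lam h)] and [gamma(z+h) = gamma z + mu h
    / (1 + lam h)], the second by [ad - bc = 1]. As [lam] and [mu] stay bounded over all pairs, one
    expansion in [h] serves every term. *)
Lemma poincare_term_shift K k a b c d z h :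
  (a * d - b * c = 1)%Z -> 0 < Im z -> 0 < Im (z + h)%C ->
  let lam := (RtoC (IZR c) / zlin c d z)%C in
  let mu := (/ zlin c d z ^ 2)%C in
  poincare_term K k (c, d) (z + h)
  = (poincare_term K k (c, d) z *
     ((/ (1 + lam * h)) ^ K * nome (RtoC (INR k) * (mu * h / (1 + lam * h)))))%C.
Proof.
  intros E Hz Hzh lam mu.
  assert (ND : (c, d) <> (0%Z, 0%Z)) by (apply gcd_1_neq_0, gcd_1_iff; eauto).
  assert (N := zlin_neq_0 c d z Hz ND). assert (N' := zlin_neq_0 c d _ Hzh ND).
  rewrite (poincare_term_eq K k a b c d z E Hz), (poincare_term_eq K k a b c d _ E Hzh).
  assert (F : zlin c d (z + h) = (zlin c d z * (1 + lam * h))%C).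
  { unfold lam, zlin. unfold zlin in N. field. exact N. }
  assert (N1 : (1 + lam * h)%C <> RtoC 0) by (intros G; apply N'; rewrite F, G; ring).
  assert (G : (zlin a b (z + h) / zlin c d (z + h))%C
              = (zlin a b z / zlin c d z + mu * h / (1 + lam * h))%C).
  { rewrite F. unfold mu.
    replace (zlin a b (z + h)) with (zlin a b z * (1 + lam * h) + h / zlin c d z)%C.
    - field. easy.
    - apply (f_equal (fun x => RtoC (IZR x))) in E.
      rewrite minus_IZR, !mult_IZR, RtoC_minus, !RtoC_mult in E.
      apply (f_equal (fun x => (x * h / zlin c d z)%C)) in E.
      replace (h / zlin c d z)%C with (RtoC 1 * h / zlin c d z)%C by (field; easy).
      rewrite <- E. unfold lam, zlin. unfold zlin in N. field. exact N. }
  rewrite G, Cmult_plus_distr_l, nome_plus, F, Cpow_mult_l, Cpow_inv by easy.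
  assert (zlin c d z ^ K <> 0)%C by now apply Cpow_nz.
  assert ((1 + lam * h) ^ K <> 0)%C by now apply Cpow_nz.
  field. easy.
Qed.

Definition quad_diff_at (B r : R) (f : C -> C) (z : C) : Prop :=
  exists d, Cmod d <= B /\
    forall h, Cmod h <= r -> Cmod (f (z + h)%C - f z - d * h) <= B * Cmod h ^ 2.

(** More than holomorphy: the remainder is uniform on half-strips, as is required for comparing
    means over horizontal segments at nearby heights. *)
Definition strip_regular (f : C -> C) : Prop :=
  forall X y1, 0 < y1 -> exists B r, 0 < r /\
    forall z, Rabs (Re z) <= X -> y1 <= Im z -> Cmod (f z) <= B /\ quad_diff_at B r f z.

Lemma im_shift_pos z h y1 : y1 <= Im z -> 0 < y1 -> Cmod h <= y1 / 2 -> 0 < Im (z + h)%C.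
Proof.
  intros H H0 Hh. assert (Q := im_le_Cmod h). apply Rabs_le_between in Q.
  rewrite im_plus. lra.
Qed.

(** Differentiation term by term: the remainder of each term is at most a constant times [|h|^2]
    times its lattice weight, and the weights have a finite sum. *)
Lemma poincare_strip_regular K k : (4 <= K)%nat -> strip_regular (poincare K k).
Proof.
  intros HK X y1 Hy.
  destruct (Cmod_poincare_term_weight X y1 K k Hy HK) as [W [HW0 HW]].
  destruct (zlin_lower_bound X y1 Hy) as [delta [D0 HD]].
  assert (D2 : 0 < delta ^ 2) by now apply pow_lt.
  (* Bounds [c/(cz+d)] by [1/y1], since [|cz+d| >= |c| Im z], and [1/(cz+d)^2] by [1/delta^2]. *)
  set (A := / y1 + / delta ^ 2).
  assert (Y0 : 0 < / y1) by now apply Rinv_0_lt_compat.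
  assert (DD : 0 < / delta ^ 2) by now apply Rinv_0_lt_compat.
  assert (HA : 0 <= A) by (unfold A; lra).
  destruct (quadratic_approx_pow A K HA) as [B1 HB1].
  destruct (quadratic_approx_nome A (INR k) HA (pos_INR k)) as [B2 [r [Hr HB2]]].
  assert (R1 : r <= 1).
  { apply Rle_trans with (1 := proj2 Hr). rewrite <- Rinv_1. apply Rinv_le_contravar; lra. }
  set (B := B1 + B2 + 4 * B1 * B2).
  assert (QA : forall lam mu, Cmod lam <= A -> Cmod mu <= A ->
    quadratic_approx B r (fun h => (/ (1 + lam * h)) ^ K * nome (RtoC (INR k) * (mu * h / (1 + lam * h))))%C
      (RtoC (INR K) * - lam + RtoC (2 * PI) * Ci * (RtoC (INR k) * mu))%C).
  { intros lam mu HL HM. apply quadratic_approx_mult; auto.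
    apply quadratic_approx_le with (3 := HB1 lam HL); lra. }
  assert (HB : 0 <= B).
  { destruct (QA (RtoC 0) (RtoC 0)) as [Q _]; rewrite ?Cmod_0; auto.
    apply Rle_trans with (2 := Q), Cmod_ge_0. }
  exists (W * (1 + B) * 25), (Rmin r (y1 / 2)).
  split; [apply Rmin_pos; lra |].
  intros z Hx Hz.
  (* [g1 p] is the logarithmic derivative at [z] of the term of index [p]. *)
  set (g1 := fun p : Z * Z => let u := zlin (fst p) (snd p) z in
    (RtoC (INR K) * - (RtoC (IZR (fst p)) / u) + RtoC (2 * PI) * Ci * (RtoC (INR k) * (/ u ^ 2)))%C).
  assert (P0 : forall p, Cmod (poincare_term K k p z) <= W * lattice_weight p) by auto.
  assert (QZ : forall c d, Z.gcd c d = 1%Z ->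
     Cmod (RtoC (IZR c) / zlin c d z) <= A /\ Cmod (/ zlin c d z ^ 2) <= A).
  { intros c d G. assert (ND := gcd_1_neq_0 c d G).
    assert (N := zlin_neq_0 c d z ltac:(lra) ND).
    assert (M : 0 < Cmod (zlin c d z)) by now apply Cmod_gt_0.
    split.
    - rewrite Cmod_div, Cmod_R by easy.
      assert (I := im_le_Cmod (zlin c d z)). rewrite im_zlin, Rabs_mult, (Rabs_pos_eq (Im z)) in I by lra.
      apply Rle_trans with (/ y1); [| unfold A; lra].
      apply Rmult_le_reg_r with (Cmod (zlin c d z)); [easy |].
      unfold Rdiv. rewrite Rmult_assoc, Rinv_l, Rmult_1_r by lra.
      apply Rmult_le_reg_l with y1; [easy |]. rewrite <- Rmult_assoc, Rinv_r, Rmult_1_l by lra.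
      nra.
    - rewrite Cmod_inv, Cmod_pow by now apply Cpow_nz.
      apply Rle_trans with (/ delta ^ 2); [| unfold A; lra].
      apply Rinv_le_contravar; [easy |].
      apply Rle_trans with (2 := HD c d z Hx Hz).
      assert (Z := IZR_sq_sum_ge_1 c d ND). nra. }
  assert (G1 : forall p, Cmod (poincare_term K k p z * g1 p) <= (W * B) * lattice_weight p).
  { intros [c d]. destruct (Z.eq_dec (Z.gcd c d) 1) as [G | G].
    - destruct (QZ c d G) as [Q1 Q2]. destruct (QA _ _ Q1 Q2) as [Q3 _].
      rewrite Cmod_mult. specialize (P0 (c, d)). unfold g1. simpl fst; simpl snd.
      replace (W * B * lattice_weight (c, d)) with (W * lattice_weight (c, d) * B) by ring.
      apply Rmult_le_compat; auto using Cmod_ge_0.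
    - rewrite poincare_term_not_coprime, Cmult_0_l, Cmod_0 by easy.
      assert (L := lattice_weight_pos (c, d)).
      mult_nonneg; lra. }
  assert (WB : 0 <= W * B) by now apply Rmult_le_pos.
  split; [| exists (usum (fun p => poincare_term K k p z * g1 p)%C); split].
  - apply has_sum_bound with (1 := poincare_has_sum K k z HK ltac:(lra)).
    intros l N. apply Rle_trans with (W * 25); [| nra].
    now apply (abs_bounded_le _ lattice_weight W 25 HW0 P0 lattice_weight_sum).
  - assert (AB := abs_bounded_le _ lattice_weight (W * B) 25 WB G1 lattice_weight_sum).
    apply has_sum_bound with (1 := usum_correct _ _ AB).
    intros l N. apply Rle_trans with (1 := AB l N). nra.
  - intros h Hh.
    assert (Hh1 := Rle_trans _ _ _ Hh (Rmin_l _ _)). assert (Hh2 := Rle_trans _ _ _ Hh (Rmin_r _ _)).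
    assert (Hzh := im_shift_pos z h y1 Hz Hy Hh2).
    assert (AB := abs_bounded_le _ lattice_weight (W * B) 25 WB G1 lattice_weight_sum).
    (* The whole remainder becomes one unordered sum over the pairs, so that it can be bounded term
       by term. *)
    assert (S := has_sum_plus _ _ _ _ (poincare_has_sum K k (z + h) HK Hzh)
      (has_sum_scal (- (1)) _ _ (has_sum_plus _ _ _ _ (poincare_has_sum K k z HK ltac:(lra))
         (has_sum_scal h _ _ (usum_correct _ _ AB))))).
    cbv beta in S. set (dd := usum _) in *.
    replace (poincare K k (z + h) - poincare K k z - dd * h)%C
      with (poincare K k (z + h) + - (1) * (poincare K k z + h * dd))%C by ring.
    replace (W * (1 + B) * 25 * Cmod h ^ 2) with ((W * (1 + B) * Cmod h ^ 2) * 25) by ring.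
    apply has_sum_bound with (1 := S).
    assert (H2 := pow2_ge_0 (Cmod h)).
    apply abs_bounded_le with lattice_weight; [mult_nonneg; lra | | apply lattice_weight_sum].
    intros [c d]. destruct (Z.eq_dec (Z.gcd c d) 1) as [G | G].
    + destruct (proj1 (gcd_1_iff c d) G) as [a [b E]].
      rewrite (poincare_term_shift K k a b c d z h E ltac:(lra) Hzh).
      destruct (QZ c d G) as [Q1 Q2]. destruct (QA _ _ Q1 Q2) as [_ Q3].
      specialize (Q3 h Hh1). unfold g1. simpl fst; simpl snd.
      set (lam := (RtoC (IZR c) / zlin c d z)%C) in *. set (mu := (/ zlin c d z ^ 2)%C) in *.
      match type of Q3 with Cmod ?q <= _ => set (qq := q) in Q3;
        match goal with |- Cmod ?w <= _ =>
          replace w with (poincare_term K k (c, d) z * qq)%C by (unfold qq; ring) end end.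
      rewrite Cmod_mult. specialize (P0 (c, d)). assert (L := lattice_weight_pos (c, d)).
      apply Rle_trans with ((W * lattice_weight (c, d)) * (B * Cmod h ^ 2)).
      * apply Rmult_le_compat; auto using Cmod_ge_0.
      * assert (0 <= W * lattice_weight (c, d) * Cmod h ^ 2) by (mult_nonneg; lra). nra.
    + rewrite !poincare_term_not_coprime by easy.
      replace (0 + - (1) * (0 + h * (0 * g1 (c, d))))%C with (RtoC 0) by ring.
      rewrite Cmod_0. assert (L := lattice_weight_pos (c, d)). mult_nonneg; lra.
Qed.

Lemma quad_diff_ex_derive B r f z : 0 < r -> quad_diff_at B r f z ->
  ex_derive (K := C_AbsRing) (V := C_NormedModule) f z.
Proof.
  intros Hr [d [Hd H]]. exists d. split; [apply is_linear_scal_l |].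
  intros x Hx. apply (is_filter_lim_locally_unique (K := C_AbsRing) (V := AbsRing_NormedModule C_AbsRing)) in Hx.
  subst x. intros eps.
  assert (HB : 0 <= B) by (apply Rle_trans with (2 := Hd), Cmod_ge_0).
  assert (Q : 0 < Rmin r (eps / (B + 1))).
  { apply Rmin_pos; [easy |]. apply Rdiv_lt_0_compat; [apply cond_pos | lra]. }
  exists (mkposreal _ Q). intros y Hy.
  change (Cmod (y - z) < Rmin r (eps / (B + 1))) in Hy.
  change (norm (minus (minus (f y) (f z)) (scal (minus y z) d)))
    with (Cmod (f y - f z - (y - z) * d)).
  change (norm (minus y z)) with (Cmod (y - z)).
  assert (Hy1 := Rlt_le_trans _ _ _ Hy (Rmin_l _ _)). assert (Hy2 := Rlt_le_trans _ _ _ Hy (Rmin_r _ _)).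
  specialize (H (y - z)%C ltac:(lra)).
  change (UniformSpace.sort (AbsRing_UniformSpace C_AbsRing)) with C in y.
  replace (z + (y - z))%C with y in H by ring.
  replace (f y - f z - (y - z) * d)%C with (f y - f z - d * (y - z))%C by ring.
  apply Rle_trans with (1 := H). assert (P := Cmod_ge_0 (y - z)).
  assert (E : eps = eps / (B + 1) * (B + 1) :> R) by (field; lra).
  set (m := Cmod (y - z)) in *. set (q := eps / (B + 1)) in *. rewrite E.
  assert (B * m <= q * (B + 1)) by nra. nra.
Qed.

Lemma exp_neg_le_inv (x : R) : 0 < x -> exp (- x) <= / x.
Proof.
  intros H. rewrite exp_Ropp. apply Rinv_le_contravar; [easy |].
  assert (Q := exp_ineq1_le x). lra.
Qed.

(** If [c <> 0], one of the [K] factors is at least [Im z] and the other [K - 1 >= 4] still give a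
    summable bound: this is the origin of [K >= 5]. If [c = 0], the term decays exponentially
    because [k >= 1]. *)
Lemma poincare_decay K k : (5 <= K)%nat -> (1 <= k)%nat ->
  exists A, 0 <= A /\ forall z, Rabs (Re z) <= 1 -> 1 <= Im z -> Cmod (poincare K k z) <= A / Im z.
Proof.
  intros HK Hk.
  destruct (zlin_lower_bound 1 1 Rlt_0_1) as [delta [D0 HD]].
  set (W := 3 * / delta ^ (K - 1)).
  assert (DK : 0 < / delta ^ (K - 1)) by (apply Rinv_0_lt_compat, pow_lt, D0).
  (* [W] serves the pairs with [c <> 0], the [2] makes up for the weight [1/2] of [(0,1)] and
     [(0,-1)], and [25] bounds the total weight. *)
  exists ((W + 2) * 25). split; [unfold W; lra |].
  intros z Hx Hz.
  replace ((W + 2) * 25 / Im z) with (((W + 2) / Im z) * 25) by (field; lra).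
  apply has_sum_bound with (1 := poincare_has_sum K k z ltac:(lia) ltac:(lra)).
  assert (W0 : 0 <= W + 2) by (unfold W; lra).
  assert (Y0 : 0 < / Im z) by (apply Rinv_0_lt_compat; lra).
  apply abs_bounded_le with lattice_weight; [apply Rmult_le_pos; lra | | apply lattice_weight_sum].
  intros [c d]. assert (L := lattice_weight_pos (c, d)).
  destruct (Z.eq_dec (Z.gcd c d) 1) as [G | G].
  - assert (ND := gcd_1_neq_0 c d G).
    assert (N := zlin_neq_0 c d z ltac:(lra) ND).
    assert (M : 0 < Cmod (zlin c d z)) by now apply Cmod_gt_0.
    destruct (Z.eq_dec c 0) as [-> | Nc].
    + destruct (proj1 (gcd_1_iff 0 d) G) as [a [b E]].
      rewrite (poincare_term_eq K k a b 0 d z E ltac:(lra)).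
      assert (Dd : (d = 1 \/ d = -1)%Z).
      { apply Z.divide_1_r. exists a. lia. }
      assert (U : Cmod (zlin 0 d z) = 1).
      { unfold zlin. rewrite Cmult_0_l, Cplus_0_l, Cmod_R.
        destruct Dd; subst; [rewrite Rabs_pos_eq; lra | rewrite Rabs_left; lra]. }
      rewrite Cmod_mult, Cmod_inv, Cmod_pow, U, pow1, Rinv_1, Rmult_1_l by now apply Cpow_nz.
      rewrite Cmod_nome, im_scal_l, (im_mobius a b 0 d z E ltac:(lra)), U, pow1, Rdiv_1_r.
      assert (V : lattice_weight (0%Z, d) = / 2).
      { unfold lattice_weight. simpl fst; simpl snd.
        destruct Dd; subst; simpl; f_equal; ring. }
      rewrite V.
      assert (P := PI2_1). assert (KK : 1 <= INR k) by (apply (le_INR 1); easy).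
      replace (- (2 * PI) * (INR k * Im z)) with (- (2 * PI * INR k * Im z)) by ring.
      assert (T : Im z <= 2 * PI * INR k * Im z).
      { assert (1 <= 2 * PI * INR k) by nra. nra. }
      apply Rle_trans with (/ (2 * PI * INR k * Im z)); [apply exp_neg_le_inv; lra |].
      apply Rle_trans with (/ Im z); [apply Rinv_le_contravar; lra |].
      unfold Rdiv. assert (0 <= W) by (unfold W; lra). nra.
    + apply Rle_trans with (1 := Cmod_poincare_term_le K k c d z ltac:(lra)).
      assert (B := zlin_pow_bound (K - 1) delta c d z ltac:(lia) D0 ND (HD c d z Hx ltac:(lra))).
      fold W in B.
      replace K with (S (K - 1)) at 1 by lia. simpl. rewrite Rinv_mult.
      assert (I := im_le_Cmod (zlin c d z)). rewrite im_zlin, Rabs_mult, (Rabs_pos_eq (Im z)) in I by lra.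
      assert (C1 : 1 <= Rabs (IZR c)).
      { rewrite <- abs_IZR. apply IZR_le. lia. }
      assert (/ Cmod (zlin c d z) <= / Im z) by (apply Rinv_le_contravar; [lra | nra]).
      apply Rle_trans with (/ Im z * (W * lattice_weight (c, d))).
      * apply Rmult_le_compat; auto.
        -- left. now apply Rinv_0_lt_compat.
        -- apply Rinv_0_le_compat, pow_le; lra.
      * unfold Rdiv. nra.
  - rewrite poincare_term_not_coprime, Cmod_0 by easy.
    apply Rmult_le_pos; [apply Rmult_le_pos |]; lra.
Qed.

(** * Integrals of complex-valued functions *)

(** Stated with plain moduli because two structures on [C] are in use, the complex one for products
    and the real one for integrals; continuity for either follows from this. *)
Definition ccont (f : R -> C) (s : R) : Prop :=
  forall eps, 0 < eps -> exists delta, 0 < delta /\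
    forall t, Rabs (t - s) < delta -> Cmod (f t - f s) < eps.

Lemma ccont_continuous (f : R -> C) s : ccont f s -> continuous (U := C_R_NormedModule) f s.
Proof.
  intros H. apply (proj2 (filterlim_locally (U := C_R_NormedModule) f (f s))). intros eps.
  destruct (H eps (cond_pos eps)) as [delta [D Hd]].
  exists (mkposreal delta D). intros t Ht.
  apply (C_NormedModule_mixin_compat1 (f s) (f t) eps). apply Hd, Ht.
Qed.

Lemma ccont_const (c : C) s : ccont (fun _ => c) s.
Proof.
  intros eps He. exists 1. split; [lra |]. intros t _.
  replace (c - c)%C with (RtoC 0) by ring. now rewrite Cmod_0.
Qed.

Lemma ccont_iff (f : R -> C) s :
  ccont f s <-> continuous (U := AbsRing_UniformSpace C_AbsRing) f s.
Proof.
  split.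
  - intros H. apply (proj2 (filterlim_locally (U := AbsRing_UniformSpace C_AbsRing) f (f s))).
    intros eps. destruct (H eps (cond_pos eps)) as [d [D Hd]]. now exists (mkposreal d D).
  - intros H eps He.
    destruct (proj1 (filterlim_locally (U := AbsRing_UniformSpace C_AbsRing) f (f s)) H
                (mkposreal eps He)) as [d Hd].
    exists d. split; [apply cond_pos | exact Hd].
Qed.

Lemma ccont_plus f g s : ccont f s -> ccont g s -> ccont (fun t => (f t + g t)%C) s.
Proof.
  rewrite !ccont_iff.
  apply (continuous_plus (K := C_AbsRing) (V := AbsRing_NormedModule C_AbsRing) f g s).
Qed.

Lemma ccont_mult f g s : ccont f s -> ccont g s -> ccont (fun t => (f t * g t)%C) s.
Proof.
  rewrite !ccont_iff. apply (continuous_mult (K := C_AbsRing) f g s).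
Qed.

Lemma ccont_inv f s : f s <> RtoC 0 -> ccont f s -> ccont (fun t => (/ f t)%C) s.
Proof.
  intros N Hf eps He.
  assert (P : 0 < Cmod (f s)) by now apply Cmod_gt_0. set (m := Cmod (f s)) in *.
  set (e := Rmin (m / 2) (eps * (m * m / 2))).
  assert (E : 0 < e).
  { apply Rmin_pos; [lra |]. apply Rmult_lt_0_compat; nra. }
  destruct (Hf e E) as [d [D H]]. exists d. split; [easy |]. intros t Ht.
  specialize (H t Ht).
  assert (e <= m / 2) by apply Rmin_l. assert (E2 : e <= eps * (m * m / 2)) by apply Rmin_r.
  assert (G := Cmod_ge_minus (f s) (f t - f s)).
  replace (f s + (f t - f s))%C with (f t) in G by ring. fold m in G.
  assert (Nt : f t <> RtoC 0) by (apply Cmod_gt_0; lra).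
  replace (/ f t - / f s)%C with (- ((f t - f s) / (f t * f s)))%C by (field; easy).
  rewrite Cmod_opp, Cmod_div, Cmod_mult by now apply Cmult_neq_0. fold m.
  apply Rmult_lt_reg_r with (Cmod (f t) * m); [apply Rmult_lt_0_compat; lra |].
  unfold Rdiv. rewrite Rmult_assoc, Rinv_l, Rmult_1_r by (apply Rgt_not_eq, Rmult_lt_0_compat; lra).
  apply Rlt_le_trans with (1 := H), Rle_trans with (1 := E2).
  apply Rmult_le_compat_l; [lra |]. nra.
Qed.

Lemma ccont_ext_near f g s : f s = g s ->
  (exists d, 0 < d /\ forall t, Rabs (t - s) < d -> f t = g t) -> ccont f s -> ccont g s.
Proof.
  intros E [d [D H]] Hf eps He. destruct (Hf eps He) as [d' [D' H']].
  exists (Rmin d d'). split; [now apply Rmin_pos |]. intros t Ht.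
  rewrite <- E, <- H by exact (Rlt_le_trans _ _ _ Ht (Rmin_l _ _)).
  apply H'. exact (Rlt_le_trans _ _ _ Ht (Rmin_r _ _)).
Qed.

Lemma ccont_shift f s e : ccont f (s + e) -> ccont (fun t => f (t + e)) s.
Proof.
  intros H eps He. destruct (H eps He) as [d [D Hd]]. exists d. split; [easy |].
  intros t Ht. apply Hd. replace (t + e - (s + e)) with (t - s) by ring. easy.
Qed.

Lemma ccont_Re f s : ccont f s -> continuity_pt (fun t => Re (f t)) s.
Proof.
  intros H eps He. destruct (H eps He) as [d [D Hd]]. exists d. split; [easy |].
  intros t [_ Ht]. apply Rle_lt_trans with (2 := Hd t Ht).
  apply Rle_trans with (2 := re_le_Cmod _). rewrite re_minus. apply Rle_refl.
Qed.

Lemma ccont_Im f s : ccont f s -> continuity_pt (fun t => Im (f t)) s.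
Proof.
  intros H eps He. destruct (H eps He) as [d [D Hd]]. exists d. split; [easy |].
  intros t [_ Ht]. apply Rle_lt_trans with (2 := Hd t Ht).
  apply Rle_trans with (2 := im_le_Cmod _). rewrite im_minus. apply Rle_refl.
Qed.

Lemma ccont_uniform f a b : (forall s, ccont f s) ->
  forall eps, 0 < eps -> exists delta, 0 < delta /\
    forall s t, a <= s <= b -> a <= t <= b -> Rabs (s - t) < delta -> Cmod (f s - f t) < eps.
Proof.
  intros H eps He. assert (E : 0 < eps / 2) by lra.
  destruct (Heine_cor2 (f := fun t => Re (f t)) (a := a) (b := b) (fun x _ => ccont_Re f x (H x)) (mkposreal _ E)) as [d1 H1].
  destruct (Heine_cor2 (f := fun t => Im (f t)) (a := a) (b := b) (fun x _ => ccont_Im f x (H x)) (mkposreal _ E)) as [d2 H2].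
  exists (Rmin d1 d2). split; [apply Rmin_pos; apply cond_pos |]. intros s t Hs Ht Hst.
  specialize (H1 s t Hs Ht (Rlt_le_trans _ _ _ Hst (Rmin_l _ _))).
  specialize (H2 s t Hs Ht (Rlt_le_trans _ _ _ Hst (Rmin_r _ _))).
  simpl in H1, H2. apply Rle_lt_trans with (1 := Cmod_le_abs _).
  rewrite re_minus, im_minus. lra.
Qed.

Definition CInt (f : R -> C) (a b : R) : C := RInt (V := C_R_CompleteNormedModule) f a b.

Lemma CInt_correct f a b : (forall s, a <= s <= b -> ccont f s) -> a <= b ->
  is_RInt (V := C_R_NormedModule) f a b (CInt f a b).
Proof.
  intros H Hab. apply (RInt_correct (V := C_R_CompleteNormedModule)).
  apply ex_RInt_continuous. intros s Hs. apply ccont_continuous, H.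
  now rewrite Rmin_left, Rmax_right in Hs by lra.
Qed.

Lemma CInt_unique f a b v : is_RInt (V := C_R_NormedModule) f a b v -> CInt f a b = v.
Proof.
  apply (is_RInt_unique (V := C_R_CompleteNormedModule)).
Qed.

Lemma is_RInt_Cscal (c : C) f a b v :
  is_RInt (V := C_R_NormedModule) f a b v ->
  is_RInt (V := C_R_NormedModule) (fun s => (c * f s)%C) a b (c * v)%C.
Proof.
  intros H.
  assert (H1 := is_RInt_fct_extend_fst (U := R_NormedModule) (V := R_NormedModule) f a b v H).
  assert (H2 := is_RInt_fct_extend_snd (U := R_NormedModule) (V := R_NormedModule) f a b v H).
  apply (is_RInt_fct_extend_pair (U := R_NormedModule) (V := R_NormedModule)).
  - apply (is_RInt_minus (V := R_NormedModule)); now apply (is_RInt_scal (V := R_NormedModule)).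
  - apply (is_RInt_plus (V := R_NormedModule)); now apply (is_RInt_scal (V := R_NormedModule)).
Qed.

Lemma CInt_scal c f a b : (forall s, a <= s <= b -> ccont f s) -> a <= b ->
  CInt (fun s => (c * f s)%C) a b = (c * CInt f a b)%C.
Proof.
  intros H Hab. apply CInt_unique, is_RInt_Cscal. now apply CInt_correct.
Qed.

Lemma CInt_plus f g a b : (forall s, a <= s <= b -> ccont f s) ->
  (forall s, a <= s <= b -> ccont g s) -> a <= b ->
  CInt (fun s => (f s + g s)%C) a b = (CInt f a b + CInt g a b)%C.
Proof.
  intros Hf Hg Hab. apply CInt_unique.
  apply (is_RInt_plus (V := C_R_NormedModule)); now apply CInt_correct.
Qed.

Lemma CInt_ext f g a b : a <= b -> (forall s, a <= s <= b -> f s = g s) -> CInt f a b = CInt g a b.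
Proof.
  intros Hab H. apply (RInt_ext (V := C_R_CompleteNormedModule)). intros s Hs.
  rewrite Rmin_left, Rmax_right in Hs by lra. apply H. lra.
Qed.

Lemma CInt_bound f a b M : (forall s, a <= s <= b -> ccont f s) -> a <= b ->
  (forall s, a <= s <= b -> Cmod (f s) <= M) -> Cmod (CInt f a b) <= (b - a) * M.
Proof.
  intros Hc Hab H. rewrite Cmod_norm.
  apply (norm_RInt_le_const (V := C_R_NormedModule) f); [easy | | now apply CInt_correct].
  intros s Hs. change (norm (f s)) with (@norm _ C_R_NormedModule (f s)).
  rewrite <- Cmod_norm. now apply H.
Qed.

Lemma CInt_periodic f e : (forall s, ccont f s) -> (forall s, f (s + 1) = f s) ->
  CInt (fun s => f (s + e)) 0 1 = CInt f 0 1.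
Proof.
  intros Hc Hp.
  assert (X : forall a b, ex_RInt (V := C_R_CompleteNormedModule) f a b).
  { intros a b. apply ex_RInt_continuous. intros s _. apply ccont_continuous, Hc. }
  assert (S : forall v a b, RInt (V := C_R_CompleteNormedModule) (fun s => f (s + v)) a b
                            = RInt (V := C_R_CompleteNormedModule) f (a + v) (b + v)).
  { intros v a b.
    assert (E := RInt_comp_lin (V := C_R_CompleteNormedModule) f 1 v a b (X _ _)).
    rewrite !Rmult_1_l in E. rewrite <- E. apply (RInt_ext (V := C_R_CompleteNormedModule)).
    intros s _. rewrite Rmult_1_l. symmetry. apply (scal_one (V := C_R_CompleteNormedModule)). }
  unfold CInt. rewrite S, Rplus_0_l.
  assert (E1 := RInt_Chasles (V := C_R_CompleteNormedModule) f 0 e (1 + e) (X _ _) (X _ _)).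
  assert (E2 := RInt_Chasles (V := C_R_CompleteNormedModule) f 0 1 (1 + e) (X _ _) (X _ _)).
  assert (E3 : RInt (V := C_R_CompleteNormedModule) f 1 (1 + e)
               = RInt (V := C_R_CompleteNormedModule) f 0 e).
  { replace 1 with (0 + 1) at 1 by ring. rewrite (Rplus_comm 1 e), <- S.
    apply RInt_ext. intros s _. apply Hp. }
  rewrite E3 in E2. rewrite <- E2 in E1.
  set (p := RInt (V := C_R_CompleteNormedModule) f 0 e) in *.
  set (q := RInt (V := C_R_CompleteNormedModule) f e (1 + e)) in *.
  set (v := RInt (V := C_R_CompleteNormedModule) f 0 1) in *.
  assert (E4 : (p + q = v + p)%C) by exact E1.
  assert (F : forall p q v : C, (p + q)%C = (v + p)%C -> q = v).
  { intros p' q' v' F. transitivity (p' + q' - p')%C; [ring |]. rewrite F. ring. }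
  exact (F p q v E4).
Qed.

(** Cutting the interval, of length [L], into [N] equal steps bounds the total change by
    [N B (L/N)^2 = B L^2 / N], which tends to [0]. *)
Lemma constant_of_quadratic (G : R -> C) (B r y1 y2 : R) : 0 < r -> y1 <= y2 ->
  (forall y e, y1 <= y <= y2 -> 0 <= e <= r -> Cmod (G (y + e) - G y) <= B * e ^ 2) ->
  G y1 = G y2.
Proof.
  intros Hr Hy H. symmetry. apply Cmod_small_eq. intros eps He.
  assert (HB : 0 <= B).
  { specialize (H y1 r ltac:(lra) ltac:(lra)).
    assert (Q := Rle_trans _ _ _ (Cmod_ge_0 _) H). assert (0 < r ^ 2) by now apply pow_lt. nra. }
  set (L := y2 - y1).
  assert (HL : 0 <= L) by (unfold L; lra).
  destruct (archimed_cor1 (Rmin (r / (L + 1)) (eps / (B * L ^ 2 + 1)))) as [N [N1 N0]].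
  { assert (0 <= B * L ^ 2) by (apply Rmult_le_pos; [lra | apply pow2_ge_0]).
    apply Rmin_pos; apply Rdiv_lt_0_compat; lra. }
  assert (NN : 0 < INR N) by (apply lt_0_INR; lia).
  set (e := L / INR N).
  assert (E0 : 0 <= e) by (apply Rdiv_le_0_compat; lra).
  assert (E1 : e <= r).
  { apply Rle_trans with (L * (r / (L + 1))).
    - apply Rmult_le_compat_l; [lra |].
      left. apply Rlt_le_trans with (1 := N1), Rmin_l.
    - assert (L / (L + 1) <= 1) by (apply Rle_div_l; lra).
      replace (L * (r / (L + 1))) with (r * (L / (L + 1))) by (field; lra). nra. }
  assert (I : forall j, (j <= N)%nat -> Cmod (G (y1 + INR j * e) - G y1) <= INR j * (B * e ^ 2)).
  { induction j as [| j IH]; intros Hj.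
    - simpl. rewrite !Rmult_0_l, Rplus_0_r. replace (G y1 - G y1)%C with (RtoC 0) by ring.
      rewrite Cmod_0. lra.
    - specialize (IH ltac:(lia)). rewrite S_INR.
      replace (y1 + (INR j + 1) * e) with (y1 + INR j * e + e) by ring.
      apply Rle_trans with (1 := Cmod_minus_triangle _ (G (y1 + INR j * e)) _).
      assert (Hje : INR j * e <= L).
      { replace L with (INR N * e) by (unfold e; field; lra).
        apply Rmult_le_compat_r; [easy |]. apply le_INR; lia. }
      assert (0 <= INR j * e) by (apply Rmult_le_pos; [apply pos_INR | easy]).
      specialize (H (y1 + INR j * e) e ltac:(unfold L in *; lra) ltac:(lra)). lra. }
  specialize (I N (le_n N)).
  replace (y1 + INR N * e) with y2 in I by (unfold e, L; field; lra).
  apply Rle_lt_trans with (1 := I).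
  replace (INR N * (B * e ^ 2)) with ((B * L ^ 2) * / INR N) by (unfold e; field; lra).
  assert (Q : 0 <= B * L ^ 2) by (apply Rmult_le_pos; [lra | apply pow2_ge_0]).
  assert (N2 := Rlt_le_trans _ _ _ N1 (Rmin_r _ _)).
  set (q := B * L ^ 2) in *.
  assert (/ INR N * (q + 1) < eps).
  { replace eps with (eps / (q + 1) * (q + 1)) by (field; lra). apply Rmult_lt_compat_r; lra. }
  nra.
Qed.

Lemma ccont_of_quad (F : R -> C) s (B r : R) (d : C) : 0 < r ->
  (forall t, Rabs (t - s) <= r -> Cmod (F t - F s - d * RtoC (t - s)) <= B * (t - s) ^ 2) ->
  ccont F s.
Proof.
  intros Hr H eps He.
  assert (P := Cmod_ge_0 d). assert (Q := Rabs_pos B).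
  set (A := Cmod d + Rabs B + 1).
  assert (HA : 0 < eps / A) by (apply Rdiv_lt_0_compat; unfold A; lra).
  exists (Rmin r (Rmin 1 (eps / A))). split; [repeat apply Rmin_pos; lra |].
  intros t Ht.
  assert (H1 := Rlt_le_trans _ _ _ Ht (Rmin_l _ _)).
  assert (H2 := Rlt_le_trans _ _ _ (Rlt_le_trans _ _ _ Ht (Rmin_r _ _)) (Rmin_l _ _)).
  assert (H3 := Rlt_le_trans _ _ _ (Rlt_le_trans _ _ _ Ht (Rmin_r _ _)) (Rmin_r _ _)).
  specialize (H t ltac:(lra)). assert (U := Rabs_pos (t - s)).
  rewrite <- pow2_abs in H. set (m := Rabs (t - s)) in *.
  replace (F t - F s)%C with ((F t - F s - d * RtoC (t - s)) + d * RtoC (t - s))%C by ring.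
  apply Rle_lt_trans with (1 := Cmod_triangle _ _). rewrite Cmod_mult, Cmod_R. fold m.
  assert (B * m ^ 2 <= Rabs B * m).
  { assert (B <= Rabs B) by apply Rle_abs. assert (m ^ 2 <= m) by nra.
    nra. }
  apply Rle_lt_trans with (A * m); [unfold A; nra |].
  replace eps with (A * (eps / A)) by (field; unfold A; lra).
  apply Rmult_lt_compat_l; [unfold A; lra | easy].
Qed.

Lemma nome_approx (m : R) : exists B r, 0 < r <= 1 /\
  quadratic_approx B r (fun h => nome (RtoC m * h)) (RtoC (2 * PI) * Ci * RtoC m).
Proof.
  destruct (quadratic_approx_nome (Rabs m) 1 (Rabs_pos m) Rle_0_1) as [B [r [Hr H]]].
  exists B, r. assert (P := Rabs_pos m). split.
  - split; [easy |]. apply Rle_trans with (1 := proj2 Hr).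
    rewrite <- Rinv_1. apply Rinv_le_contravar; lra.
  - destruct (H (RtoC 0) (RtoC m)) as [H1 H2]; [now rewrite Cmod_0 | rewrite Cmod_R; lra |].
    split.
    + now rewrite Cmult_1_l in H1.
    + intros h Hh. specialize (H2 h Hh). rewrite !Cmult_1_l in H2.
      replace (RtoC m * h / (1 + 0 * h))%C with (RtoC m * h)%C in H2; [easy |].
      field.
Qed.

(** The height is bounded above as well, unlike in [strip_regular]: a factor [nome (m z)] with
    [m < 0] grows with [Im z]. *)
Definition band_regular (g : C -> C) : Prop :=
  forall X y1 y2, 0 < y1 -> exists B r, 0 < r /\
    forall z, Rabs (Re z) <= X -> y1 <= Im z <= y2 -> quad_diff_at B r g z.

Lemma band_regular_nome f (m : R) : strip_regular f ->
  band_regular (fun z => f z * nome (RtoC m * z))%C.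
Proof.
  intros Hf X y1 y2 Hy.
  destruct (Hf X y1 Hy) as [B [r [Hr HB]]].
  destruct (nome_approx m) as [B' [r' [Hr' [G1 G]]]].
  set (g1 := (RtoC (2 * PI) * Ci * RtoC m)%C) in *.
  set (E0 := exp (2 * PI * Rabs m * Rabs y2)).
  assert (E0p : 0 < E0) by apply exp_pos.
  set (B2 := E0 * (B * (1 + 2 * B') + 2 * B * B' + B * B' + B)).
  exists B2, (Rmin r r'). split; [now apply Rmin_pos |].
  intros z Hx Hz. destruct (HB z Hx (proj1 Hz)) as [Bf [d [Hd HD]]].
  assert (P1 := Cmod_ge_0 d). assert (P2 := Cmod_ge_0 g1). assert (P3 := Cmod_ge_0 (f z)).
  assert (EE : Cmod (nome (RtoC m * z)) <= E0).
  { rewrite Cmod_nome, im_scal_l. unfold E0.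
    assert (Q : - (2 * PI) * (m * Im z) <= 2 * PI * Rabs m * Rabs y2).
    { assert (PP := PI_RGT_0). assert (R1 := Rle_abs (- m)). rewrite Rabs_Ropp in R1.
      assert (R2 := Rle_abs y2). assert (R3 := Rabs_pos m).
      assert (- m * Im z <= Rabs m * Rabs y2) by nra. nra. }
    destruct Q as [Q | ->]; [left; now apply exp_increasing | apply Rle_refl]. }
  set (e0 := nome (RtoC m * z)) in *.
  assert (P4 := Cmod_ge_0 e0).
  assert (BB : 0 <= B * B') by (apply Rmult_le_pos; lra).
  exists (e0 * (d + f z * g1))%C. split.
  - rewrite Cmod_mult.
    assert (T := Cmod_triangle d (f z * g1)). rewrite Cmod_mult in T.
    assert (Cmod (f z) * Cmod g1 <= B * B') by (apply Rmult_le_compat; auto).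
    unfold B2. apply Rmult_le_compat; auto using Cmod_ge_0. lra.
  - intros h Hh. cbv beta.
    specialize (HD h (Rle_trans _ _ _ Hh (Rmin_l _ _))).
    assert (Hh' := Rle_trans _ _ _ Hh (Rmin_r _ _)). specialize (G h Hh').
    assert (EN : nome (RtoC m * (z + h)) = (e0 * nome (RtoC m * h))%C).
    { unfold e0. rewrite <- nome_plus. f_equal. ring. }
    rewrite EN. fold e0. set (E := nome (RtoC m * h)) in *.
    replace (f (z + h)%C * (e0 * E) - f z * e0 - e0 * (d + f z * g1) * h)%C with
      (e0 * ((f (z + h)%C - f z - d * h) * ((E - 1 - g1 * h) + (1 + g1 * h)) +
         ((f z + d * h) * (E - 1 - g1 * h) + d * g1 * (h * h))))%C by ring.
    rewrite Cmod_mult.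
    assert (H0 := Cmod_ge_0 h). set (a := Cmod h) in *.
    assert (Ha : a <= 1) by lra. assert (Ha2 := pow2_ge_0 a). assert (Ha3 : a ^ 2 <= 1) by nra.
    set (u := (f (z + h)%C - f z - d * h)%C) in *. set (v := (E - 1 - g1 * h)%C) in *.
    assert (T0 := Cmod_triangle (u * (v + (1 + g1 * h))) ((f z + d * h) * v + d * g1 * (h * h))).
    assert (T1 := Cmod_triangle ((f z + d * h) * v) (d * g1 * (h * h))).
    assert (T2 := Cmod_triangle v (1 + g1 * h)). assert (T3 := Cmod_triangle 1 (g1 * h)).
    assert (T4 := Cmod_triangle (f z) (d * h)).
    rewrite !Cmod_mult in *. rewrite Cmod_1 in *. fold a in T1, T3, T4.
    assert (V1 : Cmod (v + (1 + g1 * h)) <= 1 + 2 * B') by nra.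
    assert (V2 : Cmod (f z + d * h) <= 2 * B) by nra.
    assert (V3 : Cmod u * Cmod (v + (1 + g1 * h)) <= (B * a ^ 2) * (1 + 2 * B'))
      by (apply Rmult_le_compat; auto using Cmod_ge_0).
    assert (V4 : Cmod (f z + d * h) * Cmod v <= 2 * B * (B' * a ^ 2))
      by (apply Rmult_le_compat; auto using Cmod_ge_0).
    assert (V5 : Cmod d * Cmod g1 * (a * a) <= B * B' * (a * a)).
    { apply Rmult_le_compat_r; [nra |]. apply Rmult_le_compat; auto. }
    unfold B2. rewrite Rmult_assoc. apply Rmult_le_compat; auto using Cmod_ge_0.
    nra.
Qed.

Lemma quad_diff_ccont B r g w s : 0 < r -> quad_diff_at B r g (w + RtoC s) ->
  ccont (fun t => g (w + RtoC t)%C) s.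
Proof.
  intros Hr [d [Hd H]]. apply ccont_of_quad with B r d; [easy |].
  intros t Ht. specialize (H (RtoC (t - s))). rewrite Cmod_R in H. specialize (H Ht).
  rewrite pow2_abs in H. rewrite RtoC_minus in *.
  now replace (w + s + (t - s))%C with (w + t)%C in H by ring.
Qed.

Lemma band_regular_ccont g w s : band_regular g -> 0 < Im w -> ccont (fun t => g (w + RtoC t)%C) s.
Proof.
  intros H Hw. destruct (H (Rabs (Re (w + RtoC s))) (Im w) (Im w) Hw) as [B [r [Hr HB]]].
  apply quad_diff_ccont with B r; [easy |]. apply HB; [lra |].
  rewrite im_plus, im_RtoC. lra.
Qed.

Lemma strip_regular_ccont g w s : strip_regular g -> 0 < Im w -> ccont (fun t => g (w + RtoC t)%C) s.
Proof.
  intros H. apply band_regular_ccont. intros X y1 y2 Hy.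
  destruct (H X y1 Hy) as [B [r [Hr HB]]]. exists B, r. split; [easy |].
  intros z Hx Hz. now apply HB.
Qed.

Lemma ccont_nome (m : R) w s : ccont (fun t => nome (RtoC m * (w + RtoC t))) s.
Proof.
  destruct (nome_approx m) as [B [r [Hr [_ H]]]].
  set (e0 := nome (RtoC m * (w + RtoC s))).
  apply ccont_of_quad with (Cmod e0 * B) r (e0 * (RtoC (2 * PI) * Ci * RtoC m))%C; [easy |].
  intros t Ht. specialize (H (RtoC (t - s))). rewrite Cmod_R in H. specialize (H Ht).
  rewrite pow2_abs in H.
  replace (nome (RtoC m * (w + RtoC t))) with (e0 * nome (RtoC m * RtoC (t - s)))%C.
  - fold e0. set (g1 := (RtoC (2 * PI) * Ci * RtoC m)%C) in *.
    replace (e0 * nome (RtoC m * RtoC (t - s)) - e0 - e0 * g1 * RtoC (t - s))%C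
      with (e0 * (nome (RtoC m * RtoC (t - s)) - 1 - g1 * RtoC (t - s)))%C by ring.
    rewrite Cmod_mult, Rmult_assoc. apply Rmult_le_compat_l; [apply Cmod_ge_0 | easy].
  - unfold e0. rewrite <- nome_plus. f_equal. rewrite RtoC_minus. ring.
Qed.

(* By the Cauchy-Riemann equations the vertical increment of [g] is [i] times the horizontal
   one up to second order, and the mean of the horizontal increment vanishes. *)
Lemma horizontal_mean_constant g : band_regular g ->
  (forall z, 0 < Im z -> g (z + 1)%C = g z) ->
  forall y1 y2, 0 < y1 <= y2 ->
  CInt (fun x => g ((0, y1) + RtoC x)%C) 0 1 = CInt (fun x => g ((0, y2) + RtoC x)%C) 0 1.
Proof.
  intros Hg Hp y1 y2 Hy.
  destruct (Hg 1 y1 y2 (proj1 Hy)) as [B [r [Hr HB]]].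
  apply (constant_of_quadratic (fun y => CInt (fun x => g ((0, y) + RtoC x)%C) 0 1) (2 * B) r);
    [easy | easy |].
  intros y e Hye He.
  set (F := fun (y x : R) => g ((0, y) + RtoC x)%C).
  change (Cmod (CInt (F (y + e)%R) 0 1 - CInt (F y) 0 1) <= 2 * B * e ^ 2).
  assert (Cc : forall y s, 0 < y -> ccont (F y) s) by (intros; now apply band_regular_ccont).
  assert (Cs : forall s, ccont (fun x => F y (x + e)%R) s) by (intros; apply ccont_shift, Cc; lra).
  assert (Per : CInt (fun x => F y (x + e)%R) 0 1 = CInt (F y) 0 1).
  { apply CInt_periodic; [intros; apply Cc; lra |]. intros s. unfold F.
    rewrite RtoC_plus, Cplus_assoc. apply Hp. rewrite im_plus. simpl. lra. }
  assert (E : (CInt (F (y + e)%R) 0 1 - CInt (F y) 0 1)%C =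
    CInt (fun x => (F (y + e)%R x + - (1) * F y x + (- Ci * F y (x + e)%R + Ci * F y x))%C) 0 1).
  { rewrite !CInt_plus, !CInt_scal, Per; try lra; [ring | ..]; intros;
      repeat apply ccont_plus; repeat (apply ccont_mult; [apply ccont_const |]); auto; apply Cc; lra. }
  rewrite E. replace (2 * B * e ^ 2) with ((1 - 0) * (2 * B * e ^ 2)) by ring.
  apply CInt_bound; [| lra |].
  - intros; repeat apply ccont_plus; repeat (apply ccont_mult; [apply ccont_const |]); auto; apply Cc; lra.
  - intros x Hx. set (z := ((0, y) + RtoC x)%C).
    destruct (HB z) as [d [Hd H]].
    { unfold z. rewrite re_plus. simpl. apply Rabs_le. lra. }
    { unfold z. rewrite im_plus. simpl. lra. }
    assert (H1 := H (RtoC e)). assert (H2 := H (Ci * RtoC e)%C).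
    rewrite Cmod_mult, Cmod_Ci, Cmod_R, Rabs_pos_eq, Rmult_1_l in H2 by lra.
    rewrite Cmod_R, Rabs_pos_eq in H1 by lra.
    specialize (H1 ltac:(lra)). specialize (H2 ltac:(lra)).
    replace (F (y + e)%R x) with (g (z + Ci * RtoC e)%C)
      by (unfold F, z; f_equal; apply C_ext; simpl; ring).
    replace (F y (x + e)%R) with (g (z + RtoC e)%C)
      by (unfold F, z; f_equal; apply C_ext; simpl; ring).
    replace (F y x) with (g z) by easy.
    (* The linear parts [d (i e)] and [- i (d e)] cancel, leaving two second-order remainders. *)
    replace (g (z + Ci * RtoC e)%C + - (1) * g z + (- Ci * g (z + RtoC e)%C + Ci * g z))%C
      with ((g (z + Ci * RtoC e)%C - g z - d * (Ci * RtoC e))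
            + - Ci * (g (z + RtoC e)%C - g z - d * RtoC e))%C by ring.
    apply Rle_trans with (1 := Cmod_triangle _ _).
    rewrite Cmod_mult, Cmod_opp, Cmod_Ci. lra.
Qed.

(** * Expansion of periodic holomorphic functions *)

Lemma nome_real (t : R) : nome (RtoC t) = (cos (2 * PI * t), sin (2 * PI * t)).
Proof.
  unfold nome, Cexp. rewrite re_2PI_Ci, im_2PI_Ci, im_RtoC, re_RtoC, Rmult_0_r, exp_0.
  now rewrite !Rmult_1_l.
Qed.

Lemma nome_real_neq_1 (s : R) : (forall m : Z, s <> IZR m) -> nome (RtoC s) <> RtoC 1.
Proof.
  intros H E. destruct (base_Int_part s) as [H1 H2]. set (m := Int_part s) in *.
  assert (H3 := H m).
  replace (RtoC s) with (RtoC (s - IZR m) + RtoC (IZR m))%C in E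
    by (rewrite RtoC_minus; ring).
  rewrite nome_plus_Z, nome_real in E. set (t := s - IZR m) in *.
  assert (T : 0 < t < 1) by (unfold t in *; lra).
  apply (f_equal Re) in E. simpl in E.
  replace (2 * PI * t) with (2 * (PI * t)) in E by ring. rewrite cos_2a_sin in E.
  assert (P := PI_RGT_0).
  assert (0 < sin (PI * t)) by (apply sin_gt_0; nra). nra.
Qed.

Lemma nome_half : nome (RtoC (1 / 2)) = RtoC (- 1).
Proof.
  rewrite nome_real. replace (2 * PI * (1 / 2)) with PI by field.
  rewrite cos_PI, sin_PI. apply C_ext; simpl; ring.
Qed.

Definition fourier_char (n : Z) (s : R) : C := nome (RtoC (IZR n) * RtoC s).

Lemma fourier_char_ccont n s : ccont (fourier_char n) s.
Proof.
  replace (fourier_char n) with (fun t => nome (RtoC (IZR n) * (0 + RtoC t))).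
  - apply ccont_nome.
  - apply functional_extensionality. intros t. unfold fourier_char. now rewrite Cplus_0_l.
Qed.

Lemma fourier_char_plus n s t : fourier_char n (s + t) = (fourier_char n s * fourier_char n t)%C.
Proof.
  unfold fourier_char. rewrite <- nome_plus, RtoC_plus. f_equal. ring.
Qed.

Lemma fourier_char_1 n : fourier_char n 1 = RtoC 1.
Proof.
  unfold fourier_char. rewrite Cmult_1_r. apply nome_Z.
Qed.

Lemma Cmod_fourier_char n s : Cmod (fourier_char n s) = 1.
Proof.
  unfold fourier_char. rewrite Cmod_nome, im_scal_l, im_RtoC, !Rmult_0_r. apply exp_0.
Qed.

Lemma fourier_char_half_period n : n <> 0%Z -> fourier_char n (1 / (2 * IZR n)) = RtoC (- 1).
Proof.
  intros N. unfold fourier_char. rewrite <- nome_half, <- RtoC_mult. do 2 f_equal.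
  field. now apply not_0_IZR.
Qed.

(* Translation by half a period of the character changes its sign, which turns the coefficient
   into the mean of [u s - u (s + 1 / 2n)]. *)
Lemma riemann_lebesgue (u : R -> C) :
  (forall s, ccont u s) -> (forall s, u (s + 1) = u s) ->
  forall eps, 0 < eps -> exists N : Z, forall n, (N <= Z.abs n)%Z ->
    Cmod (CInt (fun s => (u s * fourier_char n s)%C) 0 1) < eps.
Proof.
  intros Hu Hp eps He.
  (* A point of [[0,1]] translated by at most [1] in either direction stays in [[-1,2]]. *)
  destruct (ccont_uniform u (-1) 2 Hu eps He) as [delta [D H]].
  exists (up (/ delta) + 1)%Z. intros n Hn.
  assert (U := archimed (/ delta)). destruct U as [U _].
  assert (D0 : 0 < / delta) by now apply Rinv_0_lt_compat.
  apply IZR_le in Hn. rewrite plus_IZR, abs_IZR in Hn.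
  assert (N0 : n <> 0%Z) by (intros ->; rewrite Rabs_R0 in Hn; lra).
  set (e := 1 / (2 * IZR n)).
  assert (Ee : Rabs e = / (2 * Rabs (IZR n))).
  { unfold e, Rdiv. rewrite Rmult_1_l, Rabs_inv, Rabs_mult, (Rabs_pos_eq 2) by lra. easy. }
  assert (E1 : Rabs e < delta).
  { rewrite Ee. replace delta with (/ / delta) by (now rewrite Rinv_inv).
    apply Rinv_lt_contravar; [apply Rmult_lt_0_compat|]; lra. }
  assert (E2 : Rabs e <= 1).
  { rewrite Ee, <- Rinv_1. apply Rinv_le_contravar; [lra |].
    assert (1 <= Rabs (IZR n)); [| lra]. rewrite <- abs_IZR. apply IZR_le. lia. }
  apply Rabs_le_between in E2.
  set (F := fun s => (u s * fourier_char n s)%C).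
  assert (CF : forall s, ccont F s) by (intros; apply ccont_mult; [apply Hu | apply fourier_char_ccont]).
  assert (PF : forall s, F (s + 1) = F s).
  { intros s. unfold F. rewrite Hp, fourier_char_plus, fourier_char_1. ring. }
  assert (S := CInt_periodic F e CF PF).
  assert (CFe : forall s, ccont (fun t => F (t + e)) s) by (intros; now apply ccont_shift).
  assert (T : (2 * CInt F 0 1)%C = CInt (fun s => (F s + F (s + e)%R)%C) 0 1).
  { rewrite CInt_plus, S by (auto; lra). ring. }
  assert (M : Cmod (CInt (fun s => (F s + F (s + e)%R)%C) 0 1) <= (1 - 0) * eps).
  { apply CInt_bound; [| lra |].
    - intros; now apply ccont_plus.
    - intros s Hs. unfold F. unfold e at 2. rewrite fourier_char_plus, fourier_char_half_period by easy.
      fold e.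
      replace (u s * fourier_char n s + u (s + e)%R * (fourier_char n s * -1))%C
        with ((u s - u (s + e)%R) * fourier_char n s)%C by ring.
      rewrite Cmod_mult, Cmod_fourier_char, Rmult_1_r. left. apply H; try lra.
      replace (s - (s + e)) with (- e) by ring. now rewrite Rabs_Ropp. }
  rewrite <- T, Cmod_mult, Cmod_R, Rabs_pos_eq in M by lra.
  change (Cmod (CInt F 0 1) < eps). lra.
Qed.

(** Translation by half a period changes the sign of the character but not its mean. *)
Lemma fourier_char_mean n : n <> 0%Z -> CInt (fourier_char n) 0 1 = RtoC 0.
Proof.
  intros N.
  assert (S := CInt_periodic (fourier_char n) (1 / (2 * IZR n)) (fourier_char_ccont n)).
  assert (P : forall s, fourier_char n (s + 1) = fourier_char n s)
    by (intros; rewrite fourier_char_plus, fourier_char_1; ring).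
  specialize (S P).
  rewrite (CInt_ext _ (fun s => (RtoC (- 1) * fourier_char n s)%C)) in S; [| lra |].
  - rewrite CInt_scal in S by (try lra; intros; apply fourier_char_ccont).
    set (v := CInt _ _ _) in *.
    assert (E : (2 * v)%C = RtoC 0).
    { replace (2 * v)%C with (v - (- 1) * v)%C by ring. rewrite S. ring. }
    replace v with (2 * v / 2)%C by field. rewrite E. field.
  - intros s _. rewrite fourier_char_plus, fourier_char_half_period by easy. ring.
Qed.

(** At an integer the denominator vanishes to first order and so, by periodicity, does the
    numerator. The singularity is removed by the value [d / (2 pi i)], as [nome s - 1] is [2 pi i s]
    to first order at [0]. *)
Lemma difference_quotient_ccont f w B r d :
  (forall s, ccont (fun t => f (w + RtoC t)%C) s) ->
  (forall t, f (w + RtoC (t + 1))%C = f (w + RtoC t)%C) ->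
  0 < r -> (forall h, Cmod h <= r -> Cmod (f (w + h)%C - f w - d * h) <= B * Cmod h ^ 2) ->
  exists u : R -> C, (forall s, ccont u s) /\ (forall s, u (s + 1) = u s) /\
    forall s, (u s * (nome (RtoC s) - 1))%C = (f (w + RtoC s)%C - f w)%C.
Proof.
  intros Cf Pf Hr Hd.
  assert (PZ : forall (m : Z) t, f (w + RtoC (t + IZR m))%C = f (w + RtoC t)%C).
  { assert (PN : forall (m : nat) t, f (w + RtoC (t + INR m))%C = f (w + RtoC t)%C).
    { induction m as [| m IH]; intros t; [now rewrite Rplus_0_r |].
      rewrite S_INR, <- Rplus_assoc, Pf. apply IH. }
    intros m t. destruct (Z_le_gt_dec 0 m) as [Hm | Hm].
    - rewrite <- (Z2Nat.id m Hm), <- INR_IZR_INZ. apply PN.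
    - rewrite <- (PN (Z.to_nat (- m))). do 3 f_equal.
      rewrite INR_IZR_INZ, Z2Nat.id, opp_IZR by lia. ring. }
  set (isint := fun s => exists m : Z, s = IZR m).
  assert (dec : forall s, {isint s} + {~ isint s}) by (intros; apply excluded_middle_informative).
  set (d1 := (d / (RtoC (2 * PI) * Ci))%C).
  assert (PP := PI_RGT_0).
  assert (N2 : (RtoC (2 * PI) * Ci)%C <> RtoC 0).
  { apply Cmult_neq_0; [| apply Ci_nz]. intros E. apply RtoC_inj in E. lra. }
  set (u := fun s => if dec s then d1 else ((f (w + RtoC s)%C - f w) / (nome (RtoC s) - 1))%C).
  assert (NN : forall s, ~ isint s -> (nome (RtoC s) - 1)%C <> RtoC 0).
  { intros s Hs E. apply (nome_real_neq_1 s); [intros m ->; apply Hs; now exists m |].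
    now apply Ceq_minus. }
  assert (IZ : forall s m, isint (s + IZR m) <-> isint s).
  { intros s m. split; intros [k E].
    - exists (k - m)%Z. rewrite minus_IZR. lra.
    - exists (k + m)%Z. rewrite plus_IZR. lra. }
  assert (uZ : forall s m, u (s + IZR m) = u s).
  { intros s m. unfold u. assert (Q := IZ s m).
    destruct (dec (s + IZR m)), (dec s); try tauto.
    now rewrite PZ, RtoC_plus, nome_plus_Z. }
  exists u. split; [| split].
  - assert (C0 : ccont u 0).
    { destruct (nome_approx 1) as [B' [r' [Hr' [G1 G]]]].
      rewrite Cmult_1_r in G1. set (g := (RtoC (2 * PI) * Ci)%C) in *.
      assert (Eg : Cmod g = 2 * PI).
      { unfold g. rewrite Cmod_mult, Cmod_R, Cmod_Ci, Rabs_pos_eq by lra. ring. }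
      assert (HB' : 0 <= B') by lra.
      set (A := Rabs B * Cmod g + Cmod d * B' + 1).
      assert (HA : 0 < A).
      { assert (0 <= Rabs B * Cmod g) by (apply Rmult_le_pos; [apply Rabs_pos | apply Cmod_ge_0]).
        assert (0 <= Cmod d * B') by (apply Rmult_le_pos; [apply Cmod_ge_0 | easy]). unfold A; lra. }
      assert (u0 : u 0 = d1).
      { unfold u. destruct (dec 0) as [_ | n]; [easy |]. elim n. now exists 0%Z. }
      intros eps He.
      exists (Rmin (Rmin r r') (Rmin (Rmin 1 (/ (B' + 1))) (eps / A))). split.
      { repeat apply Rmin_pos; try lra; [apply Rinv_0_lt_compat | apply Rdiv_lt_0_compat]; lra. }
      intros t Ht. rewrite Rminus_0_r in Ht.
      apply Rmin_Rgt in Ht. destruct Ht as [Ht1 Ht2].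
      apply Rmin_Rgt in Ht1. destruct Ht1 as [Htr Htr'].
      apply Rmin_Rgt in Ht2. destruct Ht2 as [Ht2 Hte].
      apply Rmin_Rgt in Ht2. destruct Ht2 as [Ht1 HtB].
      rewrite u0. unfold u. destruct (dec t) as [_ | n].
      - replace (d1 - d1)%C with (RtoC 0) by ring. now rewrite Cmod_0.
      - assert (t0 : 0 < Rabs t).
        { apply Rabs_pos_lt. intros ->. apply n. now exists 0%Z. }
        specialize (Hd (RtoC t)). specialize (G (RtoC t)). rewrite Cmod_R in Hd, G.
        specialize (Hd ltac:(lra)). specialize (G ltac:(lra)).
        rewrite Cmult_1_l, Cmult_1_r in G. fold g in G.
        assert (Nt := NN t n).
        set (X := (f (w + RtoC t)%C - f w)%C) in *. set (Y := (nome (RtoC t) - 1)%C) in *.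
        set (a := Rabs t) in *.
        replace (X / Y - d1)%C with (((X - d * t) * g - d * (Y - g * t)) / (Y * g))%C
          by (unfold d1; field; now split).
        assert (T := Cmod_triangle ((X - d * t) * g) (- (d * (Y - g * t)))).
        rewrite Cmod_opp, !Cmod_mult in T.
        (* From [|Y| >= 2 pi a - B' a^2] and [B' a < 1]. *)
        assert (Yb : a <= Cmod Y).
        { assert (W := Cmod_ge_minus (g * t) (Y - g * t)).
          replace (g * t + (Y - g * t))%C with Y in W by ring.
          rewrite Cmod_mult, Cmod_R, Eg in W. fold a in W.
          assert (Q2 := PI2_1).
          assert (a * (B' + 1) < 1).
          { replace 1 with (/ (B' + 1) * (B' + 1)) at 2 by (field; lra).
            apply Rmult_lt_compat_r; lra. }
          nra. }
        rewrite Cmod_div, Cmod_mult by now apply Cmult_neq_0.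
        assert (Num : Cmod ((X - d * t) * g - d * (Y - g * t)) <= A * a ^ 2).
        { apply Rle_trans with (1 := T).
          assert (B * a ^ 2 <= Rabs B * a ^ 2)
            by (apply Rmult_le_compat_r; [apply pow2_ge_0 | apply Rle_abs]).
          assert (Cmod d * Cmod (Y - g * t) <= Cmod d * (B' * a ^ 2))
            by (apply Rmult_le_compat_l; [apply Cmod_ge_0 | lra]).
          unfold A. nra. }
        assert (Q2 := PI2_1).
        assert (Den : a <= Cmod Y * Cmod g) by (rewrite Eg; nra).
        apply Rle_lt_trans with (A * a ^ 2 / a).
        + unfold Rdiv. apply Rmult_le_compat; auto using Cmod_ge_0.
          * left. apply Rinv_0_lt_compat. lra.
          * apply Rinv_le_contravar; lra.
        + replace (A * a ^ 2 / a) with (A * a) by (field; lra).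
          replace eps with (A * (eps / A)) by (field; lra).
          apply Rmult_lt_compat_l; lra. }
    intros s. destruct (dec s) as [[m Em] | n].
    + replace u with (fun t => u (t + IZR (- m)))
        by (apply functional_extensionality; intros; apply uZ).
      apply ccont_shift. rewrite Em, opp_IZR, Rplus_opp_r. exact C0.
    + apply ccont_ext_near with (fun t => ((f (w + RtoC t)%C - f w) / (nome (RtoC t) - 1))%C).
      * unfold u. now destruct (dec s).
      (* Near a non-integer [s], [nome] stays different from [1], its value at the integers; so no
         integer comes close and [u] is the plain quotient there. *)
      * assert (Cn : ccont (fun t => (fourier_char 1 t + - (1))%C) s)
          by (apply ccont_plus; [apply fourier_char_ccont | apply ccont_const]).
        assert (Q : 0 < Cmod (nome (RtoC s) - 1)) by (apply Cmod_gt_0; now apply NN).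
        destruct (Cn _ Q) as [dl [D Hdl]]. exists dl. split; [easy |].
        intros t Ht. specialize (Hdl t Ht). unfold fourier_char in Hdl. rewrite !Cmult_1_l in Hdl.
        unfold u. destruct (dec t) as [[k Ek] | _]; [| easy].
        exfalso. rewrite Ek, nome_Z in Hdl.
        replace (1 + - (1) - (nome s + - (1)))%C with (- (nome s - 1))%C in Hdl by ring.
        rewrite Cmod_opp in Hdl. lra.
      * apply ccont_mult; [apply ccont_plus; [apply Cf | apply ccont_const] |].
        apply ccont_inv; [now apply NN |]. apply ccont_plus; [| apply ccont_const].
        replace (fun t => nome (RtoC t)) with (fourier_char 1);
          [apply fourier_char_ccont |].
        apply functional_extensionality. intros t. unfold fourier_char. now rewrite Cmult_1_l.
  - intros s. apply (uZ s 1%Z).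
  - intros s. unfold u. destruct (dec s) as [[m ->] | n].
    + rewrite nome_Z. replace (f (w + RtoC (IZR m))%C) with (f (w + RtoC (0 + IZR m))%C)
        by now rewrite Rplus_0_l.
      rewrite PZ, Cplus_0_r. ring.
    + field. now apply NN.
Qed.

(* The coefficients of [u = (f(w + s) - f w) / (e(s) - 1)] satisfy
   [u_(n-1) - u_n = a_n e(nw) - f(w) delta_(n,0)]; the [u_n] tend to [0] at both ends, so the
   relation telescopes to the expansion of [f] at [w]. *)
Lemma q_expansion (f : C -> C) : strip_regular f ->
  (forall z, 0 < Im z -> f (z + 1)%C = f z) ->
  (exists A, forall z, Rabs (Re z) <= 1 -> 1 <= Im z -> Cmod (f z) <= A / Im z) ->
  exists a : nat -> C, a 0%nat = RtoC 0 /\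
    forall w, 0 < Im w -> is_series (K := C_AbsRing) (V := C_NormedModule)
      (fun n => (a n * nome w ^ n)%C) (f w).
Proof.
  intros Hf Hp [A HA].
  set (G := fun (n : Z) z => (f z * nome (RtoC (IZR (- n)) * z))%C).
  set (cf := fun n => CInt (fun s => G n ((0, 1) + RtoC s)%C) 0 1).
  assert (GR : forall n, band_regular (G n)) by (intros; now apply band_regular_nome).
  assert (GP : forall n z, 0 < Im z -> G n (z + 1)%C = G n z).
  { intros n z Hz. unfold G. rewrite Hp by easy.
    replace (RtoC (IZR (- n)) * (z + 1))%C with (RtoC (IZR (- n)) * z + RtoC (IZR (- n)))%C by ring.
    now rewrite nome_plus_Z. }
  assert (cfY : forall n y, 0 < y -> CInt (fun s => G n ((0, y) + RtoC s)%C) 0 1 = cf n).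
  { intros n y Hy. unfold cf. destruct (Rle_dec y 1).
    - apply horizontal_mean_constant; auto; lra.
    - symmetry. apply horizontal_mean_constant; auto; lra. }
  (* Periodicity frees the real part of the base point, as [cfY] freed its height. *)
  assert (cfW : forall n w, 0 < Im w -> CInt (fun s => G n (w + RtoC s)%C) 0 1 = cf n).
  { intros n w Hw. rewrite <- (cfY n (Im w) Hw).
    rewrite <- (CInt_periodic (fun s => G n ((0, Im w) + RtoC s)%C) (Re w)).
    - apply CInt_ext; [lra |]. intros s _. f_equal. apply C_ext; unfold Re, Im; simpl; ring.
    - intros s. apply band_regular_ccont; auto.
    - intros s. rewrite RtoC_plus, Cplus_assoc. apply GP. rewrite im_plus. simpl. lra. }
  (* Raise the height [y] to infinity: for [n <= 0] the factor [nome (- n z)] has modulus at most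
     [1], so the mean is at most [A / y]. *)
  assert (cf0 : forall n, (n <= 0)%Z -> cf n = RtoC 0).
  { intros n Hn. apply Cmod_small_eq. intros eps He.
    set (y := Rmax 1 ((Rabs A + 1) / eps)).
    assert (Y1 : 1 <= y) by apply Rmax_l.
    assert (Y2 : (Rabs A + 1) / eps <= y) by apply Rmax_r.
    replace (cf n - 0)%C with (cf n) by ring. rewrite <- (cfY n y) by lra.
    assert (Q' := Rle_abs A).
    apply Rle_lt_trans with ((1 - 0) * (A / y)).
    - apply CInt_bound; [| lra |].
      + intros s _. apply band_regular_ccont; auto. simpl. lra.
      + intros s Hs. unfold G. rewrite Cmod_mult.
        assert (Iz : Im ((0, y) + RtoC s)%C = y) by (simpl; ring).
        assert (HAz : Cmod (f ((0, y) + RtoC s)%C) <= A / y).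
        { rewrite <- Iz at 2. apply HA; [| lra]. simpl. rewrite Rplus_0_l, Rabs_pos_eq; lra. }
        assert (Cmod (nome (RtoC (IZR (- n)) * ((0, y) + RtoC s))) <= 1).
        { rewrite Cmod_nome, im_scal_l, Iz, opp_IZR, <- exp_0.
          assert (IZR n <= 0) by now apply IZR_le. assert (PP := PI_RGT_0).
          assert (M : - (2 * PI) * (- IZR n * y) <= 0) by (assert (IZR n * y <= 0) by nra; nra).
          destruct M as [M | ->]; [left; now apply exp_increasing | lra]. }
        assert (P1 := Cmod_ge_0 (f ((0, y) + RtoC s)%C)).
        nra.
    - rewrite Rminus_0_r, Rmult_1_l.
      apply Rmult_lt_reg_r with y; [lra |]. unfold Rdiv. rewrite Rmult_assoc, Rinv_l by lra.
      apply (Rmult_le_compat_r eps) in Y2; [| lra].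
      unfold Rdiv in Y2. rewrite Rmult_assoc, Rinv_l in Y2; lra. }
  exists (fun n => cf (Z.of_nat n)). split; [apply (cf0 0%Z); lia |].
  intros w Hw.
  destruct (Hf (Rabs (Re w)) (Im w) Hw) as [B [r [Hr HB]]].
  destruct (HB w (Rle_refl _) (Rle_refl _)) as [_ [d [_ Hd]]].
  assert (Cf : forall s, ccont (fun t => f (w + RtoC t)%C) s)
    by (intros; now apply strip_regular_ccont).
  assert (Pf : forall t, f (w + RtoC (t + 1))%C = f (w + RtoC t)%C).
  { intros t. rewrite RtoC_plus, Cplus_assoc. apply Hp. rewrite im_plus, im_RtoC. lra. }
  destruct (difference_quotient_ccont f w B r d Cf Pf Hr Hd) as [u [Cu [Pu Eu]]].
  (* With this sign convention [uh (- n)] is the usual Fourier coefficient of [u] of index [n]. *)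
  set (uh := fun n => CInt (fun s => (u s * fourier_char n s)%C) 0 1).
  assert (CM : forall g n s, (forall s, ccont g s) -> ccont (fun t => (g t * fourier_char n t)%C) s)
    by (intros; apply ccont_mult; [auto | apply fourier_char_ccont]).
  assert (Rel : forall n : Z, (uh (- n + 1)%Z - uh (- n)%Z)%C
     = (cf n * nome (RtoC (IZR n) * w) - f w * CInt (fourier_char (- n)) 0 1)%C).
  { intros n. rewrite <- (cfW n w Hw).
    transitivity (CInt (fun s => (nome (RtoC (IZR n) * w) * G n (w + RtoC s)%C
       + (- f w) * fourier_char (- n) s)%C) 0 1).
    - unfold uh.
      replace (CInt (fun s => (u s * fourier_char (- n + 1) s)%C) 0 1 -
               CInt (fun s => (u s * fourier_char (- n) s)%C) 0 1)%C
        with (CInt (fun s => (u s * fourier_char (- n + 1) s)%C) 0 1 +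
              - (1) * CInt (fun s => (u s * fourier_char (- n) s)%C) 0 1)%C by ring.
      rewrite <- CInt_scal, <- CInt_plus; try lra; auto.
      2: { intros; apply ccont_mult; [apply ccont_const | auto]. }
      apply CInt_ext; [lra |]. intros s _.
      assert (E1 : fourier_char (- n + 1) s = (fourier_char (- n) s * nome (RtoC s))%C).
      { unfold fourier_char. rewrite <- nome_plus, plus_IZR, RtoC_plus. f_equal. ring. }
      assert (E2 : (nome (RtoC (IZR n) * w) * G n (w + RtoC s)%C)%C
                   = (f (w + RtoC s)%C * fourier_char (- n) s)%C).
      { unfold G, fourier_char.
        replace (nome (RtoC (IZR n) * w) * (f (w + s)%C * nome (RtoC (IZR (- n)) * (w + s))))%C
          with (f (w + s)%C * (nome (RtoC (IZR n) * w) * nome (RtoC (IZR (- n)) * (w + s))))%C by ring.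
        f_equal. rewrite <- nome_plus. f_equal. rewrite opp_IZR, RtoC_opp. ring. }
      rewrite E1, E2.
      replace (u s * (fourier_char (- n) s * nome s) + - (1) * (u s * fourier_char (- n) s))%C
        with (u s * (nome s - 1) * fourier_char (- n) s)%C by ring.
      rewrite Eu. ring.
    - assert (C1 : forall s, ccont (fun t => G n (w + RtoC t)%C) s)
        by (intros; now apply band_regular_ccont).
      assert (C2 := fourier_char_ccont (- n)).
      rewrite CInt_plus, !CInt_scal; try lra; auto;
        [ring | ..]; intros; apply ccont_mult; auto using ccont_const. }
  assert (RL : forall eps, 0 < eps -> exists N : Z, forall n, (N <= Z.abs n)%Z -> Cmod (uh n) < eps)
    by exact (riemann_lebesgue u Cu Pu).
  (* For negative [n] the right-hand side of [Rel] vanishes, so [uh] is constant on positive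
     indices, and the constant is its limit [0]. *)
  assert (U1 : uh 1%Z = RtoC 0).
  { assert (I : forall j : nat, uh (1 + Z.of_nat j)%Z = uh 1%Z).
    { induction j as [| j IH]; [easy |]. rewrite <- IH.
      specialize (Rel (- (1 + Z.of_nat j))%Z).
      rewrite (cf0 (- (1 + Z.of_nat j))%Z), Z.opp_involutive, fourier_char_mean in Rel by lia.
      apply Ceq_minus. replace (1 + Z.of_nat (S j))%Z with (1 + Z.of_nat j + 1)%Z by lia.
      rewrite Rel. ring. }
    apply Cmod_small_eq. intros eps He. destruct (RL eps He) as [N HN].
    rewrite <- (I (Z.to_nat N)). replace (uh _ - 0)%C with (uh (1 + Z.of_nat (Z.to_nat N))%Z) by ring.
    apply (HN (1 + Z.of_nat (Z.to_nat N))%Z). lia. }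
  (* At [n = 0] the character has mean [1]: this is where the value [f w] enters the telescoping
     sum. *)
  assert (U0 : uh 0%Z = f w).
  { specialize (Rel 0%Z). simpl in Rel. rewrite U1, (cf0 0%Z) in Rel by lia.
    replace (CInt (fourier_char 0) 0 1) with (RtoC 1) in Rel.
    - apply Ceq_minus. replace (uh 0%Z - f w)%C with (- (0 - uh 0%Z) - f w)%C by ring.
      rewrite Rel. ring.
    - symmetry. apply CInt_unique.
      apply (is_RInt_ext (V := C_R_NormedModule) (fun _ => RtoC 1)).
      + intros s _. unfold fourier_char. rewrite Cmult_0_l. symmetry. apply nome_0.
      + assert (I1 := is_RInt_const (V := C_R_NormedModule) 0 1 (RtoC 1)).
        rewrite scal_R_Cmult in I1. rewrite Rminus_0_r, Cmult_1_l in I1. exact I1. }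
  set (b := fun n => (cf (Z.of_nat n) * nome w ^ n)%C).
  assert (Sm : forall n, sum_n (G := C_AbelianMonoid) b n = (f w - uh (- Z.of_nat n)%Z)%C).
  { induction n as [| n IH].
    - rewrite sum_O. unfold b. simpl. rewrite U0, (cf0 0%Z) by lia. ring.
    - rewrite sum_Sn, IH. specialize (Rel (Z.of_nat (S n))).
      rewrite fourier_char_mean in Rel by lia.
      replace (- Z.of_nat (S n) + 1)%Z with (- Z.of_nat n)%Z in Rel by lia.
      unfold b. rewrite nome_pow, INR_IZR_INZ.
      change (plus (f w - uh (- Z.of_nat n)%Z)%C ?x) with ((f w - uh (- Z.of_nat n)%Z) + x)%C.
      replace (cf (Z.of_nat (S n)) * nome (RtoC (IZR (Z.of_nat (S n))) * w))%C
        with (uh (- Z.of_nat n)%Z - uh (- Z.of_nat (S n))%Z)%C by (rewrite Rel; ring).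
      assert (Q : forall x y z : C, (x - y + (y - z))%C = (x - z)%C) by (intros; ring).
      apply Q. }
  apply (proj2 (filterlim_locally (U := C_NormedModule) (sum_n (G := C_AbelianMonoid) b) (f w))).
  intros eps. destruct (RL eps (cond_pos eps)) as [N HN].
  exists (Z.to_nat N). intros n Hn. rewrite Sm.
  apply (C_NormedModule_mixin_compat1 (f w) (f w - uh (- Z.of_nat n)%Z)%C eps).
  change (Cmod (f w - uh (- Z.of_nat n)%Z - f w) < eps).
  replace (f w - uh (- Z.of_nat n)%Z - f w)%C with (- uh (- Z.of_nat n)%Z)%C by ring.
  rewrite Cmod_opp. apply (HN (- Z.of_nat n)%Z). lia.
Qed.

(** * Dirichlet characters and Gauss sums *)

Definition residues (D : nat) : list Z := map Z.of_nat (seq 0 D).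

Lemma in_residues D a : In a (residues D) <-> (0 <= a < Z.of_nat D)%Z.
Proof.
  unfold residues. rewrite in_map_iff. split.
  - intros [n [<- H]]. apply in_seq in H. lia.
  - intros H. exists (Z.to_nat a). rewrite in_seq. lia.
Qed.

Lemma NoDup_residues D : NoDup (residues D).
Proof.
  apply Injective_map_NoDup; [intros x y; apply Nat2Z.inj | apply seq_NoDup].
Qed.

Lemma length_residues D : length (residues D) = D.
Proof. unfold residues. now rewrite length_map, length_seq. Qed.

Lemma lsum_Permutation {T} (f : T -> C) l l' : Permutation l l' -> lsum f l = lsum f l'.
Proof.
  induction 1; simpl; auto; [now rewrite IHPermutation | ring | congruence].
Qed.

Lemma periodic_Z (D : nat) (f : Z -> C) : (forall a, f (a + Z.of_nat D)%Z = f a) ->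
  forall a t, f (a + t * Z.of_nat D)%Z = f a.
Proof.
  intros H.
  assert (N : forall (t : nat) a, f (a + Z.of_nat t * Z.of_nat D)%Z = f a).
  { induction t as [| t IH]; intros a; [f_equal; lia |].
    rewrite Nat2Z.inj_succ, <- (IH a), <- (H (a + Z.of_nat t * _)%Z). f_equal. lia. }
  intros a t. destruct (Z_le_gt_dec 0 t) as [Ht | Ht].
  - rewrite <- (Z2Nat.id t Ht). apply N.
  - rewrite <- (N (Z.to_nat (- t))). f_equal. lia.
Qed.

Lemma periodic_mod (D : nat) (f : Z -> C) : (1 <= D)%nat ->
  (forall a, f (a + Z.of_nat D)%Z = f a) -> forall a, f (a mod Z.of_nat D)%Z = f a.
Proof.
  intros HD H a. rewrite (Z.div_mod a (Z.of_nat D)) at 2 by lia.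
  rewrite Z.add_comm, Z.mul_comm. symmetry. now apply periodic_Z.
Qed.

(** An injection of a finite set into itself is a permutation, so only injectivity modulo [D] is
    asked of [sigma]. *)
Lemma lsum_residues_bij (D : nat) (f : Z -> C) (sigma : Z -> Z) : (1 <= D)%nat ->
  (forall a, f (a + Z.of_nat D)%Z = f a) ->
  (forall a b, In a (residues D) -> In b (residues D) ->
     (sigma a mod Z.of_nat D = sigma b mod Z.of_nat D)%Z -> a = b) ->
  lsum (fun a => f (sigma a)) (residues D) = lsum f (residues D).
Proof.
  intros HD H Hs.
  rewrite (lsum_ext _ (fun a => f (sigma a mod Z.of_nat D)%Z))
    by (intros; now rewrite periodic_mod).
  rewrite <- (lsum_map (fun a => (sigma a mod Z.of_nat D)%Z) f).
  apply lsum_Permutation, NoDup_Permutation_bis.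
  - assert (G : forall l, (forall a, In a l -> In a (residues D)) -> NoDup l ->
              NoDup (map (fun a => (sigma a mod Z.of_nat D)%Z) l)).
    { induction l as [| x l IH]; intros Hi Hn; [constructor |].
      inversion Hn; subst. simpl. constructor.
      - intros I. apply in_map_iff in I. destruct I as [y [E I]].
        assert (y = x) by (apply Hs; auto; apply Hi; simpl; auto). now subst.
      - apply IH; auto. intros; apply Hi; now right. }
    apply G; auto using NoDup_residues.
  - now rewrite length_map.
  - intros x Hx. apply in_map_iff in Hx. destruct Hx as [y [<- _]].
    apply in_residues, Z.mod_pos_bound. lia.
Qed.

Lemma mod_eq_sub a b D : (0 < D)%Z -> (a mod D = b mod D)%Z -> exists t, (a - b = t * D)%Z.
Proof.
  intros H E. exists (a / D - b / D)%Z.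
  rewrite (Z.div_mod a D), (Z.div_mod b D) at 1 by lia. rewrite E. ring.
Qed.

Lemma residues_eq D a b t : In a (residues D) -> In b (residues D) ->
  (a - b = t * Z.of_nat D)%Z -> a = b.
Proof.
  rewrite !in_residues. intros. assert (t = 0)%Z by nia. lia.
Qed.

Definition root_of_unity (D : nat) (x : Z) : C := nome (RtoC (IZR x / INR D)).

Lemma root_of_unity_plus D x y :
  root_of_unity D (x + y) = (root_of_unity D x * root_of_unity D y)%C.
Proof.
  unfold root_of_unity. rewrite <- nome_plus, <- RtoC_plus, plus_IZR. do 2 f_equal. unfold Rdiv. ring.
Qed.

Lemma root_of_unity_mult D t : (1 <= D)%nat -> root_of_unity D (t * Z.of_nat D) = RtoC 1.
Proof.
  intros HD. unfold root_of_unity. rewrite <- (nome_Z t). do 2 f_equal.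
  rewrite mult_IZR, <- INR_IZR_INZ. field. apply not_0_INR. lia.
Qed.

Lemma root_of_unity_period D x t : (1 <= D)%nat ->
  root_of_unity D (x + t * Z.of_nat D) = root_of_unity D x.
Proof.
  intros HD. rewrite root_of_unity_plus, root_of_unity_mult by easy. ring.
Qed.

Lemma Cmod_root_of_unity D x : Cmod (root_of_unity D x) = 1.
Proof.
  unfold root_of_unity. rewrite Cmod_nome, im_RtoC, Rmult_0_r. apply exp_0.
Qed.

Lemma root_of_unity_eq_1 D x : (1 <= D)%nat -> root_of_unity D x = RtoC 1 ->
  exists t, x = (t * Z.of_nat D)%Z.
Proof.
  intros HD E. apply NNPP. intros N. revert E. apply nome_real_neq_1.
  intros m Hm. apply N. exists m. apply eq_IZR. rewrite mult_IZR, <- INR_IZR_INZ, <- Hm.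
  field. apply not_0_INR. lia.
Qed.

(** Shifting [n] by [1] multiplies the sum by [root_of_unity D b], which differs from [1]. *)
Lemma root_of_unity_sum D b : (1 <= D)%nat ->
  (forall t, b <> t * Z.of_nat D)%Z ->
  lsum (fun n => root_of_unity D (n * b)) (residues D) = RtoC 0.
Proof.
  intros HD Hb.
  assert (P : forall n, root_of_unity D ((n + Z.of_nat D) * b) = root_of_unity D (n * b)).
  { intros n. replace ((n + Z.of_nat D) * b)%Z with (n * b + b * Z.of_nat D)%Z by ring.
    now apply root_of_unity_period. }
  assert (S := lsum_residues_bij D (fun n => root_of_unity D (n * b)) (fun n => (n + 1)%Z) HD P).
  cbv beta in S. set (T := lsum (fun n => root_of_unity D (n * b)) (residues D)) in *.
  assert (E : (root_of_unity D b * T)%C = T).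
  { rewrite <- S at 2.
    - unfold T. rewrite <- lsum_scal. apply lsum_ext. intros a _.
      rewrite <- root_of_unity_plus. f_equal. ring.
    - intros a c Ha Hc E. apply mod_eq_sub in E; [| lia]. destruct E as [t E].
      apply residues_eq with D t; auto. lia. }
  apply NNPP. intros N.
  assert (R1 : root_of_unity D b = RtoC 1).
  { transitivity (root_of_unity D b * T / T)%C; [now field |]. rewrite E. now field. }
  apply root_of_unity_eq_1 in R1; [| easy]. destruct R1 as [t Ht]. now apply (Hb t).
Qed.

Lemma Cinv_0 : (/ RtoC 0)%C = RtoC 0.
Proof. apply C_ext; simpl; unfold Rdiv; ring. Qed.

Lemma Cinv_mult (a b : C) : (/ (a * b))%C = (/ a * / b)%C.
Proof.
  destruct (Ceq_dec a 0) as [-> | Na]; [rewrite Cmult_0_l, Cinv_0; ring |].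
  destruct (Ceq_dec b 0) as [-> | Nb]; [rewrite Cmult_0_r, Cinv_0; ring |].
  field. easy.
Qed.

Lemma Cinv_inv (a : C) : (/ / a)%C = a.
Proof.
  destruct (Ceq_dec a 0) as [-> | Na]; [now rewrite !Cinv_0 |].
  field. exact Na.
Qed.

Lemma Cinv_neq_0 (a : C) : (/ a)%C <> RtoC 0 <-> a <> RtoC 0.
Proof.
  split; intros H E; apply H.
  - now rewrite E, Cinv_0.
  - rewrite <- (Cinv_inv a), E. apply Cinv_0.
Qed.

Lemma character_1 D chi : dirichlet_character D chi -> chi 1%Z = RtoC 1.
Proof.
  intros [_ M S].
  assert (N : chi 1%Z <> RtoC 0) by (apply S; apply Z.gcd_1_l).
  assert (E := M 1%Z 1%Z). simpl in E.
  transitivity (chi 1%Z * chi 1%Z / chi 1%Z)%C; [now field |]. rewrite <- E. now field.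
Qed.

Lemma inverse_character D chi : dirichlet_character D chi ->
  dirichlet_character D (fun a => / chi a)%C.
Proof.
  intros [P M S]. split.
  - intros a. now rewrite P.
  - intros a b. now rewrite M, Cinv_mult.
  - intros a. rewrite Cinv_neq_0. apply S.
Qed.

Lemma inverse_primitive D chi : primitive_character D chi ->
  primitive_character D (fun a => / chi a)%C.
Proof.
  intros [Hc Hp]. split; [now apply inverse_character |].
  intros d psi Hd Hpsi H. apply Hp with (fun a => / psi a)%C; auto using inverse_character.
  intros a Ha. rewrite <- H by easy. now rewrite Cinv_inv.
Qed.

Lemma unit_inverse (D : nat) a : Z.gcd a (Z.of_nat D) = 1%Z ->
  exists b t, (a * b = 1 + t * Z.of_nat D)%Z.
Proof.
  intros H. apply gcd_1_iff in H. destruct H as [u [v E]].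
  exists (- v)%Z, (- u)%Z. lia.
Qed.

Lemma character_unit_inverse D chi a b t : dirichlet_character D chi ->
  (a * b = 1 + t * Z.of_nat D)%Z -> (/ chi a)%C = chi b /\ chi a <> RtoC 0.
Proof.
  intros Hc E. assert (P := periodic_Z D chi (dirichlet_periodic _ _ Hc)).
  assert (M : (chi a * chi b)%C = RtoC 1).
  { rewrite <- (dirichlet_mul _ _ Hc), E, P. now apply character_1 with D. }
  assert (N : chi a <> RtoC 0).
  { intros Z. rewrite Z, Cmult_0_l in M. symmetry in M. now apply C1_nz in M. }
  split; [| easy]. transitivity (/ chi a * (chi a * chi b))%C; [rewrite M; ring | now field].
Qed.

(** Powers of a value of modulus above [1] would be unbounded values of [chi], which takes only
    finitely many. *)
Lemma character_le_1 D chi a : (1 <= D)%nat -> dirichlet_character D chi -> Cmod (chi a) <= 1.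
Proof.
  intros HD Hc. apply Rnot_lt_le. intros H.
  set (B := rsum (fun b => Cmod (chi b)) (residues D)).
  assert (HB : forall b, Cmod (chi b) <= B).
  { intros b. rewrite <- (periodic_mod D chi HD (dirichlet_periodic _ _ Hc)).
    set (r := (b mod Z.of_nat D)%Z).
    replace (Cmod (chi r)) with (rsum (fun b => Cmod (chi b)) [r]) by (simpl; ring).
    apply rsum_incl; [intros; apply Cmod_ge_0 | repeat constructor; easy |].
    intros x [<- | []]. apply in_residues, Z.mod_pos_bound. lia. }
  assert (E : forall n : nat, chi (a ^ Z.of_nat n)%Z = (chi a ^ n)%C).
  { induction n as [| n IH]; [now apply character_1 with D |].
    rewrite Nat2Z.inj_succ, Z.pow_succ_r, (dirichlet_mul _ _ Hc), IH by lia. easy. }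
  destruct (Pow_x_infinity (Cmod (chi a))) with (b := B + 1) as [N HN].
  { rewrite Rabs_pos_eq; [easy | apply Cmod_ge_0]. }
  specialize (HN N (le_n N)). rewrite Rabs_pos_eq in HN by apply pow_le, Cmod_ge_0.
  rewrite <- Cmod_pow, <- E in HN. specialize (HB (a ^ Z.of_nat N)%Z). lra.
Qed.

(** Built on the inverse character. The inverse of [0] being [0], residues not prime to [D]
    contribute nothing. *)
Definition gauss_sum (D : nat) (chi : Z -> C) (n : Z) : C :=
  lsum (fun a => (/ chi a * root_of_unity D (a * n))%C) (residues D).

Lemma gauss_sum_translate D chi b n : (1 <= D)%nat -> dirichlet_character D chi ->
  Z.gcd b (Z.of_nat D) = 1%Z ->
  (/ chi b * gauss_sum D chi (b * n))%C = gauss_sum D chi n.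
Proof.
  intros HD Hc Hb. unfold gauss_sum.
  symmetry. rewrite <- (lsum_residues_bij D _ (fun a => (a * b)%Z) HD).
  - rewrite <- lsum_scal. apply lsum_ext. intros a _. cbv beta.
    rewrite (dirichlet_mul _ _ Hc), Cinv_mult. replace (a * b * n)%Z with (a * (b * n))%Z by ring. ring.
  - intros a. rewrite (dirichlet_periodic _ _ Hc). f_equal.
    replace ((a + Z.of_nat D) * n)%Z with (a * n + n * Z.of_nat D)%Z by ring.
    now apply root_of_unity_period.
  - intros a c Ha Hcc E. apply mod_eq_sub in E; [| lia]. destruct E as [t E].
    destruct (unit_inverse D b Hb) as [b' [s Eb]].
    apply residues_eq with D (t * b' - s * (a - c))%Z; auto.
    assert (F : ((a - c) * (b * b') = t * b' * Z.of_nat D)%Z).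
    { transitivity ((a * b - c * b) * b')%Z; [ring |]. rewrite E. ring. }
    rewrite Eb in F. lia.
Qed.

(** If [chi] were trivial on all units congruent to [1] modulo [D/g], it would be induced from a
    character modulo [D/g], against primitivity. Square-freeness makes [D/g] and [g] coprime, so the
    inducing character can be written down by the Chinese remainder theorem. *)
Lemma primitive_nontrivial_kernel D chi g : (1 <= D)%nat -> squarefree D ->
  primitive_character D chi -> (g | Z.of_nat D)%Z -> (1 < g)%Z ->
  exists b t, (b = 1 + t * (Z.of_nat D / g))%Z /\ Z.gcd b (Z.of_nat D) = 1%Z /\ chi b <> RtoC 1.
Proof.
  intros HD Sq [Hc Hp] [d Ed] Hg.
  rewrite Ed, Z.div_mul by lia.
  apply NNPP. intros No.
  assert (Triv : forall b t, (b = 1 + t * d)%Z -> Z.gcd b (Z.of_nat D) = 1%Z -> chi b = RtoC 1).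
  { intros b t E1 E2. apply NNPP. intros N. apply No. exists b, t. now rewrite <- Ed. }
  (* The square of this gcd divides [d g = D]. *)
  assert (Cop : Z.gcd d g = 1%Z).
  { assert (H1 := Z.gcd_divide_l d g). assert (H2 := Z.gcd_divide_r d g).
    assert (H0 := Z.gcd_nonneg d g). set (p := Z.gcd d g) in *.
    destruct H1 as [x Hx], H2 as [y Hy].
    assert (Q : Z.to_nat p = 1%nat); [| lia].
    apply Sq. exists (Z.to_nat (x * y)).
    apply Nat2Z.inj. rewrite !Nat2Z.inj_mul, !Z2Nat.id by nia. rewrite Ed, Hx, Hy. ring. }
  apply gcd_1_iff in Cop. destruct Cop as [s [r' E]].
  set (r := (- r')%Z). assert (E' : (r * d + s * g = 1)%Z) by (unfold r; lia). clear E.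
  set (R := (s * g)%Z) in *. set (Q := (r * d)%Z) in *.
  assert (QR : (R * Q = r * s * Z.of_nat D)%Z) by (unfold R, Q; rewrite Ed; ring).
  assert (P := periodic_Z D chi (dirichlet_periodic _ _ Hc)).
  (* [a R + Q] is congruent to [a] modulo [d] and to [1] modulo [g], since [R = s g], [Q = r d] and
     [R + Q = 1]. As [R Q] is a multiple of [D], [psi] is multiplicative. *)
  set (psi := fun a => chi (a * R + Q)%Z).
  assert (Supp : forall a, Z.gcd (a * R + Q) (Z.of_nat D) = 1%Z <-> Z.gcd a d = 1%Z).
  { intros a. split; intros H.
    - apply gcd_1_iff in H. destruct H as [x [y H]]. apply gcd_1_iff.
      exists (x * g - y * r)%Z, (y * R)%Z. rewrite <- H, Ed. unfold Q. ring.
    - apply gcd_1_iff in H. destruct H as [x [y H]].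
      (* A Bezout identity with [d] and one with [g]; their product is one with [D = d g]. *)
      assert (A1 : ((a * R + Q) * (- y) + d * (x + y * r * (1 - a)) = 1)%Z).
      { transitivity (x * d - y * a)%Z; [| exact H].
        replace R with (1 - Q)%Z by lia. unfold Q. ring. }
      assert (A2 : ((a * R + Q) * 1 + g * (s * (1 - a)) = 1)%Z).
      { transitivity (Q + R)%Z; [unfold R; ring | exact E']. }
      apply gcd_1_iff. exists ((x + y * r * (1 - a)) * (s * (1 - a)))%Z,
        (- ((- y) * ((a * R + Q) * 1 + g * (s * (1 - a))) + d * (x + y * r * (1 - a))))%Z.
      transitivity (((a * R + Q) * (- y) + d * (x + y * r * (1 - a))) *
                    ((a * R + Q) * 1 + g * (s * (1 - a))))%Z; [rewrite Ed; ring |].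
      rewrite A1, A2. ring. }
  assert (Dd : Z.to_nat d = D).
  { apply Hp with psi.
    - exists (Z.to_nat g). apply Nat2Z.inj. rewrite Nat2Z.inj_mul, !Z2Nat.id by lia. lia.
    - split.
      + intros a. unfold psi. rewrite Z2Nat.id by lia.
        rewrite <- (P (a * R + Q)%Z s). f_equal. unfold R. rewrite Ed. ring.
      + intros a b. unfold psi. rewrite <- (dirichlet_mul _ _ Hc).
        rewrite <- (P (a * b * R + Q)%Z (r * s * (a + b - a * b - 1))%Z). f_equal.
        replace (r * s * (a + b - a * b - 1) * Z.of_nat D)%Z
          with ((a + b - a * b - 1) * (R * Q))%Z by (rewrite QR; ring).
        replace Q with (1 - R)%Z by lia. ring.
      + intros a. unfold psi. rewrite (dirichlet_support _ _ Hc), Z2Nat.id by lia. apply Supp.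
    - intros a Ha. unfold psi.
      destruct (unit_inverse D a Ha) as [b [t Hb]].
      destruct (character_unit_inverse D chi a b t Hc Hb) as [Eb Na].
      assert (Ub : Z.gcd (b * (a * R + Q)) (Z.of_nat D) = 1%Z).
      { apply (dirichlet_support _ _ Hc). rewrite (dirichlet_mul _ _ Hc), <- Eb.
        apply Cmult_neq_0; [now apply Cinv_neq_0 |].
        apply (dirichlet_support _ _ Hc), Supp.
        apply gcd_1_iff in Ha. destruct Ha as [x [y Ha]].
        apply gcd_1_iff. exists (x * g)%Z, y. rewrite <- Ha, Ed. ring. }
      (* [b] inverts [a] modulo [D], so [b (a R + Q)] is congruent to [1] modulo [d] and [Triv]
         applies. *)
      assert (T1 : chi (b * (a * R + Q))%Z = RtoC 1).
      { apply Triv with (t * g + (b - a * b) * r)%Z; [| easy].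
        replace R with (1 - Q)%Z by lia.
        replace (b * (a * (1 - Q) + Q))%Z with (a * b + (b - a * b) * Q)%Z by ring.
        rewrite Hb at 1. rewrite Ed. unfold Q. ring. }
      rewrite (dirichlet_mul _ _ Hc), <- Eb in T1.
      transitivity (chi a * (/ chi a * chi (a * R + Q)%Z))%C; [rewrite T1; ring | now field]. }
  nia.
Qed.

(** The substitution of [a n] for [a] settles [n] prime to [D]. Otherwise let [g = gcd(n, D)]: some
    unit [b] congruent to [1] modulo [D/g] has [chi b <> 1], while [b n] and [n] agree modulo [D].
    The sum then equals its own product with [/ chi b], and is [0]. *)
Lemma gauss_sum_eq D chi n : (1 <= D)%nat -> squarefree D -> primitive_character D chi ->
  gauss_sum D chi n = (chi n * gauss_sum D chi 1)%C.
Proof.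
  intros HD Sq Hprim. assert (Hc := proj1 Hprim).
  destruct (Z.eq_dec (Z.gcd n (Z.of_nat D)) 1) as [G | G].
  - assert (N : chi n <> RtoC 0) by now apply (dirichlet_support _ _ Hc).
    rewrite <- (gauss_sum_translate D chi n 1 HD Hc G), Z.mul_1_r. field. exact N.
  - assert (N : chi n = RtoC 0).
    { apply NNPP. intros N. apply G. now apply (dirichlet_support _ _ Hc). }
    rewrite N, Cmult_0_l.
    assert (G0 := Z.gcd_nonneg n (Z.of_nat D)).
    destruct (Z.gcd_divide_l n (Z.of_nat D)) as [n' Hn].
    assert (GD := Z.gcd_divide_r n (Z.of_nat D)).
    set (g := Z.gcd n (Z.of_nat D)) in *.
    assert (Hg : (1 < g)%Z).
    { assert (g <> 0%Z) by (intros E; rewrite E in GD; apply Z.divide_0_l in GD; lia). lia. }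
    destruct (primitive_nontrivial_kernel D chi g HD Sq Hprim GD Hg) as [b [t [Eb [Ub Nb]]]].
    assert (Db : (Z.of_nat D = Z.of_nat D / g * g)%Z).
    { destruct GD as [d Ed]. rewrite Ed, Z.div_mul by lia. easy. }
    assert (T := gauss_sum_translate D chi b n HD Hc Ub).
    remember (Z.of_nat D / g)%Z as e eqn:Ee. clear Ee. clearbody g.
    assert (Same : gauss_sum D chi (b * n) = gauss_sum D chi n).
    { unfold gauss_sum. apply lsum_ext. intros a _. f_equal.
      rewrite <- (root_of_unity_period D (a * n) (a * t * n') HD). f_equal.
      rewrite Eb, Hn, Db. ring. }
    rewrite Same in T. set (v := gauss_sum D chi n) in *.
    apply NNPP. intros Nv. apply Nb.
    assert (Q : (/ chi b)%C = RtoC 1).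
    { transitivity (/ chi b * v / v)%C.
      - field. split; [| easy]. now apply (dirichlet_support _ _ Hc).
      - rewrite T. now field. }
    rewrite <- (Cinv_inv (chi b)), Q. field.
Qed.

Lemma rsum_const {T} (c : R) (l : list T) : rsum (fun _ => c) l = INR (length l) * c.
Proof.
  induction l as [| x l IH]; [simpl; ring |].
  change (c + rsum (fun _ => c) l = INR (S (length l)) * c). rewrite IH, S_INR. ring.
Qed.

(** Pairing [gauss_sum D chi n] with [root_of_unity D (- n)] and summing over [n] gives [D] by
    orthogonality, but at most [D |gauss_sum D chi 1|] by [gauss_sum_eq]. This cruder bound stands
    in for the exact modulus [sqrt D]. *)
Lemma gauss_sum_ge_1 D chi : (1 <= D)%nat -> squarefree D -> primitive_character D chi ->
  1 <= Cmod (gauss_sum D chi 1).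
Proof.
  intros HD Sq Hprim. assert (Hc := proj1 Hprim).
  set (v := gauss_sum D chi 1).
  assert (D0 : 0 < INR D) by (apply lt_0_INR; lia).
  set (X := lsum (fun n => (gauss_sum D chi n * root_of_unity D (- n))%C) (residues D)).
  assert (U : Cmod X <= INR D * Cmod v).
  { apply Rle_trans with (1 := Cmod_lsum_le _ _).
    rewrite <- (length_residues D) at 2. rewrite <- rsum_const. apply rsum_le. intros n _.
    rewrite Cmod_mult, Cmod_root_of_unity, Rmult_1_r, gauss_sum_eq, Cmod_mult by easy. fold v.
    assert (A := character_le_1 D chi n HD Hc). assert (B := Cmod_ge_0 v). nra. }
  assert (E : X = RtoC (INR D)).
  { unfold X, gauss_sum.
    rewrite (lsum_ext _ (fun n => lsum (fun a => (/ chi a * root_of_unity D (n * (a - 1)))%C) (residues D))).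
    2: { intros n _. rewrite Cmult_comm, <- lsum_scal. apply lsum_ext. intros a _.
         replace (n * (a - 1))%Z with (a * n + - n)%Z by ring. rewrite root_of_unity_plus. ring. }
    rewrite lsum_swap.
    rewrite (lsum_ext _ (fun a => (/ chi a * lsum (fun n => root_of_unity D (n * (a - 1))) (residues D))%C))
      by (intros; now rewrite lsum_scal).
    (* The shift brings the surviving residue [1] to [0], the head of the list; this also covers
       [D = 1], where [1] is not a listed residue. *)
    rewrite <- (lsum_residues_bij D _ (fun a => (a + 1)%Z) HD).
    - destruct D as [| D']; [lia |].
      change (residues (S D')) with (0%Z :: map Z.of_nat (seq 1 D')) at 2.
      rewrite (lsum_ext _ (fun a => if Z.eq_dec a 0 then RtoC (INR (S D')) else RtoC 0)).
      + set (N := INR (S D')). simpl lsum at 1. destruct (Z.eq_dec 0 0); [| easy].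
        rewrite (lsum_ext _ (fun _ => (RtoC 0 * RtoC 0)%C)).
        * rewrite lsum_scal. ring.
        * intros x Hx. apply in_map_iff in Hx. destruct Hx as [i [<- Hi]]. apply in_seq in Hi.
          destruct (Z.eq_dec (Z.of_nat i) 0); [lia | ring].
      + intros a Ha. destruct (Z.eq_dec a 0) as [-> | Na].
        * rewrite (lsum_ext _ (fun _ => RtoC 1)).
          -- rewrite lsum_RtoC, rsum_const, length_residues. simpl (0 + 1)%Z.
             rewrite (character_1 _ _ Hc), Rmult_1_r. field.
          -- intros n _. replace (n * (0 + 1 - 1))%Z with (0 * Z.of_nat (S D'))%Z by ring.
             now apply root_of_unity_mult.
        * rewrite root_of_unity_sum; [ring | easy |].
          intros t Ht.
          assert (B : (0 <= a < Z.of_nat (S D'))%Z).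
          { destruct Ha as [Ha | Ha]; [lia |]. apply in_map_iff in Ha. destruct Ha as [i [<- Hi]].
            apply in_seq in Hi. lia. }
          assert (t = 0)%Z by nia. subst t. lia.
    - intros a. f_equal; [now rewrite (dirichlet_periodic _ _ Hc) |].
      apply lsum_ext. intros n _.
      replace (n * (a + Z.of_nat D - 1))%Z with (n * (a - 1) + n * Z.of_nat D)%Z by ring.
      now apply root_of_unity_period.
    - intros a c Ha Hcc Em. apply mod_eq_sub in Em; [| lia]. destruct Em as [t Em].
      apply residues_eq with D t; auto. lia. }
  rewrite E, Cmod_R, Rabs_pos_eq in U by lra.
  apply Rmult_le_reg_l with (INR D); lra.
Qed.

(** * Twists of cusp forms *)

Lemma poincare_cusp_form K k : (5 <= K)%nat -> (1 <= k)%nat ->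
  exists f : cusp_form K, forall z, f z = poincare K k z.
Proof.
  intros HK Hk.
  assert (SR : strip_regular (poincare K k)) by (apply poincare_strip_regular; lia).
  assert (Per : forall z, 0 < Im z -> poincare K k (z + 1)%C = poincare K k z).
  { intros z Hz.
    assert (E := poincare_modular K k 1 1 0 1 z ltac:(lia) eq_refl Hz).
    replace (zlin 0 1 z) with (RtoC 1) in E by (unfold zlin; ring).
    replace (zlin 1 1 z / 1)%C with (z + 1)%C in E by (unfold zlin; field).
    rewrite E, Cpow_1_l. ring. }
  destruct (poincare_decay K k HK Hk) as [A [_ HA]].
  destruct (q_expansion _ SR Per) as [a [a0 Ha]]; [now exists A |].
  unshelve eexists (Build_cusp_form K (poincare K k) a _ _ a0 Ha).
  - intros z Hz. destruct (SR (Rabs (Re z)) (Im z) Hz) as [B [r [Hr HB]]].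
    destruct (HB z (Rle_refl _) (Rle_refl _)) as [_ Q]. now apply quad_diff_ex_derive with B r.
  - intros a' b c d z E Hz. apply poincare_modular; auto. lia.
  - reflexivity.
Qed.

Lemma is_series_CSeries (u : nat -> C) (s : C) :
  is_series (K := C_AbsRing) (V := C_NormedModule) u s -> CSeries u = s.
Proof.
  intros H.
  assert (SR : forall n, sum_n (G := R_AbelianMonoid) (fun i => Re (u i)) n
                         = Re (sum_n (G := C_AbelianMonoid) u n)).
  { induction n as [| n IH]; [now rewrite !sum_O |]. now rewrite !sum_Sn, IH. }
  assert (SI : forall n, sum_n (G := R_AbelianMonoid) (fun i => Im (u i)) n
                         = Im (sum_n (G := C_AbelianMonoid) u n)).
  { induction n as [| n IH]; [now rewrite !sum_O |]. now rewrite !sum_Sn, IH. }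
  unfold CSeries.
  assert (L := proj1 (filterlim_locally (U := C_NormedModule) (sum_n (G := C_AbelianMonoid) u) s) H).
  apply C_ext; simpl; apply is_series_unique.
  - apply (proj2 (filterlim_locally (U := R_NormedModule) _ _)). intros eps.
    destruct (L eps) as [N HN]. exists N. intros n Hn.
    change (ball (Re s) eps (sum_n (G := R_AbelianMonoid) (fun i => Re (u i)) n)).
    rewrite SR. apply (HN n Hn).
  - apply (proj2 (filterlim_locally (U := R_NormedModule) _ _)). intros eps.
    destruct (L eps) as [N HN]. exists N. intros n Hn.
    change (ball (Im s) eps (sum_n (G := R_AbelianMonoid) (fun i => Im (u i)) n)).
    rewrite SI. apply (HN n Hn).
Qed.

Lemma is_series_lsum {T} (u : T -> nat -> C) (s : T -> C) (l : list T) :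
  (forall x, In x l -> is_series (K := C_AbsRing) (V := C_NormedModule) (u x) (s x)) ->
  is_series (K := C_AbsRing) (V := C_NormedModule) (fun n => lsum (fun x => u x n) l) (lsum s l).
Proof.
  induction l as [| x l IH]; intros H.
  - simpl. apply (proj2 (filterlim_locally (U := C_NormedModule) _ _)). intros eps. exists 0%nat.
    assert (E : forall n, sum_n (G := C_AbelianMonoid) (fun _ => RtoC 0) n = RtoC 0).
    { induction n as [| n IHn]; [now rewrite sum_O |]. rewrite sum_Sn, IHn. apply Cplus_0_l. }
    intros n _. rewrite E. apply ball_center.
  - simpl. apply (is_series_plus (K := C_AbsRing) (V := C_NormedModule)).
    + apply H. now left.
    + apply IH. intros; apply H; now right.
Qed.

(** Coefficientwise this is [gauss_sum_eq]. The twisted series is a finite combination of convergent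
    expansions at translated points, so its convergence requires no bound on the coefficients. *)
Lemma twist_formula D chi K (f : cusp_form K) z :
  (1 <= D)%nat -> squarefree D -> primitive_character D chi -> 0 < Im z ->
  (gauss_sum D chi 1 * twist chi f z)%C
  = lsum (fun a => (/ chi a * f (z + RtoC (IZR a / INR D))%C)%C) (residues D).
Proof.
  intros HD Sq Hp Hz.
  assert (Gn : gauss_sum D chi 1 <> RtoC 0).
  { apply Cmod_gt_0. assert (Q := gauss_sum_ge_1 D chi HD Sq Hp). lra. }
  set (v := lsum _ (residues D)).
  assert (S : is_series (K := C_AbsRing) (V := C_NormedModule)
    (fun n => lsum (fun a => (/ chi a * (cusp_coef f n * nome (z + RtoC (IZR a / INR D)) ^ n))%C)
                (residues D)) v).
  { apply is_series_lsum. intros a _.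
    apply (is_series_scal (K := C_AbsRing) (V := C_NormedModule) (/ chi a)%C).
    apply cusp_expansion. unfold in_upper_half_plane. rewrite im_plus, im_RtoC. lra. }
  replace (twist chi f z) with (/ gauss_sum D chi 1 * v)%C; [now field |].
  symmetry. apply is_series_CSeries.
  apply is_series_ext with (2 := is_series_scal (K := C_AbsRing) (V := C_NormedModule)
    (/ gauss_sum D chi 1)%C _ _ S).
  intros n. cbv beta.
  change (scal (/ gauss_sum D chi 1)%C ?x) with (/ gauss_sum D chi 1 * x)%C.
  match goal with |- ?x = ?y => change (@eq C x y) end.
  assert (E := gauss_sum_eq D chi (Z.of_nat n) HD Sq Hp).
  rewrite (lsum_ext _ (fun a => (cusp_coef f n * nome z ^ n *
      (/ chi a * root_of_unity D (a * Z.of_nat n)))%C)).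
  - rewrite lsum_scal. fold (gauss_sum D chi (Z.of_nat n)). rewrite E. now field.
  - intros a _. rewrite nome_plus, Cpow_mult_l.
    replace (nome (RtoC (IZR a / INR D)) ^ n)%C with (root_of_unity D (a * Z.of_nat n)).
    + ring.
    + rewrite nome_pow. unfold root_of_unity. f_equal. rewrite <- RtoC_mult. f_equal.
      rewrite mult_IZR, <- INR_IZR_INZ. unfold Rdiv. ring.
Qed.

Definition inverse_mod (D : nat) (a : Z) : Z :=
  epsilon (inhabits 0%Z) (fun b => exists t, (a * b = 1 + t * Z.of_nat D)%Z).

Lemma inverse_mod_spec D a : Z.gcd a (Z.of_nat D) = 1%Z ->
  exists t, (a * inverse_mod D a = 1 + t * Z.of_nat D)%Z.
Proof.
  intros H. unfold inverse_mod. apply epsilon_spec. now apply unit_inverse.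
Qed.

(** Replacing [a] by its inverse modulo [D] turns the left side into [gauss_sum] of [/ chi] at
    [- k]. These are the phases carried by the terms of the pairs [(D,-a)]. *)
Lemma dual_gauss_sum D chi k :
  (1 <= D)%nat -> squarefree D -> primitive_character D chi ->
  lsum (fun a => (/ chi a * root_of_unity D (- (k * inverse_mod D a)))%C) (residues D)
  = (/ chi (- k)%Z * gauss_sum D (fun a => / chi a)%C 1)%C.
Proof.
  intros HD Sq Hp. assert (Hc := proj1 Hp).
  set (chi' := fun a => (/ chi a)%C).
  change (/ chi (- k)%Z)%C with (chi' (- k)%Z).
  rewrite <- (gauss_sum_eq D chi' (- k) HD Sq (inverse_primitive D chi Hp)).
  unfold gauss_sum.
  (* Residues that are not units are left fixed, so that [sigma] permutes all of them. *)
  set (sigma := fun a => if Z.eq_dec (Z.gcd a (Z.of_nat D)) 1 then inverse_mod D a else a).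
  assert (U : forall a, Z.gcd a (Z.of_nat D) = 1%Z ->
     Z.gcd (inverse_mod D a) (Z.of_nat D) = 1%Z).
  { intros a Ha. destruct (inverse_mod_spec D a Ha) as [t E].
    apply gcd_1_iff. exists (- t)%Z, (- a)%Z. lia. }
  symmetry. rewrite <- (lsum_residues_bij D _ sigma HD).
  - apply lsum_ext. intros a _. unfold chi', sigma. cbv beta. rewrite Cinv_inv.
    destruct (Z.eq_dec (Z.gcd a (Z.of_nat D)) 1) as [G | G].
    + destruct (inverse_mod_spec D a G) as [t E].
      destruct (character_unit_inverse D chi a _ t Hc E) as [-> _].
      do 2 f_equal. ring.
    + assert (N : chi a = RtoC 0).
      { apply NNPP. intros N. apply G. now apply (dirichlet_support _ _ Hc). }
      rewrite N, Cinv_0. ring.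
  - intros a. unfold chi'. rewrite (dirichlet_periodic _ _ Hc). f_equal.
    replace ((a + Z.of_nat D) * - k)%Z with (a * - k + (- k) * Z.of_nat D)%Z by ring.
    now apply root_of_unity_period.
  - intros a b Ha Hb E. apply mod_eq_sub in E; [| lia]. destruct E as [t E]. unfold sigma in E.
    destruct (Z.eq_dec (Z.gcd a (Z.of_nat D)) 1) as [Ga | Ga];
      destruct (Z.eq_dec (Z.gcd b (Z.of_nat D)) 1) as [Gb | Gb].
    + destruct (inverse_mod_spec D a Ga) as [s Es]. destruct (inverse_mod_spec D b Gb) as [r Er].
      set (x := inverse_mod D a) in *. set (y := inverse_mod D b) in *.
      apply residues_eq with D (b * s - a * r - a * b * t)%Z; auto.
      assert (F : (a * b * (t * Z.of_nat D)
                   = b * (1 + s * Z.of_nat D) - a * (1 + r * Z.of_nat D))%Z)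
        by (rewrite <- E, <- Es, <- Er; ring).
      lia.
    + exfalso. apply Gb. specialize (U a Ga). apply gcd_1_iff in U. destruct U as [p [q U]].
      apply gcd_1_iff. exists (p - q * t)%Z, q. rewrite <- U.
      replace (inverse_mod D a) with (b + t * Z.of_nat D)%Z by lia. ring.
    + exfalso. apply Ga. specialize (U b Gb). apply gcd_1_iff in U. destruct U as [p [q U]].
      apply gcd_1_iff. exists (p + q * t)%Z, q. rewrite <- U.
      replace (inverse_mod D b) with (a - t * Z.of_nat D)%Z by lia. ring.
    + apply residues_eq with D t; auto.
Qed.

(** * Poincare series on the lines above rational points *)

Definition cusp_line (D : nat) (a : Z) (t : R) : C := (Ci * RtoC t + RtoC (IZR a / INR D))%C.

Lemma im_cusp_line D a t : Im (cusp_line D a t) = t.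
Proof. unfold cusp_line. simpl. ring. Qed.

Lemma re_cusp_line D a t : Re (cusp_line D a t) = IZR a / INR D.
Proof. unfold cusp_line. simpl. ring. Qed.

Lemma Cpow_even_opp (u : C) (kap : nat) : ((- u) ^ (2 * kap))%C = (u ^ (2 * kap))%C.
Proof.
  rewrite !Cpow_mult_r. f_equal. simpl. ring.
Qed.

Lemma poincare_term_opp kap k c d z : 0 < Im z ->
  poincare_term (2 * kap) k (- c, - d)%Z z = poincare_term (2 * kap) k (c, d) z.
Proof.
  intros Hz. destruct (Z.eq_dec (Z.gcd c d) 1) as [G | G].
  - destruct (proj1 (gcd_1_iff c d) G) as [a [b E]].
    assert (N := zlin_neq_0 c d z Hz (gcd_1_neq_0 c d G)).
    assert (O : forall u v, zlin (- u) (- v) z = (- zlin u v z)%C).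
    { intros u v. unfold zlin. rewrite !opp_IZR, !RtoC_opp. ring. }
    rewrite (poincare_term_eq _ _ a b c d z E Hz).
    rewrite (poincare_term_eq _ _ (- a) (- b) (- c) (- d) z ltac:(lia) Hz).
    rewrite !O, Cpow_even_opp. do 3 f_equal. field. easy.
  - rewrite !poincare_term_not_coprime; [easy | easy |]. now rewrite Z.gcd_opp_l, Z.gcd_opp_r.
Qed.

(** The term of [(D,-a)] at [z = a/D + i t]: there [D z - a = i D t], and
    [gamma z = - b/D + i / (D^2 t)] up to an integer, with [b] inverse to [a] modulo [D]. *)
Definition dual_term (K k D : nat) (a : Z) (t : R) : C :=
  (/ (Ci * RtoC (INR D * t)) ^ K *
   (root_of_unity D (- (Z.of_nat k * inverse_mod D a)) *
    RtoC (exp (- (2 * PI * INR k / (INR D ^ 2 * t))))))%C.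

Lemma nome_imag (r : R) : nome (Ci * RtoC r) = RtoC (exp (- (2 * PI * r))).
Proof.
  unfold nome, Cexp. rewrite re_2PI_Ci, im_2PI_Ci.
  replace (Re (Ci * RtoC r)) with 0 by (simpl; ring).
  replace (Im (Ci * RtoC r)) with r by (simpl; ring).
  rewrite Rmult_0_r, cos_0, sin_0, Rmult_1_r, Rmult_0_r. unfold RtoC. do 2 f_equal. ring.
Qed.

Lemma poincare_term_dual K k D a t : (1 <= D)%nat -> Z.gcd a (Z.of_nat D) = 1%Z -> 0 < t ->
  poincare_term K k (Z.of_nat D, - a)%Z (cusp_line D a t) = dual_term K k D a t.
Proof.
  intros HD Ha Ht. destruct (inverse_mod_spec D a Ha) as [s E].
  assert (D0 : 0 < INR D) by (apply lt_0_INR; lia).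
  set (b := inverse_mod D a) in *.
  rewrite (poincare_term_eq K k (- b) s (Z.of_nat D) (- a)) by (rewrite ?im_cusp_line; lia || lra).
  assert (ND : RtoC (INR D) <> RtoC 0) by (intros Q; apply RtoC_inj in Q; lra).
  assert (NT : RtoC t <> RtoC 0) by (intros Q; apply RtoC_inj in Q; lra).
  assert (E1 : zlin (Z.of_nat D) (- a) (cusp_line D a t) = (Ci * RtoC (INR D * t))%C).
  { unfold zlin, cusp_line. rewrite <- INR_IZR_INZ, opp_IZR, RtoC_opp, RtoC_mult, RtoC_div by lra.
    field. easy. }
  unfold dual_term. rewrite E1. f_equal. fold b.
  unfold root_of_unity.
  replace (- (2 * PI * INR k / (INR D ^ 2 * t))) with (- (2 * PI * (INR k / (INR D ^ 2 * t))))
    by (field; lra).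
  rewrite <- nome_imag, <- nome_plus. f_equal.
  assert (CC : (Ci * Ci)%C = RtoC (-1)) by (apply C_ext; simpl; ring).
  rewrite opp_IZR, mult_IZR, <- INR_IZR_INZ.
  assert (E2 : zlin (- b) s (cusp_line D a t) = (- (Ci * (RtoC (IZR b) * RtoC t)) - / RtoC (INR D))%C).
  { unfold zlin, cusp_line. rewrite opp_IZR, RtoC_opp, RtoC_div by lra.
    apply (f_equal (fun x => RtoC (IZR x))) in E.
    rewrite plus_IZR, !mult_IZR, <- INR_IZR_INZ, RtoC_plus, !RtoC_mult in E.
    transitivity (- (Ci * (RtoC (IZR b) * RtoC t)) - (RtoC (IZR a) * RtoC (IZR b)) / RtoC (INR D) + RtoC (IZR s))%C.
    - field. easy.
    - rewrite E. field. easy. }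
  rewrite E2, !RtoC_mult, !RtoC_div, !RtoC_mult, RtoC_opp, RtoC_mult
    by (try apply Rgt_not_eq; try apply Rmult_lt_0_compat; try apply pow_lt; lra).
  replace (RtoC (INR D ^ 2)) with (RtoC (INR D) * RtoC (INR D))%C
    by (rewrite <- RtoC_mult; f_equal; ring).
  set (dd := RtoC (INR D)) in *. set (tt := RtoC t) in *. set (kk := RtoC (INR k)). set (bb := RtoC (IZR b)).
  assert (Ni := Ci_nz).
  transitivity (- (kk * bb) / dd + Ci * (- / (Ci * Ci)) * (kk / (dd * dd * tt)))%C.
  - field. repeat split; easy.
  - rewrite CC. replace (- / RtoC (-1))%C with (RtoC 1); [field; easy |].
    apply C_ext; simpl; field.
Qed.

(** Here [|cz+d|^2 = (e/D)^2 + (c t)^2] with [e = c a + d D], both squares positive. Of its [kap]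
    powers, two go into the inequality of arithmetic and geometric means, which yields the weight in
    [(c,e)] and a factor [t^2]; each of the others is at least [(1 + t^2)/D^2], and they outweigh
    the rest of [t^m]. *)
Lemma off_axis_term_bound (kap m D : nat) (a c d : Z) (t : R) :
  (1 <= D)%nat -> (2 <= m)%nat -> (m + 2 <= kap)%nat -> 0 < t ->
  c <> 0%Z -> (c * a + d * Z.of_nat D)%Z <> 0%Z ->
  / Cmod (zlin c d (cusp_line D a t)) ^ (2 * kap) * t ^ m
  <= INR D ^ (2 * kap) / (1 + t ^ 2) * lattice_weight (c, c * a + d * Z.of_nat D)%Z.
Proof.
  intros HD Hm Hmk Ht Hc He.
  assert (D1 : 1 <= INR D) by (apply (le_INR 1); easy).
  rewrite pow_mult, Cmod2_alt, re_zlin, im_zlin, re_cusp_line, im_cusp_line.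
  set (e := (c * a + d * Z.of_nat D)%Z) in *.
  assert (Ee : IZR c * (IZR a / INR D) + IZR d = IZR e / INR D).
  { unfold e. rewrite plus_IZR, !mult_IZR, <- INR_IZR_INZ. field. lra. }
  rewrite Ee. unfold lattice_weight. simpl fst; simpl snd.
  assert (C1 : 1 <= IZR c ^ 2) by (rewrite pow_IZR; apply IZR_le; change (Z.of_nat 2) with 2%Z; nia).
  assert (E1 : 1 <= IZR e ^ 2) by (rewrite pow_IZR; apply IZR_le; change (Z.of_nat 2) with 2%Z; nia).
  set (cc := IZR c ^ 2) in *. set (ee := IZR e ^ 2) in *. set (DD := INR D ^ 2).
  assert (DD1 : 1 <= DD) by (unfold DD; nra).
  set (T := t ^ 2). assert (T0 : 0 < T) by (apply pow_lt; lra).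
  replace ((IZR e / INR D) ^ 2 + (IZR c * t) ^ 2) with (ee / DD + cc * T)
    by (unfold ee, DD, cc, T; field; lra).
  set (X := ee / DD + cc * T).
  assert (iD : 0 < / DD <= 1).
  { split; [apply Rinv_0_lt_compat; lra |]. rewrite <- Rinv_1. apply Rinv_le_contravar; lra. }
  assert (X1 : (1 + T) / DD <= X).
  { unfold X, Rdiv. nra. }
  assert (X2 : 4 * (ee * cc * T / DD) <= X ^ 2).
  { unfold X. replace (4 * (ee * cc * T / DD)) with (4 * (ee / DD) * (cc * T)) by (field; lra).
    assert (Q := pow2_ge_0 (ee / DD - cc * T)). nra. }
  assert (N0 : 0 < (1 + T) / DD) by (apply Rdiv_lt_0_compat; lra).
  assert (Xk : ((1 + T) / DD) ^ (kap - 2) <= X ^ (kap - 2)) by (apply pow_incr; lra).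
  assert (Xp : 0 < X) by lra.
  rewrite pow_mult. fold DD.
  apply Rmult_le_reg_l with (X ^ kap); [now apply pow_lt |].
  rewrite <- Rmult_assoc, Rinv_r, Rmult_1_l by (apply Rgt_not_eq; now apply pow_lt).
  replace (X ^ kap) with (X ^ 2 * X ^ (kap - 2)) by (rewrite <- pow_add; f_equal; lia).
  assert (W1 : 1 <= 4 * (ee * cc) * / ((1 + cc) * (1 + ee))).
  { apply Rmult_le_reg_r with ((1 + cc) * (1 + ee)); [nra |].
    rewrite Rmult_assoc, Rinv_l by nra. nra. }
  assert (W0 : 0 < / ((1 + cc) * (1 + ee))) by (apply Rinv_0_lt_compat; nra).
  (* Uses [t <= 1 + t^2] on all but two factors, which exist because [m >= 2]. *)
  assert (M1 : t ^ m <= T * (1 + T) ^ (m - 2)).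
  { replace m with (2 + (m - 2))%nat at 1 by lia. rewrite pow_add. fold T.
    apply Rmult_le_compat_l; [lra |]. apply pow_incr. unfold T. nra. }
  assert (M2 : (1 + T) ^ (m - 2) * (1 + T) <= (1 + T) ^ (kap - 2)).
  { rewrite Rmult_comm. change ((1 + T) ^ S (m - 2) <= (1 + T) ^ (kap - 2)).
    apply Rle_pow; [lra | lia]. }
  apply Rle_trans with
    (4 * (ee * cc * T / DD) * ((1 + T) / DD) ^ (kap - 2) *
      (DD ^ kap / (1 + T) * / ((1 + cc) * (1 + ee)))).
  - replace (DD ^ kap) with (DD ^ 2 * DD ^ (kap - 2)) by (rewrite <- pow_add; f_equal; lia).
    unfold Rdiv at 2. rewrite Rpow_mult_distr, pow_inv.
    assert (DDk : 0 < DD ^ (kap - 2)) by (apply pow_lt; lra).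
    replace (4 * (ee * cc * T / DD) * ((1 + T) ^ (kap - 2) * / DD ^ (kap - 2)) *
      (DD ^ 2 * DD ^ (kap - 2) / (1 + T) * / ((1 + cc) * (1 + ee))))
      with ((4 * (ee * cc) * / ((1 + cc) * (1 + ee))) * (DD * (T * ((1 + T) ^ (kap - 2) / (1 + T)))))
      by (field; repeat split; nra || lra).
    assert (Y : (1 + T) ^ (m - 2) <= (1 + T) ^ (kap - 2) / (1 + T)).
    { apply Rmult_le_reg_r with (1 + T); [lra |].
      unfold Rdiv. rewrite (Rmult_assoc _ (/ (1 + T))), Rinv_l by lra. lra. }
    assert (Y2 : t ^ m <= T * ((1 + T) ^ (kap - 2) / (1 + T))).
    { apply Rle_trans with (1 := M1). apply Rmult_le_compat_l; lra. }
    assert (0 < t ^ m) by now apply pow_lt.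
    set (y := T * ((1 + T) ^ (kap - 2) / (1 + T))) in *.
    assert (y <= DD * y) by nra. nra.
  - apply Rmult_le_compat_r.
    + apply Rmult_le_pos; [| lra]. apply Rdiv_le_0_compat; [apply pow_le; lra | lra].
    + apply Rmult_le_compat; auto; [| apply pow_le; lra].
      apply Rmult_le_pos; [lra |]. apply Rdiv_le_0_compat; [| lra]. mult_nonneg; lra.
Qed.

(** A coprime pair other than [(0,1)], [(0,-1)], [(D,-a)] and [(-D,a)] has [c <> 0] and
    [c a + d D <> 0], so [off_axis_term_bound] applies to it. The factor [t^m] is the one of the
    period integral and makes the right-hand side integrable over the half-line. *)
Lemma poincare_at_rational (kap m k D : nat) (a : Z) (t : R) :
  (1 <= D)%nat -> (2 <= m)%nat -> (m + 2 <= kap)%nat -> Z.gcd a (Z.of_nat D) = 1%Z -> 0 < t ->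
  Cmod (poincare (2 * kap) k (cusp_line D a t) - 2 * dual_term (2 * kap) k D a t) * t ^ m
  <= 2 * (t ^ m * exp (- (2 * PI * INR k * t))) + INR D ^ (2 * kap) / (1 + t ^ 2) * 25.
Proof.
  intros HD Hm Hmk Ha Ht.
  set (K := (2 * kap)%nat). set (z := cusp_line D a t).
  assert (Hz : 0 < Im z) by (unfold z; now rewrite im_cusp_line).
  assert (Tm : 0 < t ^ m) by now apply pow_lt.
  set (dl := Z.of_nat D).
  set (L := [(dl, - a); (- dl, a); (0, 1); (0, -1)]%Z).
  assert (NL : NoDup L).
  { unfold L. repeat constructor; simpl; intuition; repeat match goal with
      | H : (_, _) = (_, _) |- _ => injection H; clear H; intros end; lia. }
  set (b := INR D ^ K / (1 + t ^ 2)).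
  assert (T2 : 0 < t ^ 2) by (apply pow_lt; lra).
  assert (B0 : 0 <= b) by (apply Rdiv_le_0_compat; [apply pow_le, pos_INR | lra]).
  assert (Rest : Cmod (poincare K k z - lsum (fun p => poincare_term K k p z) L) <= b * 25 * / t ^ m).
  { apply has_sum_off_list with (1 := poincare_has_sum K k z ltac:(unfold K; lia) Hz); [easy |].
    intros l Nl Hl.
    apply Rle_trans with (rsum (fun p => (b * / t ^ m) * lattice_weight (fst p, fst p * a + snd p * dl)%Z) l).
    - apply rsum_le. intros [c d] Hp. simpl fst; simpl snd.
      specialize (Hl _ Hp).
      assert (W := lattice_weight_pos (c, c * a + d * dl)%Z).
      assert (It : 0 < / t ^ m) by now apply Rinv_0_lt_compat.
      destruct (Z.eq_dec (Z.gcd c d) 1) as [G | G].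
      2: { rewrite poincare_term_not_coprime, Cmod_0 by easy. mult_nonneg; lra. }
      assert (Nc : c <> 0%Z).
      { intros ->. apply Hl. unfold L. rewrite Z.gcd_0_l in G. simpl.
        destruct (Z.abs_eq_or_opp d) as [Q | Q]; rewrite Q in G; [subst d; tauto |].
        assert (d = -1)%Z by lia. subst d. tauto. }
      (* Otherwise [D] divides [c], being prime to [a], and coprimality of [(c,d)] leaves only
         [(D,-a)] up to sign. *)
      assert (Ne : (c * a + d * dl)%Z <> 0%Z).
      { intros E. apply Hl.
        assert (Dv : (dl | c)%Z).
        { apply Z.gauss with a; [exists (- d)%Z; lia | now rewrite Z.gcd_comm]. }
        destruct Dv as [x ->].
        assert (Ed : d = (- (x * a))%Z).
        { assert (Q : (dl * (x * a + d) = 0)%Z) by (rewrite <- E; ring).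
          apply Z.mul_eq_0 in Q. destruct Q; lia. }
        apply gcd_1_iff in G. destruct G as [u [v G]].
        assert (X1 : (x | 1)%Z) by (exists (- u * a - v * dl)%Z; rewrite <- G, Ed; ring).
        apply Z.divide_1_r in X1. unfold L. subst d. destruct X1 as [-> | ->].
        - left. f_equal; lia.
        - right; left. f_equal; lia. }
      apply Rle_trans with (1 := Cmod_poincare_term_le K k c d z Hz).
      assert (O := off_axis_term_bound kap m D a c d t HD Hm Hmk Ht Nc Ne).
      fold z dl K b in O.
      apply (Rmult_le_compat_r (/ t ^ m)) in O; [| lra].
      rewrite Rmult_assoc, Rinv_r, Rmult_1_r in O by lra.
      apply Rle_trans with (1 := O). right. ring.
    - rewrite rsum_scal. rewrite (Rmult_assoc b 25), (Rmult_comm 25), <- Rmult_assoc.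
      apply Rmult_le_compat_l; [apply Rmult_le_pos; [easy | left; now apply Rinv_0_lt_compat] |].
      (* [(c,d)] goes injectively to [(c, c a + d D)], so the weights belong to distinct lattice
         points. *)
      rewrite <- (rsum_map (fun p => (fst p, fst p * a + snd p * dl)%Z) lattice_weight).
      apply lattice_weight_sum, Injective_map_NoDup; [| easy].
      intros [c d] [c' d']. simpl. intros E. injection E as <- E. f_equal. nia. }
  assert (E1 : poincare_term K k (dl, - a)%Z z = dual_term K k D a t) by now apply poincare_term_dual.
  assert (E2 : poincare_term K k (- dl, a)%Z z = dual_term K k D a t).
  { rewrite <- E1. rewrite <- (Z.opp_involutive a) at 1. now apply poincare_term_opp. }
  assert (E3 : poincare_term K k (0, -1)%Z z = poincare_term K k (0, 1)%Z z).
  { apply (poincare_term_opp kap k 0 1 z Hz). }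
  assert (E4 : Cmod (poincare_term K k (0, 1)%Z z) = exp (- (2 * PI * INR k * t))).
  { rewrite (poincare_term_eq K k 1 0 0 1 z eq_refl Hz).
    assert (U : zlin 0 1 z = RtoC 1) by (unfold zlin; ring).
    rewrite U, Cpow_1_l. rewrite Cmod_mult, Cmod_inv by apply C1_nz.
    rewrite Cmod_1, Rinv_1, Rmult_1_l, Cmod_nome, im_scal_l.
    replace (zlin 1 0 z / 1)%C with z by (unfold zlin; field).
    unfold z. rewrite im_cusp_line. f_equal. ring. }
  unfold L in Rest. cbn [lsum fold_right] in Rest. rewrite E1, E2, E3 in Rest.
  set (dt := dual_term K k D a t) in *. set (pt := poincare_term K k (0, 1)%Z z) in *.
  set (P := poincare K k z) in *.
  assert (F : Cmod (P - 2 * dt) <= b * 25 * / t ^ m + 2 * exp (- (2 * PI * INR k * t))).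
  { replace (P - 2 * dt)%C with ((P - (dt + (dt + (pt + (pt + 0))))) + (pt + pt))%C by ring.
    apply Rle_trans with (1 := Cmod_triangle _ _).
    assert (Q := Cmod_triangle pt pt). lra. }
  apply Rle_trans with ((b * 25 * / t ^ m + 2 * exp (- (2 * PI * INR k * t))) * t ^ m).
  - apply Rmult_le_compat_r; lra.
  - right. field. lra.
Qed.

(** * Integrals over the half-line *)

Lemma filter_prod_half_line (P : R * R -> Prop) : (forall a b, 0 < a <= b -> P (a, b)) ->
  filter_prod (at_right 0) (Rbar_locally p_infty) P.
Proof.
  intros HP. exists (fun a => 0 < a < 1) (fun b => 1 < b).
  - exists (mkposreal 1 Rlt_0_1). intros y Hy Hy0. split; [easy |].
    change (Rabs (y - 0) < 1) in Hy. rewrite Rminus_0_r, Rabs_pos_eq in Hy; lra.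
  - exists 1. auto.
  - intros a b Ha Hb. apply HP. lra.
Qed.

Lemma is_RInt_gen_of_limits {V : NormedModule R_AbsRing} (f Phi : R -> V) (A B : V) :
  (forall a b, 0 < a <= b -> is_RInt f a b (minus (Phi b) (Phi a))) ->
  filterlim Phi (at_right 0) (locally A) ->
  filterlim Phi (Rbar_locally p_infty) (locally B) ->
  is_RInt_gen f (at_right 0) (Rbar_locally p_infty) (minus B A).
Proof.
  intros H HA HB P HP.
  assert (L : filterlim (fun ab : R * R => minus (Phi (snd ab)) (Phi (fst ab)))
                (filter_prod (at_right 0) (Rbar_locally p_infty)) (locally (minus B A))).
  { apply (filterlim_comp_2 (G := locally B) (H := locally (opp A))
             (fun ab : R * R => Phi (snd ab)) (fun ab : R * R => opp (Phi (fst ab))) plus).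
    - apply filterlim_comp with (2 := HB). apply filterlim_snd.
    - apply filterlim_comp with (2 := filterlim_opp A).
      apply filterlim_comp with (2 := HA). apply filterlim_fst.
    - apply filterlim_plus. }
  specialize (L P HP). unfold filtermap in L.
  assert (Q := filter_prod_half_line (fun ab : R * R => 0 < fst ab <= snd ab) (fun a b H => H)).
  unfold filtermapi. apply filter_imp with (2 := filter_and _ _ L Q).
  intros [a b] [L' Q']. simpl in *. exists (minus (Phi b) (Phi a)). split; [now apply H | easy].
Qed.

(** A comparison test with an explicit primitive [Gam] of the dominating function: increments of the
    integral of [f] are bounded by those of [Gam], so Cauchy's criterion holds at both ends, and the
    same domination bounds the value. *)
Lemma comparison_RInt_gen (f : R -> C) (g Gam : R -> R) (A B : R) :
  (forall t, 0 < t -> ccont f t) ->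
  (forall t, 0 < t -> Cmod (f t) <= g t) ->
  (forall a b, 0 < a <= b -> is_RInt (V := R_NormedModule) g a b (minus (Gam b) (Gam a))) ->
  filterlim Gam (at_right 0) (locally A) ->
  filterlim Gam (Rbar_locally p_infty) (locally B) ->
  exists v, is_RInt_gen (V := C_R_NormedModule) f (at_right 0) (Rbar_locally p_infty) v /\
    Cmod v <= B - A.
Proof.
  intros Hc Hb Hg HA HB.
  set (Phi := fun t => RInt (V := C_R_CompleteNormedModule) f 1 t).
  assert (EX : forall a b, 0 < a -> 0 < b -> ex_RInt (V := C_R_CompleteNormedModule) f a b).
  { intros a b Ha Hb'. apply ex_RInt_continuous. intros s Hs. apply ccont_continuous, Hc.
    assert (0 < Rmin a b) by now apply Rmin_pos. lra. }
  assert (IR : forall a b, 0 < a -> 0 < b -> is_RInt (V := C_R_NormedModule) f a b (minus (Phi b) (Phi a))).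
  { intros a b Ha Hb'.
    assert (E : RInt (V := C_R_CompleteNormedModule) f a b = minus (Phi b) (Phi a)).
    { unfold Phi. rewrite <- (RInt_Chasles (V := C_R_CompleteNormedModule) f 1 a b) by (apply EX; lra).
      unfold minus. rewrite plus_comm, plus_assoc. 
      rewrite (plus_opp_l (G := C_R_CompleteNormedModule)). now rewrite plus_zero_l. }
    rewrite <- E. apply (RInt_correct (V := C_R_CompleteNormedModule)). now apply EX. }
  assert (Est : forall a b, 0 < a <= b -> Cmod (Phi b - Phi a) <= Gam b - Gam a).
  { intros a b Hab. rewrite Cmod_norm.
    apply (norm_RInt_le (V := C_R_NormedModule) f g a b); [lra | | apply IR; lra | now apply Hg].
    intros x Hx. change (norm (f x)) with (@norm _ C_R_NormedModule (f x)).
    rewrite <- Cmod_norm. apply Hb. lra. }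
  assert (Est2 : forall a b, 0 < a -> 0 < b -> Cmod (Phi b - Phi a) <= Rabs (Gam b - Gam a)).
  { intros a b Ha Hb'. destruct (Rle_dec a b).
    - apply Rle_trans with (1 := Est a b ltac:(lra)). apply Rle_abs.
    - rewrite Cmod_minus_sym, Rabs_minus_sym.
      apply Rle_trans with (1 := Est b a ltac:(lra)). apply Rle_abs. }
  assert (Cau : forall (F : (R -> Prop) -> Prop) (PF : ProperFilter F) (l : R),
    F (fun t => 0 < t) -> filterlim Gam F (locally l) ->
    exists y : C_R_CompleteNormedModule, filterlim Phi F (locally y)).
  { intros F PF l F0 HF. apply (filterlim_locally_cauchy (U := C_R_CompleteNormedModule)).
    intros eps. assert (E2 : 0 < eps / 2) by (assert (Q := cond_pos eps); lra).
    exists (fun t => 0 < t /\ ball l (mkposreal _ E2) (Gam t)). split.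
    - apply filter_and; [easy |]. apply HF. now exists (mkposreal _ E2).
    - intros u v [U0 U] [V0 V]. change (Rabs (Gam u - l) < eps / 2) in U.
      change (Rabs (Gam v - l) < eps / 2) in V.
      apply (C_NormedModule_mixin_compat1 (Phi u) (Phi v) eps).
      change (Cmod (Phi v - Phi u) < eps).
      apply Rle_lt_trans with (1 := Est2 u v U0 V0).
      replace (Gam v - Gam u) with ((Gam v - l) - (Gam u - l)) by ring.
      apply Rle_lt_trans with (1 := Rabs_triang _ _). rewrite Rabs_Ropp. lra. }
  destruct (Cau (at_right 0) (at_right_proper_filter 0) A) as [vA HvA]; auto.
  { exists (mkposreal 1 Rlt_0_1). auto. }
  destruct (Cau (Rbar_locally p_infty) (Rbar_locally_filter p_infty) B) as [vB HvB]; auto.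
  { exists 0. auto. }
  exists (minus (vB : C_R_NormedModule) vA).
  assert (I : is_RInt_gen (V := C_R_NormedModule) f (at_right 0) (Rbar_locally p_infty) (minus (vB : C_R_NormedModule) vA)).
  { apply (is_RInt_gen_of_limits (V := C_R_NormedModule) f Phi); auto.
    intros a b Hab. apply IR; lra. }
  split; [exact I |].
  rewrite Cmod_norm.
  apply (RInt_gen_norm (V := C_R_CompleteNormedModule) (Fa := at_right 0) (Fb := Rbar_locally p_infty) f g).
  - apply filter_prod_half_line. intros; simpl; lra.
  - apply filter_prod_half_line. intros a b Hab x Hx. simpl in Hx.
    change (norm (f x)) with (@norm _ C_R_NormedModule (f x)).
    rewrite <- Cmod_norm. apply Hb. lra.
  - exact I.
  - now apply (is_RInt_gen_of_limits (V := R_NormedModule) g Gam).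
Qed.

(** The primitive of [t^p exp(- X t)] found by integrating by parts [p] times; it tends to [0] at
    infinity and equals [- p! / X^(p+1)] at [0]. *)
Fixpoint gamma_primitive (X : R) (p : nat) (t : R) : R :=
  match p with
  | O => - exp (- (X * t)) / X
  | S q => - (t ^ p * exp (- (X * t))) / X + INR p / X * gamma_primitive X q t
  end.

Lemma gamma_primitive_derive X p t : 0 < X ->
  is_derive (gamma_primitive X p) t (t ^ p * exp (- (X * t))).
Proof.
  intros HX. induction p as [| p IH].
  - simpl. auto_derive; [easy |]. field. lra.
  - change (gamma_primitive X (S p)) with
      (fun t => - (t ^ S p * exp (- (X * t))) / X + INR (S p) / X * gamma_primitive X p t).
    replace (t ^ S p * exp (- (X * t))) with
      ((- (INR (S p) * t ^ p * exp (- (X * t)) + t ^ S p * (- X * exp (- (X * t)))) / X)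
       + INR (S p) / X * (t ^ p * exp (- (X * t)))) by (field; lra).
    apply (is_derive_plus (K := R_AbsRing) (V := R_NormedModule)).
    + auto_derive; [easy |]. change (match p with 0%nat => 1 | S _ => INR p + 1 end) with (INR (S p)).
      simpl pow. field. lra.
    + apply (is_derive_scal (gamma_primitive X p) t (INR (S p) / X)). exact IH.
Qed.

Lemma gamma_primitive_0 X p : 0 < X -> gamma_primitive X p 0 = - (INR (fact p) / X ^ (S p)).
Proof.
  intros HX. induction p as [| p IH].
  - simpl. rewrite Rmult_0_r, Ropp_0, exp_0. field. lra.
  - change (gamma_primitive X (S p) 0) with
      (- (0 ^ S p * exp (- (X * 0))) / X + INR (S p) / X * gamma_primitive X p 0).
    rewrite IH, pow_i by lia.
    change (fact (S p)) with (S p * fact p)%nat. rewrite mult_INR.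
    change (X ^ S (S p)) with (X * X ^ S p).
    assert (0 < X ^ S p) by now apply pow_lt. field. lra.
Qed.

(** The exponential is the power [p + 1] of [exp (- y)] with [y = X t / (p + 1)], and
    [exp (- y) <= 1/y]. *)
Lemma pow_exp_le (X : R) (p : nat) (t : R) : 0 < X -> 0 < t ->
  t ^ p * exp (- (X * t)) <= ((INR p + 1) / X) ^ (S p) / t.
Proof.
  intros HX Ht. assert (P := pos_INR p).
  set (y := X * t / (INR p + 1)).
  assert (Y : 0 < y) by (unfold y; apply Rdiv_lt_0_compat; nra).
  assert (E : exp (- (X * t)) = exp (- y) ^ S p).
  { rewrite <- Rpower_pow by apply exp_pos. unfold Rpower. rewrite ln_exp, S_INR. f_equal.
    unfold y. field. lra. }
  rewrite E. assert (Q := exp_neg_le_inv y Y). assert (Q0 := exp_pos (- y)).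
  apply Rle_trans with (t ^ p * (/ y) ^ S p).
  - apply Rmult_le_compat_l; [apply pow_le; lra |]. apply pow_incr. lra.
  - right. unfold y. replace (/ (X * t / (INR p + 1))) with ((INR p + 1) / X * / t) by (field; lra).
    rewrite Rpow_mult_distr. change ((/ t) ^ S p) with (/ t * (/ t) ^ p). rewrite (pow_inv t p).
    assert (0 < t ^ p) by now apply pow_lt. field. lra.
Qed.

Lemma gamma_primitive_infty X p : 0 < X -> exists M, forall t, 1 <= t ->
  Rabs (gamma_primitive X p t) <= M / t.
Proof.
  intros HX. 
  assert (S0 : forall q t, 0 < t -> Rabs (- (t ^ q * exp (- (X * t))) / X)
     <= ((INR q + 1) / X) ^ (S q) / X / t).
  { intros q t Ht. unfold Rdiv at 1. rewrite Rabs_mult, Rabs_Ropp, Rabs_inv, (Rabs_pos_eq X) by lra.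
    rewrite Rabs_pos_eq by (apply Rmult_le_pos; [apply pow_le; lra | left; apply exp_pos]).
    assert (Q := pow_exp_le X q t HX Ht).
    apply (Rmult_le_compat_r (/ X)) in Q; [| left; now apply Rinv_0_lt_compat].
    apply Rle_trans with (1 := Q). right. field. lra. }
  induction p as [| p [M IH]].
  - exists (((INR 0 + 1) / X) ^ 1 / X). intros t Ht. specialize (S0 0%nat t ltac:(lra)).
    simpl gamma_primitive. rewrite pow_O, Rmult_1_l in S0. exact S0.
  - exists (((INR (S p) + 1) / X) ^ (S (S p)) / X + INR (S p) / X * M).
    intros t Ht. specialize (S0 (S p) t ltac:(lra)). specialize (IH t Ht).
    change (gamma_primitive X (S p) t) with
      (- (t ^ S p * exp (- (X * t))) / X + INR (S p) / X * gamma_primitive X p t).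
    apply Rle_trans with (1 := Rabs_triang _ _). rewrite (Rabs_mult (INR (S p) / X)).
    assert (I : 0 <= INR (S p) / X) by (apply Rdiv_le_0_compat; [apply pos_INR | easy]).
    rewrite (Rabs_pos_eq (INR (S p) / X)) by easy.
    apply (Rmult_le_compat_l _ _ _ I) in IH.
    unfold Rdiv at 3. rewrite Rmult_plus_distr_r.
    apply Rplus_le_compat; [exact S0 |]. apply Rle_trans with (1 := IH). right.
    unfold Rdiv. ring.
Qed.

Lemma filterlim_of_inverse_bound (f : R -> R) (M : R) :
  (forall t, 1 <= t -> Rabs (f t) <= M / t) -> filterlim f (Rbar_locally p_infty) (locally 0).
Proof.
  intros HM. apply (proj2 (filterlim_locally (U := R_UniformSpace) _ _)). intros eps.
  assert (E0 := cond_pos eps).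
  exists (Rmax 1 ((Rabs M + 1) / eps)). intros t Ht.
  assert (T1 := Rle_lt_trans _ _ _ (Rmax_l _ _) Ht). assert (T2 := Rle_lt_trans _ _ _ (Rmax_r _ _) Ht).
  change (Rabs (f t - 0) < eps). rewrite Rminus_0_r.
  apply Rle_lt_trans with (1 := HM t ltac:(lra)).
  apply (Rmult_lt_compat_r eps) in T2; [| easy].
  unfold Rdiv in T2. rewrite Rmult_assoc, Rinv_l, Rmult_1_r in T2 by lra.
  apply Rmult_lt_reg_r with t; [lra |]. unfold Rdiv. rewrite Rmult_assoc, Rinv_l, Rmult_1_r by lra.
  assert (Q := Rle_abs M). lra.
Qed.

Lemma gamma_primitive_lim_infty X p : 0 < X ->
  filterlim (gamma_primitive X p) (Rbar_locally p_infty) (locally 0).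
Proof.
  intros HX. destruct (gamma_primitive_infty X p HX) as [M HM].
  now apply filterlim_of_inverse_bound with M.
Qed.

Lemma gamma_primitive_continuous X p t : 0 < X -> continuous (gamma_primitive X p) t.
Proof.
  intros HX. apply (ex_derive_continuous (K := R_AbsRing) (V := R_NormedModule)).
  eexists. now apply gamma_primitive_derive.
Qed.

(** With [s = 1/t] the integrand becomes [- s^p exp(- Y s) ds]. This is the shape of the main term:
    the dual term times [t^m], where [p + 2 = K - m]. *)
Lemma inverse_gamma_integral Y p a b : 0 < Y -> 0 < a <= b ->
  is_RInt (V := R_NormedModule) (fun t => / t ^ (p + 2) * exp (- (Y / t))) a b
    (minus (- gamma_primitive Y p (/ b)) (- gamma_primitive Y p (/ a))).
Proof.
  intros HY Hab. apply (is_RInt_derive (V := R_CompleteNormedModule) (fun t => - gamma_primitive Y p (/ t))).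
  - intros t Ht. rewrite Rmin_left, Rmax_right in Ht by lra.
    assert (T : t <> 0) by lra.
    replace (/ t ^ (p + 2) * exp (- (Y / t)))
      with (opp (scal (- / t ^ 2) ((/ t) ^ p * exp (- (Y * / t)))) : R).
    + apply (is_derive_opp (K := R_AbsRing) (V := R_NormedModule) (fun t => gamma_primitive Y p (/ t))).
      apply (is_derive_comp (K := R_AbsRing) (V := R_NormedModule) (gamma_primitive Y p) Rinv).
      * now apply gamma_primitive_derive.
      * auto_derive; [easy |]. field. lra.
    + unfold opp, scal; simpl. unfold mult; simpl. rewrite pow_add, (pow_inv t p).
      unfold Rdiv. assert (0 < t ^ p) by (apply pow_lt; lra). field. lra.
  - intros t Ht. rewrite Rmin_left, Rmax_right in Ht by lra.
    apply (ex_derive_continuous (K := R_AbsRing) (V := R_NormedModule)). auto_derive.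
    assert (0 < t ^ (p + 2)) by (apply pow_lt; lra). repeat split; lra.
Qed.

Lemma is_RInt_RtoC (h : R -> R) a b v : is_RInt (V := R_NormedModule) h a b v ->
  is_RInt (V := C_R_NormedModule) (fun t => RtoC (h t)) a b (RtoC v).
Proof.
  intros H. apply (is_RInt_fct_extend_pair (U := R_NormedModule) (V := R_NormedModule)); [exact H |].
  simpl. assert (I := is_RInt_const (V := R_NormedModule) a b 0).
  unfold scal in I; simpl in I. unfold mult in I; simpl in I. now rewrite Rmult_0_r in I.
Qed.

Lemma filterlim_Cscal_RtoC {T} (F : (T -> Prop) -> Prop) (FF : Filter F) (c : C) (h : T -> R) l :
  filterlim h F (locally l) ->
  filterlim (fun t => (c * RtoC (h t))%C) F (locally (T := C_R_NormedModule) (c * RtoC l)%C).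
Proof.
  intros H. apply (proj2 (filterlim_locally (U := C_R_NormedModule) _ _)). intros eps.
  assert (P := Cmod_ge_0 c). assert (E := cond_pos eps).
  assert (E' : 0 < eps / (Cmod c + 1)) by (apply Rdiv_lt_0_compat; lra).
  assert (H' := proj1 (filterlim_locally (U := R_UniformSpace) h l) H (mkposreal _ E')).
  apply filter_imp with (2 := H'). intros t Ht. change (Rabs (h t - l) < eps / (Cmod c + 1)) in Ht.
  apply (C_NormedModule_mixin_compat1 (c * RtoC l)%C (c * RtoC (h t))%C eps).
  change (Cmod (c * RtoC (h t) - c * RtoC l) < eps).
  replace (c * RtoC (h t) - c * RtoC l)%C with (c * RtoC (h t - l))%C by (rewrite RtoC_minus; ring).
  rewrite Cmod_mult, Cmod_R.
  apply (Rmult_lt_compat_r (Cmod c + 1)) in Ht; [| lra].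
  unfold Rdiv in Ht. rewrite Rmult_assoc, Rinv_l, Rmult_1_r in Ht by lra. nra.
Qed.

Lemma inverse_gamma_RInt_gen (c : C) Y p : 0 < Y ->
  is_RInt_gen (V := C_R_NormedModule)
    (fun t => (c * RtoC (/ t ^ (p + 2) * exp (- (Y / t))))%C)
    (at_right 0) (Rbar_locally p_infty) (c * RtoC (INR (fact p) / Y ^ (S p)))%C.
Proof.
  intros HY.
  assert (G0 : filterlim (fun t => - gamma_primitive Y p (/ t)) (at_right 0) (locally (- 0))).
  { apply (filterlim_comp _ _ _ (fun t => gamma_primitive Y p (/ t)) Ropp _ (locally 0)).
    - apply (filterlim_comp _ _ _ Rinv (gamma_primitive Y p) _ (Rbar_locally p_infty)).
      + apply filterlim_Rinv_0_right.
      + now apply gamma_primitive_lim_infty.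
    - apply (filterlim_opp (K := R_AbsRing) (V := R_NormedModule) 0). }
  assert (G1 : filterlim (fun t => - gamma_primitive Y p (/ t)) (Rbar_locally p_infty)
                 (locally (- - (INR (fact p) / Y ^ (S p))))).
  { apply (filterlim_comp _ _ _ (fun t => gamma_primitive Y p (/ t)) Ropp _
             (locally (- (INR (fact p) / Y ^ (S p))))).
    - rewrite <- gamma_primitive_0 by easy.
      apply (filterlim_comp _ _ _ Rinv (gamma_primitive Y p) _ (locally 0)).
      + apply (filterlim_Rbar_inv p_infty). discriminate.
      + now apply gamma_primitive_continuous.
    - apply (filterlim_opp (K := R_AbsRing) (V := R_NormedModule) _). }
  assert (Lim := is_RInt_gen_of_limits (V := C_R_NormedModule)
    (fun t => (c * RtoC (/ t ^ (p + 2) * exp (- (Y / t))))%C)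
    (fun t => (c * RtoC (- gamma_primitive Y p (/ t)))%C)
    (c * RtoC (- 0))%C (c * RtoC (- - (INR (fact p) / Y ^ (S p))))%C).
  replace (c * RtoC (INR (fact p) / Y ^ (S p)))%C
    with (@minus C_R_NormedModule (c * RtoC (- - (INR (fact p) / Y ^ (S p))))%C (c * RtoC (- 0))%C).
  - apply Lim.
    + intros a b Hab.
      assert (I := is_RInt_Cscal c _ a b _ (is_RInt_RtoC _ a b _ (inverse_gamma_integral Y p a b HY Hab))).
      assert (EQ : forall x y : R, (c * RtoC (@minus R_NormedModule x y))%C
                = @minus C_R_NormedModule (c * RtoC x)%C (c * RtoC y)%C).
      { intros x y. change (c * RtoC (x - y) = c * RtoC x - c * RtoC y)%C.
        rewrite RtoC_minus. ring. }
      rewrite EQ in I. exact I.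
    + apply filterlim_Cscal_RtoC; [apply at_right_proper_filter | exact G0].
    + apply filterlim_Cscal_RtoC; [apply Rbar_locally_filter | exact G1].
  - rewrite Ropp_involutive, Ropp_0.
    assert (EQ : forall x : C, @minus C_R_NormedModule x (c * RtoC 0)%C = x).
    { intros x. change ((x - c * 0)%C = x). ring. }
    apply EQ.
Qed.

Lemma ccont_RtoC (h : R -> R) t : continuous h t -> ccont (fun t => RtoC (h t)) t.
Proof.
  intros H eps He.
  destruct (proj1 (filterlim_locally (U := R_UniformSpace) h (h t)) H (mkposreal eps He)) as [d Hd].
  exists d. split; [apply cond_pos |]. intros s Hs.
  rewrite <- RtoC_minus, Cmod_R. exact (Hd s Hs).
Qed.

Lemma ccont_pow f n s : ccont f s -> ccont (fun t => (f t ^ n)%C) s.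
Proof.
  intros H. induction n as [| n IH]; [apply (ccont_const 1) |].
  apply (ccont_mult f (fun t => (f t ^ n)%C)); easy.
Qed.

Lemma ccont_lsum {T} (f : T -> R -> C) l s : (forall x, ccont (f x) s) ->
  ccont (fun t => lsum (fun x => f x t) l) s.
Proof.
  intros H. induction l as [| x l IH]; [apply (ccont_const 0) |].
  apply (ccont_plus (f x) (fun t => lsum (fun x => f x t) l)); easy.
Qed.

Lemma strip_regular_cusp_line_ccont g D a t : strip_regular g -> 0 < t ->
  ccont (fun t => g (cusp_line D a t)) t.
Proof.
  intros H Ht.
  destruct (H (Rabs (IZR a / INR D)) t Ht) as [B [r [Hr HB]]].
  destruct (HB (cusp_line D a t)) as [_ [d [_ Hd]]];
    [rewrite re_cusp_line; lra | rewrite im_cusp_line; lra |].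
  apply ccont_of_quad with B r (d * Ci)%C; [easy |].
  intros s Hs. specialize (Hd (Ci * RtoC (s - t))%C).
  rewrite Cmod_mult, Cmod_Ci, Cmod_R, Rmult_1_l in Hd. specialize (Hd Hs). rewrite pow2_abs in Hd.
  replace (cusp_line D a s) with (cusp_line D a t + Ci * RtoC (s - t))%C
    by (unfold cusp_line; rewrite RtoC_minus; ring).
  now rewrite <- Cmult_assoc.
Qed.

Lemma period_error_integral (X E Q : R) (m : nat) (f : R -> C) :
  0 < X -> 0 <= E -> 0 <= Q -> (forall t, 0 < t -> ccont f t) ->
  (forall t, 0 < t -> Cmod (f t) <= E * (2 * (t ^ m * exp (- (X * t))) + Q / (1 + t ^ 2))) ->
  exists v, is_RInt_gen (V := C_R_NormedModule) f (at_right 0) (Rbar_locally p_infty) v /\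
    Cmod v <= E * (2 * (INR (fact m) / X ^ (S m)) + 2 * Q).
Proof.
  intros HX HE HQ Hc Hb.
  (* [Q/(1+t^2)] is replaced by the larger [2Q/(1+t)^2], whose primitive is rational; its integral
     over the half-line is the [2Q] of the bound. *)
  set (Gam := fun t => E * (2 * gamma_primitive X m t + 2 * Q * - / (1 + t))).
  set (g := fun t => E * (2 * (t ^ m * exp (- (X * t))) + 2 * Q * / (1 + t) ^ 2)).
  assert (Der : forall t, 0 <= t -> is_derive Gam t (g t)).
  { intros t Ht. apply (is_derive_scal (fun t => 2 * gamma_primitive X m t + 2 * Q * - / (1 + t)) t E).
    apply (is_derive_plus (K := R_AbsRing) (V := R_NormedModule)).
    - apply (is_derive_scal (gamma_primitive X m) t 2). now apply gamma_primitive_derive.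
    - apply (is_derive_scal (fun t => - / (1 + t)) t (2 * Q)). auto_derive; [lra | field; lra]. }
  destruct (gamma_primitive_infty X m HX) as [M HM].
  replace (E * (2 * (INR (fact m) / X ^ S m) + 2 * Q)) with (0 - Gam 0)
    by (unfold Gam; rewrite gamma_primitive_0 by easy; rewrite Rplus_0_r, Rinv_1; ring).
  apply (comparison_RInt_gen f g Gam).
  - exact Hc.
  - intros t Ht. apply Rle_trans with (1 := Hb t Ht). unfold g.
    apply Rmult_le_compat_l; [easy |]. apply Rplus_le_compat_l.
    assert (T := pow2_ge_0 (1 - t)).
    assert (/ (1 + t ^ 2) <= 2 * / (1 + t) ^ 2).
    { replace (2 * / (1 + t) ^ 2) with (/ ((1 + t) ^ 2 / 2)) by (field; lra).
      apply Rinv_le_contravar; nra. }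
    unfold Rdiv. replace (2 * Q * / (1 + t) ^ 2) with (Q * (2 * / (1 + t) ^ 2)) by ring.
    now apply Rmult_le_compat_l.
  - intros a b Hab. apply (is_RInt_derive (V := R_CompleteNormedModule) Gam).
    + intros t Ht. rewrite Rmin_left, Rmax_right in Ht by lra. apply Der. lra.
    + intros t Ht. rewrite Rmin_left, Rmax_right in Ht by lra.
      apply (ex_derive_continuous (K := R_AbsRing) (V := R_NormedModule)). unfold g.
      auto_derive. assert (0 < (1 + t) * ((1 + t) * 1)) by nra. simpl. lra.
  - refine (filterlim_filter_le_1 _ _ (_ : filterlim Gam (locally 0) (locally (Gam 0)))).
    + apply filter_le_within.
    + apply (ex_derive_continuous (K := R_AbsRing) (V := R_NormedModule)).
      eexists. apply Der. lra.
  - apply filterlim_of_inverse_bound with (E * (2 * M + 2 * Q)). intros t Ht.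
    unfold Gam. rewrite Rabs_mult, (Rabs_pos_eq E) by easy.
    replace (E * (2 * M + 2 * Q) / t) with (E * ((2 * M + 2 * Q) * / t)) by (unfold Rdiv; ring).
    apply Rmult_le_compat_l; [easy |].
    apply Rle_trans with (1 := Rabs_triang _ _).
    rewrite !Rabs_mult, Rabs_Ropp, Rabs_inv, (Rabs_pos_eq 2), (Rabs_pos_eq Q), (Rabs_pos_eq (1 + t)) by lra.
    specialize (HM t Ht).
    assert (/ (1 + t) <= / t) by (apply Rinv_le_contravar; lra). unfold Rdiv in HM. nra.
Qed.

(** The part of the main term that does not involve [k]: the factor [2] comes from the pairs
    [+-(D,-a)], [(i D)^(-K)] from [D z - a = i D t], and [i^m i] from [z^m dz] on the imaginary
    axis. *)
Definition period_constant (D : nat) (chi : Z -> C) (K m : nat) : C :=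
  (/ gauss_sum D chi 1 *
   (2 * gauss_sum D (fun a => / chi a)%C 1 *
    (/ (Ci * RtoC (INR D)) ^ K * (Ci ^ m * Ci))))%C.

(** With [m = l - 1] one has [p = K - l - 1]. The main term is subtracted inside the integral and
    integrated exactly by [inverse_gamma_RInt_gen]; only the difference is estimated, through a
    pointwise bound. *)
Lemma twisted_period_poincare (D : nat) (chi : Z -> C) (kap m k p : nat)
    (f : cusp_form (2 * kap)) :
  (1 <= D)%nat -> squarefree D -> primitive_character D chi ->
  (2 <= m)%nat -> (m + 2 <= kap)%nat -> (1 <= k)%nat -> (p + 2 + m = 2 * kap)%nat ->
  (forall z, f z = poincare (2 * kap) k z) ->
  exists v,
    twisted_period m chi f =
      (/ chi (- Z.of_nat k)%Z * period_constant D chi (2 * kap) m *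
       RtoC (INR (fact p) / (2 * PI * INR k / INR D ^ 2) ^ (S p)) + v)%C /\
    Cmod v <= INR D * (2 * (INR (fact m) / (2 * PI * INR k) ^ (S m)) + 2 * (INR D ^ (2 * kap) * 25)).
Proof.
  intros HD Sq Hp Hm Hmk Hk HK Hf. assert (Hc := proj1 Hp).
  set (K := (2 * kap)%nat) in *.
  assert (D1 : 1 <= INR D) by (apply (le_INR 1); easy).
  assert (k1 : 1 <= INR k) by (apply (le_INR 1); easy).
  assert (PP := PI2_1).
  set (X := 2 * PI * INR k). assert (HX : 0 < X) by (unfold X; nra).
  set (Y := X / INR D ^ 2).
  assert (D2 : 0 < INR D ^ 2) by (apply pow_lt; lra).
  assert (HY : 0 < Y) by (unfold Y; now apply Rdiv_lt_0_compat).
  assert (G1 := gauss_sum_ge_1 D chi HD Sq Hp).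
  set (G := gauss_sum D chi 1) in *.
  assert (GN : G <> RtoC 0) by (apply Cmod_gt_0; lra).
  assert (iG : Cmod (/ G) <= 1).
  { rewrite Cmod_inv by easy. rewrite <- Rinv_1. apply Rinv_le_contravar; lra. }
  set (c0 := (/ chi (- Z.of_nat k)%Z * period_constant D chi K m)%C).
  set (h := fun t => / t ^ (p + 2) * exp (- (Y / t))).
  set (S := fun t => lsum (fun a => (/ chi a * poincare K k (cusp_line D a t))%C) (residues D)).
  set (Err := fun t => (/ G * S t * ((Ci * RtoC t) ^ m * Ci) + - c0 * RtoC (h t))%C).
  assert (SR : strip_regular (poincare K k)) by (apply poincare_strip_regular; unfold K; lia).
  assert (CE : forall t, 0 < t -> ccont Err t).
  { intros t Ht. unfold Err. apply ccont_plus.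
    - apply ccont_mult.
      + apply ccont_mult; [apply ccont_const |]. unfold S.
        apply (ccont_lsum (fun a t => (/ chi a * poincare K k (cusp_line D a t))%C)).
        intros a. apply ccont_mult; [apply ccont_const |].
        now apply strip_regular_cusp_line_ccont.
      + apply ccont_mult; [| apply ccont_const]. apply (ccont_pow (fun t => (Ci * RtoC t)%C)).
        apply ccont_mult; [apply ccont_const |].
        apply (ccont_RtoC (fun t => t)). apply continuous_id.
    - apply ccont_mult; [apply ccont_const |]. apply ccont_RtoC. unfold h.
      apply (ex_derive_continuous (K := R_AbsRing) (V := R_NormedModule)). auto_derive.
      assert (0 < t ^ (p + 2)) by (apply pow_lt; lra). repeat split; lra. }
  (* [dual_gauss_sum] spreads the subtracted main term over the residues, so that each translate is
     compared with its own dual term. *)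
  assert (Split : forall t, 0 < t -> Err t =
     (/ G * lsum (fun a => (/ chi a * (poincare K k (cusp_line D a t) - 2 * dual_term K k D a t))%C)
               (residues D) * ((Ci * RtoC t) ^ m * Ci))%C).
  { intros t Ht.
    assert (ND : RtoC (INR D) <> RtoC 0) by (intros Q; apply RtoC_inj in Q; lra).
    assert (NT : RtoC t <> RtoC 0) by (intros Q; apply RtoC_inj in Q; lra).
    assert (Ni := Ci_nz).
    rewrite (lsum_ext _ (fun a => (/ chi a * poincare K k (cusp_line D a t)
       + (- (2) * (/ (Ci * RtoC (INR D * t)) ^ K * RtoC (exp (- (Y / t))))) *
          (/ chi a * root_of_unity D (- (Z.of_nat k * inverse_mod D a))))%C)).
    - rewrite lsum_plus, lsum_scal, dual_gauss_sum by easy. fold (S t).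
      unfold Err, c0, period_constant. fold G. set (g' := gauss_sum D (fun a => / chi a)%C 1).
      unfold h. rewrite RtoC_mult, (RtoC_mult (INR D)), RtoC_inv, RtoC_pow
        by (apply Rgt_not_eq, pow_lt; lra).
      rewrite !Cpow_mult_l.
      replace (RtoC t ^ K)%C with (RtoC t ^ (p + 2) * RtoC t ^ m)%C
        by (rewrite <- Cpow_add_r; f_equal; lia).
      set (ex := RtoC (exp (- (Y / t)))). set (s := S t). set (x := (/ chi (- Z.of_nat k)%Z)%C).
      assert (N1 := Cpow_nz _ K Ni). assert (N2 := Cpow_nz _ K ND).
      assert (N3 := Cpow_nz _ (p + 2) NT). assert (N4 := Cpow_nz _ m NT).
      set (CK := (Ci ^ K)%C) in *. set (DK := (RtoC (INR D) ^ K)%C) in *.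
      set (tp := (RtoC t ^ (p + 2))%C) in *. set (tm := (RtoC t ^ m)%C) in *.
      set (Cm := (Ci ^ m)%C). field. repeat split; easy.
    - intros a _. unfold dual_term. replace (2 * PI * INR k / (INR D ^ 2 * t)) with (Y / t).
      + ring.
      + unfold Y, X. field. lra. }
  assert (Bd : forall t, 0 < t ->
     Cmod (Err t) <= INR D * (2 * (t ^ m * exp (- (X * t))) + INR D ^ K * 25 / (1 + t ^ 2))).
  { intros t Ht. rewrite Split by easy. rewrite !Cmod_mult, Cmod_pow, Cmod_mult, Cmod_Ci, Cmod_R.
    rewrite (Rabs_pos_eq t), Rmult_1_l, Rmult_1_r by lra.
    assert (Tm : 0 < t ^ m) by now apply pow_lt.
    set (bb := 2 * (t ^ m * exp (- (X * t))) + INR D ^ K * 25 / (1 + t ^ 2)).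
    assert (bb0 : 0 <= bb).
    { unfold bb. assert (E0 := exp_pos (- (X * t))). assert (0 <= INR D ^ K) by (apply pow_le; lra).
      assert (0 <= t ^ 2) by apply pow2_ge_0.
      assert (0 <= INR D ^ K * 25 / (1 + t ^ 2)) by (apply Rdiv_le_0_compat; lra). nra. }
    assert (LS : Cmod (lsum (fun a => (/ chi a * (poincare K k (cusp_line D a t) - 2 * dual_term K k D a t))%C)
               (residues D)) <= INR D * (bb * / t ^ m)).
    { apply Rle_trans with (1 := Cmod_lsum_le _ _).
      rewrite <- (length_residues D) at 2. rewrite <- rsum_const. apply rsum_le. intros a _.
      assert (It : 0 < / t ^ m) by now apply Rinv_0_lt_compat.
      destruct (Z.eq_dec (Z.gcd a (Z.of_nat D)) 1) as [Ga | Ga].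
      - assert (B := poincare_at_rational kap m k D a t HD Hm Hmk Ga Ht). fold K X in B.
        replace (INR D ^ K / (1 + t ^ 2) * 25) with (INR D ^ K * 25 / (1 + t ^ 2)) in B
          by (unfold Rdiv; ring).
        fold bb in B. rewrite Cmod_mult.
        assert (L1 := character_le_1 D _ a HD (inverse_character D chi Hc)). cbv beta in L1.
        set (w := Cmod (poincare K k (cusp_line D a t) - 2 * dual_term K k D a t)) in *.
        assert (W0 : 0 <= w) by apply Cmod_ge_0.
        assert (w <= bb * / t ^ m).
        { apply Rmult_le_reg_r with (t ^ m); [easy |]. rewrite Rmult_assoc, Rinv_l; lra. }
        nra.
      - assert (N : chi a = RtoC 0).
        { apply NNPP. intros N. apply Ga. now apply (dirichlet_support _ _ Hc). }
        rewrite N, Cinv_0, Cmult_0_l, Cmod_0. apply Rmult_le_pos; lra. }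
    set (ll := Cmod (lsum _ _)) in *. assert (L0 : 0 <= ll) by apply Cmod_ge_0.
    apply Rle_trans with (INR D * (bb * / t ^ m) * t ^ m).
    - apply Rmult_le_compat_r; [lra |]. nra.
    - right. field. lra. }
  destruct (period_error_integral X (INR D) (INR D ^ K * 25) m Err HX ltac:(lra)) as [v [Iv Bv]]; auto.
  { assert (0 <= INR D ^ K) by (apply pow_le; lra). lra. }
  exists v. split; [| exact Bv].
  assert (Im' := inverse_gamma_RInt_gen c0 Y p HY).
  assert (I := is_RInt_gen_plus (V := C_R_NormedModule) _ _ _ _ Im' Iv).
  unfold twisted_period. apply (is_RInt_gen_unique (V := C_R_CompleteNormedModule)).
  refine (is_RInt_gen_ext (V := C_R_NormedModule) _ _ _ _ I).
  apply filter_prod_half_line. intros a b Hab t Ht. simpl in Ht. rewrite Rmin_left, Rmax_right in Ht by lra.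
  change ((c0 * RtoC (h t) + Err t)%C = (twist chi f (Ci * RtoC t) * (Ci * RtoC t) ^ m * Ci)%C).
  assert (TF := twist_formula D chi K f (Ci * RtoC t) HD Sq Hp).
  rewrite (lsum_ext _ (fun a => (/ chi a * poincare K k (cusp_line D a t))%C)) in TF
    by (intros; now rewrite Hf).
  fold G (S t) in TF. unfold Err. rewrite <- TF by (simpl; lra). field. easy.
Qed.

(** * Linear independence *)

Lemma pow_fact_dominated (B c : R) : 0 <= B -> 0 < c ->
  exists N, forall p, (N <= p)%nat -> c * B ^ p <= INR (fact p).
Proof.
  intros HB Hc. destruct (cv_speed_pow_fact B (/ c)) as [N HN]; [now apply Rinv_0_lt_compat |].
  exists N. intros p Hp. specialize (HN p Hp). unfold Rdist in HN.
  assert (F := INR_fact_lt_0 p). rewrite Rminus_0_r, Rabs_pos_eq in HN.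
  - apply (Rmult_lt_compat_r (INR (fact p))) in HN; [| easy].
    unfold Rdiv in HN. rewrite Rmult_assoc, Rinv_l, Rmult_1_r in HN by lra.
    apply (Rmult_lt_compat_l c) in HN; [| easy].
    rewrite <- Rmult_assoc, Rinv_r, Rmult_1_l in HN by lra. lra.
  - apply Rdiv_le_0_compat; [now apply pow_le | easy].
Qed.

Lemma fact_pow_le m q : INR (fact m) * INR (S m) ^ q <= INR (fact (m + q)).
Proof.
  induction q as [| q IH]; [rewrite Nat.add_0_r; simpl; lra |].
  replace (m + S q)%nat with (S (m + q)) by lia. change (fact (S (m + q))) with (S (m + q) * fact (m + q))%nat.
  rewrite mult_INR. change (INR (S m) ^ S q) with (INR (S m) * INR (S m) ^ q).
  assert (INR (S m) <= INR (S (m + q))) by (apply le_INR; lia).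
  assert (P := pos_INR (S m)). assert (F := INR_fact_lt_0 (m + q)). nra.
Qed.

(* Against [p!] with [p = 2 kap - m - 2], the delicate range is [m] close to [kap], where
   [p - m] stays bounded and only the factors between [m] and [p] help; for bounded [m] the
   factorial beats everything. *)
Lemma period_error_small (A X0 : R) : 1 <= A -> 1 <= X0 ->
  exists kap0, forall kap m p X, (kap0 <= kap)%nat -> (2 <= m)%nat -> (m + 2 <= kap)%nat ->
    (p + 2 + m = 2 * kap)%nat -> 1 <= X <= X0 ->
    A * (2 * (INR (fact m) / X ^ (S m)) + 2 * (A ^ (2 * kap) * 25))
    <= / A * (INR (fact p) / X ^ (S p)).
Proof.
  intros HA HX0.
  (* If [m + 1 >= 4 A^2 X0], each of the [p - m] factors of [p!/m!] is at least [4 A^2 X0];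
     otherwise [m <= L], and [m!] is bounded. *)
  destruct (INR_unbounded (4 * A ^ 2 * X0)) as [L HL].
  assert (A2 : 1 <= A ^ 2) by nra.
  assert (AX : 1 <= A ^ 2 * X0) by nra.
  destruct (pow_fact_dominated (A ^ 2 * X0) (100 * A ^ 2 * X0)) as [N1 H1]; [lra | nra |].
  assert (FL := INR_fact_lt_0 L).
  destruct (pow_fact_dominated X0 (4 * A ^ 2 * INR (fact L))) as [N2 H2]; [lra | nra |].
  exists (N1 + N2)%nat. intros kap m p X Hk Hm Hmk Hp HX.
  specialize (H1 p ltac:(lia)). specialize (H2 p ltac:(lia)).
  assert (Xp : 0 < X ^ S p) by (apply pow_lt; lra).
  assert (Xm : 0 < X ^ S m) by (apply pow_lt; lra).
  assert (Fm := INR_fact_lt_0 m).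
  (* Since [p >= kap], [A^(2 kap)] is at most [(A^2)^p], which [p!] dominates. *)
  assert (Q1 : 50 * A ^ 2 * (A ^ (2 * kap) * X ^ S p) <= INR (fact p) / 2).
  { assert (A ^ (2 * kap) <= (A ^ 2) ^ p).
    { rewrite <- pow_mult. apply Rle_pow; [lra | lia]. }
    assert (X ^ S p <= X0 * X0 ^ p).
    { change (X0 * X0 ^ p) with (X0 ^ S p). apply pow_incr. lra. }
    assert (P1 : 0 < A ^ (2 * kap)) by (apply pow_lt; lra).
    assert (A ^ (2 * kap) * X ^ S p <= (A ^ 2) ^ p * (X0 * X0 ^ p))
      by (apply Rmult_le_compat; lra).
    rewrite Rpow_mult_distr in H1. nra. }
  assert (Q2 : 2 * A ^ 2 * (INR (fact m) * X ^ (p - m)) <= INR (fact p) / 2).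
  { assert (Xi : X ^ (p - m) <= X0 ^ (p - m)) by (apply pow_incr; lra).
    assert (X00 : 0 < X0 ^ (p - m)) by (apply pow_lt; lra).
    destruct (Rle_dec (4 * A ^ 2 * X0) (INR (S m))) as [C | C].
    - assert (F := fact_pow_le m (p - m)). replace (m + (p - m))%nat with p in F by lia.
      assert (G : (4 * A ^ 2 * X0) ^ (p - m) <= INR (S m) ^ (p - m)) by (apply pow_incr; nra).
      rewrite Rpow_mult_distr in G.
      assert (G2 : 4 * A ^ 2 <= (4 * A ^ 2) ^ (p - m)).
      { rewrite <- (pow_1 (4 * A ^ 2)) at 1. apply Rle_pow; [lra | lia]. }
      assert (4 * A ^ 2 * X0 ^ (p - m) <= INR (S m) ^ (p - m)) by nra.
      assert (INR (fact m) * X ^ (p - m) <= INR (fact m) * X0 ^ (p - m))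
        by (apply Rmult_le_compat_l; lra).
      nra.
    - assert (ML : (m <= L)%nat).
      { apply INR_le. rewrite S_INR in C. lra. }
      assert (INR (fact m) <= INR (fact L)) by (apply le_INR, fact_le, ML).
      assert (X0 ^ (p - m) <= X0 ^ p) by (apply Rle_pow; [lra | lia]).
      assert (INR (fact m) * X ^ (p - m) <= INR (fact L) * X0 ^ p)
        by (apply Rmult_le_compat; try lra; apply pow_le; lra).
      nra. }
  apply Rmult_le_reg_l with (A * X ^ S p); [apply Rmult_lt_0_compat; lra |].
  replace (A * X ^ S p * (/ A * (INR (fact p) / X ^ S p))) with (INR (fact p)) by (field; lra).
  replace (A * X ^ S p * (A * (2 * (INR (fact m) / X ^ S m) + 2 * (A ^ (2 * kap) * 25))))
    with (2 * A ^ 2 * (INR (fact m) * (X ^ S p / X ^ S m)) + 50 * A ^ 2 * (A ^ (2 * kap) * X ^ S p))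
    by (field; lra).
  replace (X ^ S p / X ^ S m) with (X ^ (p - m)); [lra |].
  replace (S p) with (p - m + S m)%nat by lia. rewrite pow_add. field. lra.
Qed.

(** A discrete convex function: its slope [2 l_r + 1] from [r] to [r + 1] lies strictly between
    [2 l_r] and [2 l_(r+1)]. It is the exponent of [M] in the scaling that makes the diagonal
    dominant. *)
Fixpoint exponent_potential (l : nat -> nat) (i : nat) : nat :=
  match i with
  | O => 0
  | S r => exponent_potential l r + (2 * l r + 1)
  end.

(** With [S] the potential, [S_j - 2 j l_i] strictly decreases in [j] up to [j = i] and strictly
    increases afterwards, because the slopes of [S] pass [2 l_i] at [i]. The gap [1] becomes a
    factor [M]. *)
Lemma exponent_potential_gap (l : nat -> nat) (n i j : nat) :
  (forall i j : nat, (1 <= i)%nat -> (i < j)%nat -> (j <= n)%nat -> (l i < l j)%nat) ->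
  (1 <= i <= n)%nat -> (1 <= j <= n)%nat -> i <> j ->
  (2 * j * l i + exponent_potential l i + 1 <= 2 * i * l i + exponent_potential l j)%nat.
Proof.
  intros Hl Hi Hj N.
  assert (Up : forall q, (i + q <= n)%nat ->
    (exponent_potential l i + q * (2 * l i + 1) <= exponent_potential l (i + q))%nat).
  { induction q as [| q IH]; intros H; [replace (i + 0)%nat with i by lia; lia |].
    replace (i + S q)%nat with (S (i + q)) by lia. cbn [exponent_potential].
    specialize (IH ltac:(lia)).
    assert (l i <= l (i + q)%nat)%nat.
    { destruct q; [replace (i + 0)%nat with i by lia; lia |]. assert (l i < l (i + S q))%nat by (apply Hl; lia). lia. }
    nia. }
  assert (Down : forall q, (q < i)%nat ->
    (exponent_potential l i + q <= exponent_potential l (i - q) + 2 * q * l i)%nat).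
  { induction q as [| q IH]; intros H; [replace (i - 0)%nat with i by lia; lia |].
    specialize (IH ltac:(lia)).
    replace (i - q)%nat with (S (i - S q)) in IH by lia. cbn [exponent_potential] in IH.
    assert (l (i - S q) < l i)%nat by (apply Hl; lia). nia. }
  destruct (Nat.lt_ge_cases i j) as [C | C].
  - specialize (Up (j - i)%nat ltac:(lia)). replace (i + (j - i))%nat with j in Up by lia.
    nia.
  - specialize (Down (i - j)%nat ltac:(lia)). replace (i - (i - j))%nat with j in Down by lia.
    nia.
Qed.

Lemma exists_max (n : nat) (y : nat -> R) : (1 <= n)%nat ->
  exists j, (1 <= j <= n)%nat /\ forall i, (1 <= i <= n)%nat -> y i <= y j.
Proof.
  induction n as [| n IH]; intros Hn; [lia |].
  destruct (Nat.eq_dec n 0) as [-> | N0].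
  - exists 1%nat. split; [lia |]. intros i Hi. replace i with 1%nat by lia. lra.
  - destruct (IH ltac:(lia)) as [j [Hj H]].
    destruct (Rle_dec (y j) (y (S n))) as [C | C].
    + exists (S n). split; [lia |]. intros i Hi. destruct (Nat.eq_dec i (S n)) as [-> | Ni]; [lra |].
      specialize (H i ltac:(lia)). lra.
    + exists j. split; [lia |]. intros i Hi. destruct (Nat.eq_dec i (S n)) as [-> | Ni]; [lra |].
      apply H. lia.
Qed.

Lemma lsum_zero_isolate {T} (f : T -> C) (l : list T) (j : T) (B : R) :
  NoDup l -> In j l -> lsum f l = RtoC 0 -> 0 <= B ->
  (forall i, In i l -> i <> j -> Cmod (f i) <= B) -> Cmod (f j) <= INR (length l) * B.
Proof.
  intros Nd Hj H HB Hb. destruct (in_split j l Hj) as [l1 [l2 ->]].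
  rewrite lsum_app in H. simpl in H.
  assert (E : f j = (- lsum f (l1 ++ l2))%C).
  { rewrite lsum_app. transitivity (lsum f l1 + (f j + lsum f l2) - lsum f l1 - lsum f l2)%C; [ring |].
    rewrite H. ring. }
  rewrite E, Cmod_opp. apply Rle_trans with (1 := Cmod_lsum_le _ _).
  apply Rle_trans with (rsum (fun _ => B) (l1 ++ l2)).
  - apply rsum_le. intros i Hi. apply Hb.
    + apply in_app_iff in Hi. apply in_app_iff. simpl. tauto.
    + intros ->. now apply NoDup_remove_2 in Nd.
  - rewrite rsum_const. apply Rmult_le_compat_r; [easy |]. apply le_INR.
    rewrite !length_app. simpl. lia.
Qed.

(* After scaling row [i] by [M ^ exponent_potential i], a generalized Vandermonde matrix with
   nodes [M ^ (2 j)] is diagonally dominant, and stays so under relative errors of size [1/2]. *)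
Lemma perturbed_vandermonde_independent (n M : nat) (l : nat -> nat) (b w : nat -> R)
    (T : nat -> nat -> C) (c : nat -> C) :
  (4 * n <= M)%nat ->
  (forall i j : nat, (1 <= i)%nat -> (i < j)%nat -> (j <= n)%nat -> (l i < l j)%nat) ->
  (forall i, (1 <= i <= n)%nat -> 0 < b i) -> (forall j, (1 <= j <= n)%nat -> 0 < w j) ->
  (forall i j, (1 <= i <= n)%nat -> (1 <= j <= n)%nat ->
     / 2 * (b i * w j * INR M ^ (2 * j * l i)) <= Cmod (T i j)
       <= 3 / 2 * (b i * w j * INR M ^ (2 * j * l i))) ->
  (forall j, (1 <= j <= n)%nat -> lsum (fun i => (c i * T i j)%C) (seq 1 n) = RtoC 0) ->
  forall i, (1 <= i <= n)%nat -> c i = RtoC 0.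
Proof.
  intros HM Hl Hb Hw HT H0 i0 Hi0.
  assert (M1 : 4 * INR n <= INR M).
  { replace 4 with (INR 4) by (simpl; ring). rewrite <- mult_INR. now apply le_INR. }
  assert (n1 : 1 <= INR n) by (apply (le_INR 1); lia).
  set (S := exponent_potential l).
  assert (P : forall e, 0 < INR M ^ e) by (intros; apply pow_lt; lra).
  (* Up to the factor [w i], the diagonal term of index [i] scaled by the potential. The equation
     exploited is the one of index [j] where [y] is largest. *)
  set (y := fun i => Cmod (c i) * b i * INR M ^ (2 * i * l i) / INR M ^ S i).
  destruct (exists_max n y ltac:(lia)) as [j [Hj Hmax]].
  assert (Y0 : 0 <= y j).
  { unfold y. apply Rdiv_le_0_compat; [| apply P]. specialize (Hb j Hj).
    specialize (P (2 * j * l j)%nat). mult_nonneg; try lra. apply Cmod_ge_0. }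
  set (W := w j * INR M ^ S j).
  assert (W0 : 0 < W) by (apply Rmult_lt_0_compat; [now apply Hw | apply P]).
  assert (I := lsum_zero_isolate (fun i => (c i * T i j)%C) (seq 1 n) j (3 / 2 * (W * y j) / INR M)
    (seq_NoDup _ _) ltac:(apply in_seq; lia) (H0 j Hj)).
  rewrite length_seq in I.
  assert (Wy : 0 <= W * y j) by (apply Rmult_le_pos; lra).
  assert (Cj : / 2 * (W * y j) <= Cmod (c j * T j j)).
  { rewrite Cmod_mult. destruct (HT j j Hj Hj) as [L _].
    replace (/ 2 * (W * y j)) with (Cmod (c j) * (/ 2 * (b j * w j * INR M ^ (2 * j * l j)))).
    - apply Rmult_le_compat_l; [apply Cmod_ge_0 | easy].
    - unfold W, y. field. specialize (P (S j)). lra. }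
  assert (Off : Cmod (c j * T j j) <= INR n * (3 / 2 * (W * y j) / INR M)).
  { apply I; [apply Rdiv_le_0_compat; lra |].
    intros i Hi Nij. apply in_seq in Hi.
    rewrite Cmod_mult. destruct (HT i j ltac:(lia) Hj) as [_ U].
    specialize (Hmax i ltac:(lia)).
    assert (Hbi := Hb i ltac:(lia)). assert (Hwj := Hw j Hj).
    assert (G := exponent_potential_gap l n i j Hl ltac:(lia) Hj Nij). fold S in G.
    assert (G' : INR M ^ (2 * j * l i) * INR M ^ S i * INR M <= INR M ^ (2 * i * l i) * INR M ^ S j).
    { rewrite <- (pow_1 (INR M)) at 3. rewrite <- !pow_add. apply Rle_pow; [lra | easy]. }
    apply Rle_trans with (Cmod (c i) * (3 / 2 * (b i * w j * INR M ^ (2 * j * l i)))).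
    { apply Rmult_le_compat_l; [apply Cmod_ge_0 | easy]. }
    apply Rle_trans with (3 / 2 * (W * y i) / INR M).
    - assert (Si := P (S i)). assert (c0 := Cmod_ge_0 (c i)).
      assert (Q : INR M ^ (2 * j * l i) <= INR M ^ (2 * i * l i) * INR M ^ S j / (INR M ^ S i * INR M)).
      { apply Rmult_le_reg_r with (INR M ^ S i * INR M); [nra |].
        unfold Rdiv. rewrite (Rmult_assoc _ (/ _)), Rinv_l by nra. lra. }
      replace (3 / 2 * (W * y i) / INR M) with (Cmod (c i) * (3 / 2 * (b i * w j *
        (INR M ^ (2 * i * l i) * INR M ^ S j / (INR M ^ S i * INR M)))))
        by (unfold W, y; field; lra).
      apply Rmult_le_compat_l; [easy |]. apply Rmult_le_compat_l; [lra |].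
      apply Rmult_le_compat_l; [| easy]. apply Rmult_le_pos; lra.
    - unfold Rdiv. apply Rmult_le_compat_r; [left; apply Rinv_0_lt_compat; lra |].
      apply Rmult_le_compat_l; [lra |]. apply Rmult_le_compat_l; lra. }
  (* The off-diagonal terms are each at most [3/(2M)] times [W y_j], hence together at most [3/8] of
     it as [4n <= M], whereas the diagonal term is at least [1/2] of it. *)
  assert (Z : W * y j = 0).
  {
    replace (INR n * (3 / 2 * (W * y j) / INR M)) with ((INR n * / INR M) * (3 / 2 * (W * y j)))
      by (field; lra).
    assert (INR n * / INR M <= / 4).
    { apply Rmult_le_reg_r with (INR M); [lra |]. rewrite Rmult_assoc, Rinv_l; lra. }
    nra. }
  assert (yj : y j = 0) by (apply Rmult_integral in Z; destruct Z; lra).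
  assert (y0 : y i0 <= 0) by (rewrite <- yj; now apply Hmax).
  apply Cmod_eq_0. assert (c0 := Cmod_ge_0 (c i0)).
  assert (Q : 0 < b i0 * INR M ^ (2 * i0 * l i0) / INR M ^ S i0).
  { apply Rdiv_lt_0_compat; [apply Rmult_lt_0_compat; [now apply Hb | apply P] | apply P]. }
  replace (y i0) with (Cmod (c i0) * (b i0 * INR M ^ (2 * i0 * l i0) / INR M ^ S i0)) in y0
    by (unfold y, Rdiv; ring).
  nra.
Qed.

Lemma sum_n_m_lsum (f : nat -> C) n :
  sum_n_m (G := C_AbelianMonoid) f 1 n = lsum f (seq 1 n).
Proof.
  induction n as [| n IH].
  - now rewrite sum_n_m_zero by lia.
  - rewrite sum_n_Sm, IH, seq_S, lsum_app by lia. simpl.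
    change (plus (lsum f (seq 1 n)) (f (S n))) with (lsum f (seq 1 n) + f (S n))%C.
    match goal with |- ?x = ?y => change (@eq C x y) end. ring.
Qed.

(** [character_le_1] applies both to [chi] and to its inverse. *)
Lemma character_unit_norm D chi a : (1 <= D)%nat -> dirichlet_character D chi ->
  chi a <> RtoC 0 -> Cmod (chi a) = 1.
Proof.
  intros HD Hc N. apply Rle_antisym; [now apply character_le_1 with D |].
  assert (L := character_le_1 D _ a HD (inverse_character D chi Hc)). cbv beta in L.
  rewrite Cmod_inv in L by easy. assert (P : 0 < Cmod (chi a)) by now apply Cmod_gt_0.
  apply (Rmult_le_compat_r (Cmod (chi a))) in L; [| lra]. rewrite Rinv_l in L; lra.
Qed.

(** One Gauss sum has modulus at least [1], the other at most [D] by counting terms. The bound is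
    the same for all [chi] modulo [D], as [K_0] precedes [chi]. *)
Lemma period_constant_bound D chi K m : (1 <= D)%nat -> squarefree D -> primitive_character D chi ->
  2 * / INR D * / INR D ^ K <= Cmod (period_constant D chi K m).
Proof.
  intros HD Sq Hp.
  assert (G1 := gauss_sum_ge_1 D chi HD Sq Hp).
  assert (G2 := gauss_sum_ge_1 D _ HD Sq (inverse_primitive D chi Hp)).
  assert (GU : Cmod (gauss_sum D chi 1) <= INR D).
  { apply Rle_trans with (1 := Cmod_lsum_le _ _).
    rewrite <- (length_residues D) at 2. rewrite <- (Rmult_1_r (INR _)), <- rsum_const.
    apply rsum_le. intros a _. rewrite Cmod_mult, Cmod_root_of_unity, Rmult_1_r.
    apply (character_le_1 D _ a HD (inverse_character D chi (proj1 Hp))). }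
  unfold period_constant.
  assert (DN : (Ci * RtoC (INR D))%C <> RtoC 0).
  { apply Cmult_neq_0; [apply Ci_nz |]. intros Q. apply RtoC_inj in Q. lra. }
  rewrite !Cmod_mult, !Cmod_inv by (try apply Cpow_nz; try easy; apply Cmod_gt_0; lra).
  rewrite !Cmod_pow, !Cmod_mult, Cmod_Ci, !Cmod_R, !Rabs_pos_eq, pow1, !Rmult_1_l, !Rmult_1_r by lra.
  set (g := Cmod (gauss_sum D chi 1)) in *. set (g' := Cmod (gauss_sum D _ 1)) in *.
  assert (DK : 0 < / INR D ^ K) by (apply Rinv_0_lt_compat, pow_lt; lra).
  assert (/ INR D <= / g) by (apply Rinv_le_contravar; lra).
  assert (0 < / INR D) by (apply Rinv_0_lt_compat; lra).
  replace (2 * / INR D * / INR D ^ K) with (/ INR D * (2 * / INR D ^ K)) by ring.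
  apply Rmult_le_compat; try nra.
Qed.

Theorem theorem1p1 :
  forall n D : nat,
    (1 <= n)%nat ->
    (1 <= D)%nat -> Nat.Odd D -> squarefree D ->
  exists K0 : nat,
  forall chi : Z -> C, primitive_character D chi ->
  forall K : nat, Nat.Even K -> (K0 <= K)%nat ->
  forall l : nat -> nat,
    (forall i j : nat, (1 <= i)%nat -> (i < j)%nat -> (j <= n)%nat ->
       (l i < l j)%nat) ->
    (3 <= l 1)%nat ->
    (l n <= (K - 2) / 2)%nat ->
    (forall i : nat, (1 <= i <= n)%nat ->
       chi (-1)%Z = (RtoC (-1) ^ l i)%C) ->
    linearly_independent n
      (fun i (f : cusp_form K) => twisted_period (l i - 1) chi f).
Proof.
  intros n D Hn HD Hodd Sq.
  assert (D1 : 1 <= INR D) by (apply (le_INR 1); easy).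
  assert (PP := PI2_1).
  (* A power of [2] is prime to the odd [D], so [chi] does not vanish at it; the exponent gives
     [4 n <= M], which diagonal dominance asks for. *)
  set (M := (2 ^ (n + 2))%nat).
  assert (M4 : (4 * n <= M)%nat).
  { unfold M. rewrite Nat.pow_add_r. assert (n < 2 ^ n)%nat by (apply Nat.pow_gt_lin_r; lia).
    change (2 ^ 2)%nat with 4%nat. lia. }
  set (kk := fun j => (M ^ (2 * j))%nat).
  assert (kk1 : forall j, (1 <= kk j)%nat).
  { intros j. unfold kk. assert (M ^ (2 * j) <> 0)%nat by (apply Nat.pow_nonzero; lia). lia. }
  (* The largest [2 pi k] among the test series. It depends on [n] only, which keeps the threshold a
     function of [n] and [D]. *)
  set (X0 := 2 * PI * INR (kk n)).
  assert (X01 : 1 <= X0).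
  { assert (1 <= INR (kk n)) by (apply (le_INR 1); apply kk1). unfold X0. nra. }
  destruct (period_error_small (INR D) X0 D1 X01) as [kap0 Hkap].
  (* The [5] keeps the weight large enough for the Poincare series to be cusp forms. *)
  exists (2 * (kap0 + 5))%nat.
  intros chi Hp K [kap ->] HK l Hl Hl1 Hln _ c Hc i Hi.
  assert (Hch := proj1 Hp).
  assert (Li : forall i, (1 <= i <= n)%nat -> (3 <= l i <= kap - 1)%nat).
  { intros r Hr. split.
    - destruct (Nat.eq_dec r 1) as [-> | Nr]; [easy |].
      assert (l 1 < l r)%nat by (apply Hl; lia). lia.
    - assert (L : (l r <= l n)%nat).
      { destruct (Nat.eq_dec r n) as [-> | Nr]; [easy |].
        assert (l r < l n)%nat by (apply Hl; lia). lia. }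
      replace (2 * kap - 2)%nat with ((kap - 1) * 2)%nat in Hln by lia.
      rewrite Nat.div_mul in Hln by lia. lia. }
  set (F := fun j => proj1_sig (constructive_indefinite_description _
              (poincare_cusp_form (2 * kap) (kk j) ltac:(lia) (kk1 j)))).
  assert (HF : forall j z, F j z = poincare (2 * kap) (kk j) z).
  { intros j. unfold F. now destruct (constructive_indefinite_description _ _). }
  assert (Unit : forall j, Cmod (chi (- Z.of_nat (kk j))%Z) = 1).
  { intros j. apply (character_unit_norm D); [easy | easy |].
    assert (N2 : chi 2%Z <> RtoC 0).
    { apply (dirichlet_support _ _ Hch). destruct Hodd as [q Hq]. apply gcd_1_iff.
      exists 1%Z, (Z.of_nat q). lia. }
    assert (Nm : chi (-1)%Z <> RtoC 0).
    { apply (dirichlet_support _ _ Hch). apply gcd_1_iff. exists 0%Z, 1%Z. lia. }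
    assert (Np : forall e, chi (Z.of_nat (2 ^ e)) <> RtoC 0).
    { induction e as [| e IH].
      - simpl. rewrite (character_1 D chi Hch). apply C1_nz.
      - rewrite Nat.pow_succ_r', Nat2Z.inj_mul, (dirichlet_mul _ _ Hch).
        now apply Cmult_neq_0. }
    replace (- Z.of_nat (kk j))%Z with (-1 * Z.of_nat (kk j))%Z by ring.
    rewrite (dirichlet_mul _ _ Hch). apply Cmult_neq_0; [easy |].
    unfold kk, M. rewrite <- Nat.pow_mul_r. apply Np. }
  set (p := fun i => (2 * kap - 1 - l i)%nat).
  set (q := 2 * PI / INR D ^ 2).
  assert (D2 : 0 < INR D ^ 2) by (apply pow_lt; lra).
  assert (q0 : 0 < q) by (apply Rdiv_lt_0_compat; lra).
  (* As [p + 1 = K - l], one has [(q k)^(-(p+1)) = q^(-(p+1)) k^(-K) k^l]: [b] collects the factors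
     attached to [l], [w] is [k^(-K)], and [k^l] with [k = M^(2j)] is the Vandermonde entry. *)
  set (b := fun i => Cmod (period_constant D chi (2 * kap) (l i - 1)) *
                     (INR (fact (p i)) / q ^ S (p i))).
  set (w := fun j => / INR (kk j) ^ (2 * kap)).
  assert (kkR : forall j, 1 <= INR (kk j)) by (intros; apply (le_INR 1); apply kk1).
  assert (pcb : forall m, 0 < Cmod (period_constant D chi (2 * kap) m)).
  { intros m. apply Rlt_le_trans with (2 := period_constant_bound D chi (2 * kap) m HD Sq Hp).
    apply Rmult_lt_0_compat; [| apply Rinv_0_lt_compat, pow_lt; lra].
    assert (0 < / INR D) by (apply Rinv_0_lt_compat; lra). lra. }
  apply (perturbed_vandermonde_independent n M l b w
    (fun i j => twisted_period (l i - 1) chi (F j)) c); auto.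
  - intros r Hr. unfold b. apply Rmult_lt_0_compat; [apply pcb |].
    apply Rdiv_lt_0_compat; [apply INR_fact_lt_0 | now apply pow_lt].
  - intros j Hj. apply Rinv_0_lt_compat, pow_lt. specialize (kkR j). lra.
  - intros r j Hr Hj. specialize (Li r Hr).
    assert (Ep : (p r + 2 + (l r - 1) = 2 * kap)%nat) by (unfold p; lia).
    destruct (twisted_period_poincare D chi kap (l r - 1) (kk j) (p r) (F j) HD Sq Hp
      ltac:(lia) ltac:(lia) (kk1 j) Ep (HF j)) as [v [Ev Bv]].
    rewrite Ev.
    set (X := 2 * PI * INR (kk j)) in *.
    assert (kj := kkR j).
    assert (HX : 1 <= X <= X0).
    { unfold X, X0. split; [nra |]. apply Rmult_le_compat_l; [lra |]. apply le_INR.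
      unfold kk. apply Nat.pow_le_mono_r; lia. }
    assert (Small := Hkap kap (l r - 1)%nat (p r) X ltac:(lia) ltac:(lia) ltac:(lia) Ep HX).
    set (mn := (/ chi (- Z.of_nat (kk j))%Z * period_constant D chi (2 * kap) (l r - 1) *
       RtoC (INR (fact (p r)) / (X / INR D ^ 2) ^ (S (p r))))%C).
    assert (Fp := INR_fact_lt_0 (p r)).
    assert (XD : 0 < X / INR D ^ 2) by (apply Rdiv_lt_0_compat; lra).
    assert (XDp : 0 < (X / INR D ^ 2) ^ S (p r)) by now apply pow_lt.
    assert (Emn : Cmod mn = Cmod (period_constant D chi (2 * kap) (l r - 1)) *
       (INR (fact (p r)) / (X / INR D ^ 2) ^ (S (p r)))).
    { unfold mn. rewrite !Cmod_mult, Cmod_inv, Unit, Rinv_1, Rmult_1_l, Cmod_R, Rabs_pos_eq; auto.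
      - apply Rdiv_le_0_compat; lra.
      - intros Z. assert (U := Unit j). rewrite Z, Cmod_0 in U. lra. }
    assert (Main : Cmod mn = b r * w j * INR M ^ (2 * j * l r)).
    { rewrite Emn. unfold b, w.
      replace (X / INR D ^ 2) with (q * INR (kk j)) by (unfold q, X; field; lra).
      rewrite Rpow_mult_distr.
      replace (INR M ^ (2 * j * l r)) with (INR (kk j) ^ l r)
        by (unfold kk; rewrite pow_INR, <- pow_mult; easy).
      replace (2 * kap)%nat with (S (p r) + l r)%nat by (unfold p; lia). rewrite pow_add.
      assert (0 < INR (kk j) ^ S (p r)) by (apply pow_lt; lra).
      assert (0 < INR (kk j) ^ l r) by (apply pow_lt; lra).
      assert (0 < q ^ S (p r)) by now apply pow_lt.
      field. lra. }
    assert (Vs : Cmod v <= / 2 * Cmod mn).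
    { apply Rle_trans with (1 := Bv). apply Rle_trans with (1 := Small). rewrite Emn.
      assert (PB := period_constant_bound D chi (2 * kap) (l r - 1) HD Sq Hp).
      assert (Xp : 0 < X ^ S (p r)) by (apply pow_lt; lra).
      assert (DK : 0 < INR D ^ (2 * kap)) by (apply pow_lt; lra).
      assert (iD : 0 < / INR D) by (apply Rinv_0_lt_compat; lra).
      assert (E2 : INR (fact (p r)) / (X / INR D ^ 2) ^ S (p r)
                   = INR (fact (p r)) / X ^ S (p r) * INR D ^ (2 * S (p r))).
      { unfold Rdiv at 2. rewrite Rpow_mult_distr, pow_inv, pow_mult.
        assert (0 < (INR D ^ 2) ^ S (p r)) by now apply pow_lt. field. lra. }
      rewrite E2.
      (* Since [p + 1 >= kap], the [D^(2(p+1))] from [(X / D^2)^(p+1)] compensates the [D^(-K)] in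
         the lower bound for [period_constant]. *)
      assert (D3 : INR D ^ (2 * kap) <= INR D ^ (2 * S (p r))) by (apply Rle_pow; [lra | lia]).
      set (z := INR (fact (p r)) / X ^ S (p r)) in *.
      assert (z0 : 0 < z) by (apply Rdiv_lt_0_compat; lra).
      apply Rle_trans with (/ 2 * ((2 * / INR D * / INR D ^ (2 * kap)) * (z * INR D ^ (2 * kap)))).
      - right. field. lra.
      - apply Rmult_le_compat_l; [lra |]. apply Rmult_le_compat; auto.
        + assert (0 < / INR D ^ (2 * kap)) by now apply Rinv_0_lt_compat. mult_nonneg; lra.
        + apply Rmult_le_pos; lra.
        + apply Rmult_le_compat_l; lra. }
    rewrite <- Main. fold mn.
    assert (T1 := Cmod_triangle mn v). assert (T2 := Cmod_ge_minus mn v).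
    split; lra.
  - intros j Hj. rewrite <- sum_n_m_lsum. apply Hc.
Qed.
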